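(* Every minimal Lagrangian immersion $f:S^2\to\mathbb{C}P^2$ is homogeneous, and $f(S^2)$ is, up to isometries of $\mathbb{C}P^2$, contained in $\mathbb{R}P^2$.
   Context: $\mathbb{C}P^2$ carries the Fubini–Study metric and $\mathbb{R}P^2=\{[x]:x\in\mathbb{R}^3\setminus\{0\}\}\subset\mathbb{C}P^2$. For a (conformal) minimal Lagrangian immersion $f:M\to\mathbb{C}P^2$ of a Riemann surface $M$, let $\Gamma^f_M$ be the group of all $\gamma\in\mathrm{Aut}(M)$ (biholomorphic automorphisms) for which there exists $R\in SU(3)$ with $f(\gamma\cdot z)=R\cdot f(z)$ for all $z\in M$. The immersion $f$ is homogeneous if $\Gamma^f_M$ acts transitively on $M$. *)

(* Defs.v *)
From HB Require Import structures.
From mathcomp Require Import all_boot all_order all_algebra.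
From mathcomp Require Import all_classical all_reals all_analysis.
From mathcomp Require Import complex.

Set Implicit Arguments.
Unset Strict Implicit.
Unset Printing Implicit Defensive.

Import Order.TTheory GRing.Theory Num.Theory.
Import numFieldNormedType.Exports.

Local Open Scope classical_set_scope.
Local Open Scope ring_scope.

(* Calculus on open subsets of R^n.  Maps are total; only their values near
   the points under consideration matter. *)

Definition basisv (R : realType) (n : nat) (i : 'I_n) : 'cV[R]_n := delta_mx i 0.

Definition iter_derive (R : realType) (V W : normedModType R) (F : V -> W)
  (s : seq V) : V -> W := foldr (fun v G => 'D_v G) F s.

(* C^oo on an open set U *)
Definition smooth_on (R : realType) (V W : normedModType R) (U : set V)
    (F : V -> W) : Prop :=
  forall (s : seq V) (x : V), U x ->
    {for x, continuous (iter_derive F s)} /\ forall v, derivable (iter_derive F s) x v.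

(* A Riemannian metric in coordinates: p, u, v |-> g_p(u, v) *)
Definition metric (R : realType) (n : nat) : Type :=
  'cV[R]_n -> 'cV[R]_n -> 'cV[R]_n -> R.

Definition gram (R : realType) (n : nat) (g : metric R n) (p : 'cV[R]_n) :
    'M[R]_n :=
  \matrix_(a, b) g p (basisv R a) (basisv R b).

Definition pullback (R : realType) (m n : nat) (g : metric R n)
    (F : 'cV[R]_m -> 'cV[R]_n) : metric R m :=
  fun x u v => g (F x) ('D_u F x) ('D_v F x).

(* Gamma^c_ab of the Levi-Civita connection of g *)
Definition christoffel (R : realType) (n : nat) (g : metric R n)
    (c a b : 'I_n) (p : 'cV[R]_n) : R :=
  let dg (d i j : 'I_n) : R :=
    'D_(basisv R d) (fun q : 'cV[R]_n => gram g q i j : R^o) p in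
  2^-1 * \sum_d invmx (gram g p) c d * (dg a b d + dg b a d - dg d a b).

(* The Levi-Civita covariant derivative of the vector field dF(e_j) along F
   in the direction e_i *)
Definition covariant_hess (R : realType) (m n : nat) (g : metric R n)
    (F : 'cV[R]_m -> 'cV[R]_n) (x : 'cV[R]_m) (i j : 'I_m) : 'cV[R]_n :=
  let d k := 'D_(basisv R k) F in
  'D_(basisv R i) (d j) x +
  \col_c \sum_a \sum_b christoffel g c a b (F x) * d i x a 0 * d j x b 0.

(* The g-orthogonal projection of w onto the normal space of F at x *)
Definition normal_part (R : realType) (m n : nat) (g : metric R n)
    (F : 'cV[R]_m -> 'cV[R]_n) (x : 'cV[R]_m) (w : 'cV[R]_n) : 'cV[R]_n :=
  let d k := 'D_(basisv R k) F x in
  w - \sum_i \sum_j (invmx (gram (pullback g F) x) i j * g (F x) w (d i)) *: d j.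

(* (1/m) times the trace of the second fundamental form with respect to the
   induced metric *)
Definition mean_curvature (R : realType) (m n : nat) (g : metric R n)
    (F : 'cV[R]_m -> 'cV[R]_n) (x : 'cV[R]_m) : 'cV[R]_n :=
  m%:R^-1 *: \sum_i \sum_j invmx (gram (pullback g F) x) i j *:
    normal_part g F x (covariant_hess g F x i j).

(* CP^n as the set of complex lines in C^(n+1) *)
Definition CP (R : realType) (n : nat) : Type :=
  {L : {vspace 'cV[R[i]]_n.+1} | \dim L == 1%N}.

Definition line (R : realType) (n : nat) (L : CP R n) :
    {vspace 'cV[R[i]]_n.+1} := sval L.

(* Some nonzero vector of the line; no definition below depends on which one. *)
Definition generator (R : realType) (n : nat) (L : CP R n) : 'cV[R[i]]_n.+1 :=
  vpick (line L).

(* The Riemann sphere *)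
Definition S2 (R : realType) : Type := CP R 1.

(* C^n is identified with R^(n+n) by (x, y) |-> x + iy. *)
Definition of_real (R : realType) (n : nat) (p : 'cV[R]_(n + n)) :
    'cV[R[i]]_n :=
  \col_k (usubmx p k 0 +i* dsubmx p k 0)%C.

Definition to_real (R : realType) (n : nat) (w : 'cV[R[i]]_n) :
    'cV[R]_(n + n) :=
  col_mx (map_mx (@complex.Re R) w) (map_mx (@complex.Im R) w).

(* Multiplication by i *)
Definition cplxJ (R : realType) (n : nat) (p : 'cV[R]_(n + n)) :
    'cV[R]_(n + n) :=
  col_mx (- dsubmx p) (usubmx p).

(* The vector of C^(n+1) with t in slot k and the entries of w elsewhere *)
Definition insert (R : realType) (n : nat) (k : 'I_n.+1) (t : R[i])
    (w : 'cV[R[i]]_n) : 'cV[R[i]]_n.+1 :=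
  \col_l (if unlift k l is Some l' then w l' 0 else t).

Lemma dim_insert1 (R : realType) (n : nat) (k : 'I_n.+1) (w : 'cV[R[i]]_n) :
  \dim <[insert k 1 w]>%VS == 1%N.
Proof.
have nz : insert k 1 w != 0.
  apply/eqP => /matrixP/(_ k 0).
  by rewrite !mxE unlift_none => /eqP; rewrite oner_eq0.
by rewrite dim_vline nz.
Qed.

(* The k-th affine chart [v] |-> (v_l / v_k)_(l != k) of CP^n, its domain
   {v_k != 0} and its inverse *)
Definition chart (R : realType) (n : nat) (k : 'I_n.+1) (L : CP R n) :
    'cV[R]_(n + n) :=
  let v := generator L in
  to_real (\col_l (v (lift k l) 0 / v k 0)).

Definition chart_dom (R : realType) (n : nat) (k : 'I_n.+1) : set (CP R n) :=
  [set L | generator L k 0 != 0].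

Definition unchart (R : realType) (n : nat) (k : 'I_n.+1)
    (p : 'cV[R]_(n + n)) : CP R n :=
  exist _ <[insert k 1 (of_real p)]>%VS (dim_insert1 k (of_real p)).

(* The expression of f in the charts j, k, and the set where it is defined *)
Definition local_rep (R : realType) (m n : nat) (f : CP R m -> CP R n)
    (j : 'I_m.+1) (k : 'I_n.+1) : 'cV[R]_(m + m) -> 'cV[R]_(n + n) :=
  fun x => chart k (f (unchart j x)).

Definition local_dom (R : realType) (m n : nat) (f : CP R m -> CP R n)
    (j : 'I_m.+1) (k : 'I_n.+1) : set 'cV[R]_(m + m) :=
  [set x | chart_dom k (f (unchart j x))].

Definition smooth (R : realType) (m n : nat) (f : CP R m -> CP R n) : Prop :=
  forall j k, open (local_dom f j k) /\
    smooth_on (local_dom f j k) (local_rep f j k).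

Definition holomorphic (R : realType) (m n : nat) (f : CP R m -> CP R n) :
    Prop :=
  forall j k, open (local_dom f j k) /\
    forall x, local_dom f j k x ->
      differentiable (local_rep f j k) x /\
      forall v, 'd (local_rep f j k) x (cplxJ v) =
                cplxJ ('d (local_rep f j k) x v).

Definition biholomorphic (R : realType) (n : nat) (f : CP R n -> CP R n) :
    Prop :=
  exists f', [/\ cancel f f', cancel f' f, holomorphic f & holomorphic f'].

Definition hdot (R : realType) (n : nat) (a b : 'cV[R[i]]_n) : R[i] :=
  \sum_k a k 0 * (b k 0)^*.

(* The Fubini-Study Hermitian form at [v], evaluated on the images of a and b
   under the differential of C^(n+1) \ {0} -> CP^n at v *)
Definition fs_herm (R : realType) (n : nat) (v a b : 'cV[R[i]]_n) : R[i] :=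
  (hdot a b * hdot v v - hdot a v * hdot v b) / (hdot v v) ^+ 2.

(* The Fubini-Study metric in the k-th affine chart *)
Definition fubini_study (R : realType) (n : nat) (k : 'I_n.+1) :
    metric R (n + n) :=
  fun p u v => complex.Re (fs_herm (insert k 1 (of_real p))
    (insert k 0 (of_real u)) (insert k 0 (of_real v))).

Definition kahler_form (R : realType) (n : nat) (k : 'I_n.+1)
    (p u v : 'cV[R]_(n + n)) : R :=
  fubini_study k p (cplxJ u) v.

Definition fs_isometry (R : realType) (n : nat) (phi : CP R n -> CP R n) :
    Prop :=
  [/\ smooth phi,
      exists phi', [/\ cancel phi phi', cancel phi' phi & smooth phi'] &
      forall j k x, local_dom phi j k x -> forall u v,
        pullback (fubini_study k) (local_rep phi j k) x u v =
        fubini_study j x u v].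

(* RP^n inside CP^n *)
Definition RP (R : realType) (n : nat) : set (CP R n) :=
  [set L | exists2 x : 'cV[R]_n.+1, x != 0 &
     line L = <[map_mx (real_complex R) x]>%VS].

Definition immersion (R : realType) (m n : nat) (f : CP R m -> CP R n) : Prop :=
  smooth f /\
  forall j k x, local_dom f j k x ->
    forall v, 'D_v (local_rep f j k) x = 0 -> v = 0.

(* The induced metric is compatible with the complex structure of S^2: in the
   holomorphic charts it is a positive multiple of the Euclidean one. *)
Definition conformal (R : realType) (n : nat) (f : S2 R -> CP R n) : Prop :=
  forall j k x, local_dom f j k x ->
    exists2 lambda : R, 0 < lambda &
      forall u v, pullback (fubini_study k) (local_rep f j k) x u v =
                  lambda * (u^T *m v) 0 0.

Definition minimal (R : realType) (m n : nat) (f : CP R m -> CP R n) : Prop :=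
  forall j k x, local_dom f j k x ->
    mean_curvature (fubini_study k) (local_rep f j k) x = 0.

(* dim S^2 = 2 is half of dim CP^2, so the vanishing of the pulled-back Kahler
   form is the Lagrangian condition. *)
Definition lagrangian (R : realType) (f : S2 R -> CP R 2) : Prop :=
  forall j k x, local_dom f j k x -> forall u v,
    kahler_form k (local_rep f j k x)
      ('D_u (local_rep f j k) x) ('D_v (local_rep f j k) x) = 0.

Definition minimal_lagrangian_immersion (R : realType) (f : S2 R -> CP R 2) :
    Prop :=
  [/\ immersion f, conformal f, minimal f & lagrangian f].

Definition SU (R : realType) (n : nat) : set 'M[R[i]]_n :=
  [set A | A \is unitarymx /\ \det A = 1].

(* Gamma^f: the automorphisms gamma of S^2 with f (gamma z) = A . f z for some
   A in SU(3), which acts on lines by L |-> A L. *)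
Definition Gamma (R : realType) (f : S2 R -> CP R 2) : set (S2 R -> S2 R) :=
  [set gamma | biholomorphic gamma /\
     exists2 A : 'M[R[i]]_3, SU A & forall z,
       line (f (gamma z)) = (linfun (mulmx A) @: line (f z))%VS].

Definition homogeneous (R : realType) (f : S2 R -> CP R 2) : Prop :=
  forall z w, exists2 gamma, Gamma f gamma & gamma z = w.

(* Main.v *)
(** Let [P] be the orthogonal projector onto the line f(z), a 3x3 matrix of smooth functions of
    a coordinate z, and let A, B be its derivatives with respect to z and its conjugate.
    Conformality, the Lagrangian condition and minimality say that A A P = 0, A B P = B A P = l P
    with l > 0, and that the mixed derivative of P is l (1 - 3 P).  The function
    psi = tr (P A dA) is then holomorphic and is the coefficient of a cubic differential on the
    sphere, so it vanishes (Liouville); once psi = 0 the Schwarzian of l is the coefficient of a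
    quadratic differential and vanishes too.  These two facts close the structure equations:
    E = A A / l^2 is antiholomorphic, its fifth derivative vanishes, and its Taylor expansion at
    one point together with E P = P E = 0 determines P.  The outcome is that
    f [v] = U F(H v) with U unitary, H in GL(2) and F(a, b) =
    (sqrt2 a b^*, |b|^2 - |a|^2, sqrt2 a^* b).  The map F intertwines SU(2) with an irreducible
    three-dimensional representation in SU(3), which gives homogeneity, and a fixed unitary
    change of coordinates makes F real. *)

(* A line has no preferred generator, while its projector ignores scaling: it is smooth on the whole
   coordinate plane, and the conditions on f become polynomial identities between P, A and B. For a
   unit vector e of the line, A sends B e to a multiple of e, e to A e and A e to 0, and B runs
   backwards. So e, A e, B e is an orthogonal basis of C^3 and A A is a nilpotent of rank one
   sending B e to a multiple of A e. Once psi = 0, the lines of A e and B e trace conics of degree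
   2, which accounts for the degree 4 of E in the conjugate coordinate, and f is the middle term
   between them. The Schwarzian enters because its vanishing is a Riccati equation for the conjugate
   logarithmic derivative of l; without it each derivative of E would bring in a new unknown.

   Liouville's theorem is needed only for coefficients of differentials of positive weight. These
   tend to 0 at infinity, so a maximum principle for harmonic functions suffices. *)
From HB Require Import structures.
Require Import Defs.
From mathcomp Require Import all_boot all_order all_algebra.
From mathcomp Require Import all_classical all_reals all_analysis.
From mathcomp Require Import complex ring lra.

Set Implicit Arguments.
Unset Strict Implicit.
Unset Printing Implicit Defensive.

Import Order.TTheory GRing.Theory Num.Theory.
Import numFieldNormedType.Exports.

Local Open Scope classical_set_scope.
Local Open Scope ring_scope.

(** * Smooth maps *)

Section Smooth.
Context {R : realType} {V : normedModType R}.

(** [smooth_on] quantifies over whole sequences of directions; recursion on a finite order suits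
    induction, because the Leibniz and quotient rules express one derivative through functions of
    lower order. *)
Fixpoint Ck (W : normedModType R) (n : nat) (U : set V) (F : V -> W) : Prop :=
  (forall x, U x -> {for x, continuous F} /\ forall v, derivable F x v) /\
  (if n is n'.+1 then forall v, Ck n' U ('D_v F) else True).

Lemma smooth_on_derive (W : normedModType R) (U : set V) (F : V -> W) v :
  smooth_on U F -> smooth_on U ('D_v F).
Proof. by move=> sF s; have := sF (rcons s v); rewrite /iter_derive foldr_rcons. Qed.

Lemma smooth_onP (W : normedModType R) (U : set V) (F : V -> W) :
  smooth_on U F <-> forall n, Ck n U F.
Proof.
split=> [+ n|].
  elim: n F => [|n IH] F sF; first by split=> // x /(sF [::]).
  by split=> [x /(sF [::])//|v]; apply/IH/smooth_on_derive.
move=> cF s; have {cF} := cF (size s); elim/last_ind: s F => [|s v IH] F.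
  by case=> + _ x Ux => /(_ x Ux).
rewrite size_rcons /iter_derive foldr_rcons /= => -[_ /(_ v)] cF x Ux.
exact: (IH _ cF).
Qed.

Lemma Ck0 (W : normedModType R) n (U : set V) (F : V -> W) x : Ck n U F -> U x ->
  {for x, continuous F} /\ forall v, derivable F x v.
Proof. by case: n => [|n] [/(_ x)]. Qed.

Lemma near_eq_continuous (W : normedModType R) (F G : V -> W) x :
  {near x, F =1 G} -> {for x, continuous F} -> {for x, continuous G}.
Proof.
move=> FG cF; apply: (@cvg_trans _ (F @ x)).
  by apply: near_eq_cvg; apply: filterS FG => y.
by rewrite -(nbhs_singleton FG).
Qed.

Lemma Ck_eq (W : normedModType R) n (U : set V) (F G : V -> W) : open U ->
  (forall x, U x -> F x = G x) -> Ck n U F -> Ck n U G.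
Proof.
move=> oU; elim: n F G => [|n IH] F G FG cF; have nFG x (Ux : U x) : {near x, F =1 G}
    by apply: filterS (open_nbhs_nbhs (conj oU Ux)) => y /FG.
- split=> // x Ux; have [cFx dFx] := Ck0 cF Ux.
  split=> [|v]; first exact: near_eq_continuous (nFG x Ux) cFx.
  exact: near_eq_derivable (nFG x Ux) (dFx v).
- split=> [x Ux|v].
    have [cFx dFx] := Ck0 cF Ux.
    split=> [|v]; first exact: near_eq_continuous (nFG x Ux) cFx.
    exact: near_eq_derivable (nFG x Ux) (dFx v).
  apply: IH (cF.2 v) => x Ux.
  by apply: near_eq_derive; exact: nFG.
Qed.

Lemma CkW (W : normedModType R) n (U : set V) (F : V -> W) :
  Ck n.+1 U F -> Ck n U F.
Proof. by elim: n F => [|n IH] F [cF dF]; split=> // v; apply: IH. Qed.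

Lemma Ck_cst (W : normedModType R) n (U : set V) (c : W) : Ck n U (cst c).
Proof.
have D v (d : W) : 'D_v (cst d : V -> W) = cst 0.
  by apply/funext => x; rewrite derive_cst.
have b (d : W) x : {for x, continuous (cst d : V -> W)} /\ forall v, derivable (cst d : V -> W) x v.
  by split=> [|v]; [exact: cvg_cst|exact: derivable_cst].
elim: n c => [|n IH] c.
  by split=> [x _|//]; exact: b.
split=> [x _|v]; first exact: b.
 rewrite D; exact: IH.
Qed.

Lemma CkD (W : normedModType R) n (U : set V) (F G : V -> W) : open U ->
  Ck n U F -> Ck n U G -> Ck n U (F + G).
Proof.
move=> oU; elim: n F G => [|n IH] F G cF cG;
  have b x (Ux : U x) : {for x, continuous (F + G)} /\ forall v, derivable (F + G) x v
    by (have [? ?] := Ck0 cF Ux; have [? ?] := Ck0 cG Ux; split=> [|v];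
      [exact: cvgD|exact: derivableD]).
  by split; [exact: b|].
split=> [|v]; first exact: b.
apply: (Ck_eq oU _ (IH _ _ (cF.2 v) (cG.2 v))) => x Ux.
have [_ dF] := Ck0 cF Ux; have [_ dG] := Ck0 cG Ux.
by rewrite deriveD.
Qed.

Lemma CkM n (U : set V) (F G : V -> R) : open U ->
  Ck n U F -> Ck n U G -> Ck n U (F * G).
Proof.
move=> oU; elim: n F G => [|n IH] F G cF cG;
  have b x (Ux : U x) : {for x, continuous (F * G)} /\ forall v, derivable (F * G) x v
    by (have [? ?] := Ck0 cF Ux; have [? ?] := Ck0 cG Ux; split=> [|v];
      [exact: cvgM|exact: derivableM]).
  by split; [exact: b|].
split=> [|v]; first exact: b.
have := CkD oU (IH _ _ (CkW cF) (cG.2 v)) (IH _ _ (CkW cG) (cF.2 v)).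
apply: Ck_eq => // x Ux.
have [_ dF] := Ck0 cF Ux; have [_ dG] := Ck0 cG Ux.
by rewrite deriveM.
Qed.

Lemma CkV n (U : set V) (F : V -> R) : open U -> (forall x, U x -> F x != 0) ->
  Ck n U F -> Ck n U (fun x => (F x)^-1).
Proof.
move=> oU nF; elim: n F nF => [|n IH] F nF cF;
  have b x (Ux : U x) : {for x, continuous (fun x => (F x)^-1)} /\
      forall v, derivable (fun x => (F x)^-1) x v
    by (have [? ?] := Ck0 cF Ux; split=> [|v];
      [exact: cvgV (nF _ Ux) _|exact: derivableV (nF _ Ux) _]).
  by split; [exact: b|].
split=> [|v]; first exact: b.
have cV := IH _ nF (CkW cF).
have := CkM oU (@Ck_cst R n U (-1)) (CkM oU (CkM oU cV cV) (cF.2 v)).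
apply: Ck_eq => // x Ux.
have [_ dF] := Ck0 cF Ux.
by rewrite deriveV ?nF// !fctE mulN1r scaleNr expr2 invfM.
Qed.

Lemma smooth_on_eq (W : normedModType R) (U : set V) (F G : V -> W) : open U ->
  (forall x, U x -> F x = G x) -> smooth_on U F -> smooth_on U G.
Proof. by move=> oU FG /smooth_onP sF; apply/smooth_onP => n; exact: Ck_eq (sF n). Qed.

Lemma smooth_on_cst (W : normedModType R) (U : set V) (c : W) : smooth_on U (cst c).
Proof. by apply/smooth_onP => n; exact: Ck_cst. Qed.

Lemma smooth_onD (W : normedModType R) (U : set V) (F G : V -> W) : open U ->
  smooth_on U F -> smooth_on U G -> smooth_on U (F + G).
Proof.
by move=> oU /smooth_onP sF /smooth_onP sG; apply/smooth_onP => n; exact: CkD.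
Qed.

Lemma smooth_onM (U : set V) (F G : V -> R) : open U ->
  smooth_on U F -> smooth_on U G -> smooth_on U (F * G).
Proof.
by move=> oU /smooth_onP sF /smooth_onP sG; apply/smooth_onP => n; exact: CkM.
Qed.

Lemma smooth_onV (U : set V) (F : V -> R) : open U -> (forall x, U x -> F x != 0) ->
  smooth_on U F -> smooth_on U (fun x => (F x)^-1).
Proof.
by move=> oU nF /smooth_onP sF; apply/smooth_onP => n; exact: CkV.
Qed.

Lemma smooth_onN (U : set V) (F : V -> R) : open U ->
  smooth_on U F -> smooth_on U (- F).
Proof.
move=> oU sF; have := smooth_onM oU (@smooth_on_cst R U (-1)) sF.
by apply: smooth_on_eq => // x _; rewrite !fctE mulN1r.
Qed.

Lemma smooth_on_cont (W : normedModType R) (U : set V) (F : V -> W) x :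
  smooth_on U F -> U x -> {for x, continuous F}.
Proof. by move=> /(_ [::] x) + Ux => /(_ Ux)[]. Qed.

Lemma smooth_on_derivable (W : normedModType R) (U : set V) (F : V -> W) x v :
  smooth_on U F -> U x -> derivable F x v.
Proof. by move=> /(_ [::] x) + Ux => /(_ Ux)[]. Qed.

Lemma smooth_onS (W : normedModType R) (U U' : set V) (F : V -> W) :
  U' `<=` U -> smooth_on U F -> smooth_on U' F.
Proof. by move=> UU sF s x /UU; exact: sF. Qed.

Lemma smooth_on_mx m n (U : set V) (F : V -> 'M[R]_(m, n)) : open U ->
  smooth_on U F <-> forall i j, smooth_on U (fun x => F x i j : R).
Proof.
move=> oU; split=> [sF i j|sF].
  apply/smooth_onP => k; move/smooth_onP: sF => /(_ k).
  elim: k F => [|k IH] F cF; have b x (Ux : U x) :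
    {for x, continuous (fun x => F x i j)} /\ forall v, derivable (fun x => F x i j) x v
    by (have [cFx dF] := Ck0 cF Ux; split=> [|v];
      [exact: (continuous_comp cFx (@coord_continuous _ _ _ i j _))
      |by move/derivable_mxP: (dF v)]).
  by split; [exact: b|].
split=> [|v]; first exact: b.
  apply: (Ck_eq oU _ (IH _ (cF.2 v))) => x Ux; have [_ dF] := Ck0 cF Ux.
  by rewrite derive_mx ?mxE.
apply/smooth_onP => k; have {}sF i j : Ck k U (fun x => F x i j).
  by move: k; apply/smooth_onP.
elim: k F sF => [|k IH] F cF; have b x (Ux : U x) :
    {for x, continuous F} /\ forall v, derivable F x v.
- split=> [|v]; last first.
    by apply/derivable_mxP => i j; have [_ dF] := Ck0 (cF i j) Ux.
  apply/cvgrPdist_le => /= e e0; near=> y.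
  rewrite /Num.Def.normr/= mx_normrE (bigmax_le _ (ltW e0))//= => i _.
  rewrite !mxE/=; move: i; near: y; apply: filter_forall => /= i.
  exact: ((cvgrPdist_le _ _).1 (Ck0 (cF i.1 i.2) Ux).1).
- by split=> [x Ux|]; first exact: b.
- split=> [|v]; last first.
    by apply/derivable_mxP => i j; have [_ dF] := Ck0 (cF i j) Ux.
  apply/cvgrPdist_le => /= e e0; near=> y.
  rewrite /Num.Def.normr/= mx_normrE (bigmax_le _ (ltW e0))//= => i _.
  rewrite !mxE/=; move: i; near: y; apply: filter_forall => /= i.
  exact: ((cvgrPdist_le _ _).1 (Ck0 (cF i.1 i.2) Ux).1).
- split=> [x Ux|v]; first exact: b; apply: IH => i j; apply: (Ck_eq oU _ ((cF i j).2 v)) => x Ux.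
  by rewrite derive_mx ?mxE//; have [] := b x Ux.
Unshelve. all: by end_near. Qed.

End Smooth.

Lemma smooth_on_coord (R : realType) m n (U : set 'M[R]_(m, n)) i j : open U ->
  smooth_on U (fun x : 'M[R]_(m, n) => x i j : R).
Proof.
move=> oU; suff /(smooth_on_mx _ oU) : smooth_on U (@id 'M[R]_(m, n)) by [].
apply/smooth_onP => -[|k].
  by split=> // x _; split=> [|v]; [exact: cvg_id|exact: derivable_id].
split=> [x _|v]; first by split=> [|v]; [exact: cvg_id|exact: derivable_id].
rewrite (_ : 'D_v _ = cst v); first exact: Ck_cst.
by apply/funext => x; rewrite derive_id.
Qed.

(** * Complex-valued functions through their real and imaginary parts *)

Section ComplexCalculus.
Context {R : realType} {V : normedModType R}.
Implicit Types (f g : V -> R[i]) (U : set V).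

Definition csmooth U f : Prop :=
  smooth_on U (fun x => complex.Re (f x)) /\ smooth_on U (fun x => complex.Im (f x)).

Definition cD (v : V) f (x : V) : R[i] :=
  ('D_v (fun x => complex.Re (f x)) x +i* 'D_v (fun x => complex.Im (f x)) x)%C.

Lemma csmooth_eq U f g : open U -> (forall x, U x -> f x = g x) ->
  csmooth U f -> csmooth U g.
Proof.
by move=> oU fg [sR sI]; split; [apply: smooth_on_eq sR|apply: smooth_on_eq sI];
  move=> // x /fg ->.
Qed.

Lemma csmoothS U U' f : U' `<=` U -> csmooth U f -> csmooth U' f.
Proof. by move=> UU [sR sI]; split; apply: smooth_onS UU _. Qed.

Lemma csmooth_cst U (c : R[i]) : csmooth U (fun=> c).
Proof. by split; exact: smooth_on_cst. Qed.

Lemma csmoothD U f g : open U -> csmooth U f -> csmooth U g ->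
  csmooth U (fun x => f x + g x).
Proof.
move=> oU [fR fI] [gR gI]; split.
  by apply: smooth_on_eq (smooth_onD oU fR gR) => // x _; rewrite raddfD.
by apply: smooth_on_eq (smooth_onD oU fI gI) => // x _; rewrite raddfD.
Qed.

Lemma csmoothN U f : open U -> csmooth U f -> csmooth U (fun x => - f x).
Proof.
move=> oU [fR fI]; split.
  by apply: smooth_on_eq (smooth_onN oU fR) => // x _; rewrite raddfN.
by apply: smooth_on_eq (smooth_onN oU fI) => // x _; rewrite raddfN.
Qed.

Lemma ReM (x y : R[i]) : complex.Re (x * y) =
  complex.Re x * complex.Re y - complex.Im x * complex.Im y.
Proof. by case: x y => [? ?] [? ?]. Qed.

Lemma ImM (x y : R[i]) : complex.Im (x * y) =
  complex.Re x * complex.Im y + complex.Im x * complex.Re y.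
Proof. by case: x y => [? ?] [? ?]. Qed.

Lemma csmoothM U f g : open U -> csmooth U f -> csmooth U g ->
  csmooth U (fun x => f x * g x).
Proof.
move=> oU [fR fI] [gR gI]; split.
  apply: smooth_on_eq (smooth_onD oU (smooth_onM oU fR gR)
    (smooth_onN oU (smooth_onM oU fI gI))) => // x _.
  by rewrite ReM.
apply: smooth_on_eq (smooth_onD oU (smooth_onM oU fR gI)
  (smooth_onM oU fI gR)) => // x _.
by rewrite ImM.
Qed.

Lemma csmoothJ U f : open U -> csmooth U f -> csmooth U (fun x => (f x)^*).
Proof.
move=> oU [fR fI]; split; first by apply: smooth_on_eq fR => // x _; case: (f x).
by apply: smooth_on_eq (smooth_onN oU fI) => // x _; rewrite fctE; case: (f x).
Qed.

Lemma normc2_neq0 (x : R[i]) : x != 0 -> complex.Re x ^+ 2 + complex.Im x ^+ 2 != 0.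
Proof.
by case: x => a b; rewrite eq_complex negb_and /= paddr_eq0 ?sqr_ge0// !sqrf_eq0 negb_and.
Qed.

Lemma ReV (x : R[i]) : complex.Re x^-1 =
  complex.Re x * (complex.Re x ^+ 2 + complex.Im x ^+ 2)^-1.
Proof. by case: x. Qed.

Lemma ImV (x : R[i]) : complex.Im x^-1 =
  - (complex.Im x * (complex.Re x ^+ 2 + complex.Im x ^+ 2)^-1).
Proof. by case: x. Qed.

Lemma csmoothV U f : open U -> (forall x, U x -> f x != 0) -> csmooth U f ->
  csmooth U (fun x => (f x)^-1).
Proof.
move=> oU f0 [fR fI].
have sN : smooth_on U (fun x => (complex.Re (f x) ^+ 2 + complex.Im (f x) ^+ 2)^-1).
  apply: (@smooth_onV _ _ U
    (fun x => complex.Re (f x) ^+ 2 + complex.Im (f x) ^+ 2) oU) => [x Ux|].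
    by apply: normc2_neq0; apply: f0.
  apply: (smooth_on_eq oU _ (smooth_onD oU (smooth_onM oU fR fR) (smooth_onM oU fI fI))) => x _.
  by rewrite !expr2.
split; first by apply: smooth_on_eq (smooth_onM oU fR sN) => // x _; rewrite ReV.
by apply: smooth_on_eq (smooth_onN oU (smooth_onM oU fI sN)) => // x _; rewrite ImV.
Qed.

Lemma csmooth_cD U f v : open U -> csmooth U f -> csmooth U (cD v f).
Proof. by move=> oU [fR fI]; split; [exact: (smooth_on_derive v fR)|exact: (smooth_on_derive v fI)]. Qed.

Lemma csmooth_sum U (I : Type) (r : seq I) (P : pred I) (F : I -> V -> R[i]) : open U ->
  (forall i, csmooth U (F i)) -> csmooth U (fun x => \sum_(i <- r | P i) F i x).
Proof.
move=> oU sF; elim: r => [|i r IH].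
  by apply: csmooth_eq (csmooth_cst U 0) => // x _; rewrite big_nil.
case Pi: (P i); last by apply: csmooth_eq IH => // x _; rewrite big_cons Pi.
by apply: csmooth_eq (csmoothD oU (sF i) IH) => // x _; rewrite big_cons Pi.
Qed.

Lemma cD_near v f g x : {near x, f =1 g} -> cD v f x = cD v g x.
Proof.
by move=> fg; congr Complex; apply: near_eq_derive; apply: filterS fg => y ->.
Qed.

Lemma cD_eq U v f g x : open U -> U x -> (forall y, U y -> f y = g y) ->
  cD v f x = cD v g x.
Proof.
by move=> oU Ux fg; apply: cD_near; apply: filterS (open_nbhs_nbhs (conj oU Ux)) => y /fg.
Qed.

Lemma cD_cst v (c : R[i]) x : cD v (fun=> c) x = 0.
Proof. by rewrite /cD !derive_cst. Qed.

Lemma cDD U v f g x : csmooth U f -> csmooth U g -> U x ->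
  cD v (fun x => f x + g x) x = cD v f x + cD v g x.
Proof.
move=> [fR fI] [gR gI] Ux; rewrite /cD.
rewrite (_ : (fun x => complex.Re _) =
  (fun x => complex.Re (f x)) + (fun x => complex.Re (g x))); last first.
  by apply/funext => y; rewrite fctE raddfD.
rewrite (_ : (fun x => complex.Im _) =
  (fun x => complex.Im (f x)) + (fun x => complex.Im (g x))); last first.
  by apply/funext => y; rewrite fctE raddfD.
rewrite (deriveD (smooth_on_derivable fR Ux) (smooth_on_derivable gR Ux)).
by rewrite (deriveD (smooth_on_derivable fI Ux) (smooth_on_derivable gI Ux)).
Qed.

Lemma deriveMR (F G : V -> R) x v : derivable F x v -> derivable G x v ->
  'D_v (F * G) x = F x * 'D_v G x + G x * 'D_v F x.
Proof. exact: deriveM. Qed.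

Lemma complexE' (x : R[i]) : (complex.Re x +i* complex.Im x)%C = x.
Proof. by case: x. Qed.

Lemma cDM U v f g x : csmooth U f -> csmooth U g -> U x ->
  cD v (fun x => f x * g x) x = cD v f x * g x + f x * cD v g x.
Proof.
move=> [fR fI] [gR gI] Ux; rewrite /cD.
set a := fun x => complex.Re (f x); set b := fun x => complex.Im (f x).
set c := fun x => complex.Re (g x); set d := fun x => complex.Im (g x).
rewrite (_ : (fun x => complex.Re _) = a * c - b * d); last first.
  by apply/funext => y; rewrite ReM.
rewrite (_ : (fun x => complex.Im _) = a * d + b * c); last first.
  by apply/funext => y; rewrite ImM.
have da : derivable a x v := smooth_on_derivable fR Ux.
have db : derivable b x v := smooth_on_derivable fI Ux.
have dc : derivable c x v := smooth_on_derivable gR Ux.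
have dd : derivable d x v := smooth_on_derivable gI Ux.
rewrite (deriveB (derivableM da dc) (derivableM db dd)).
rewrite (deriveD (derivableM da dd) (derivableM db dc)).
rewrite (deriveMR da dc) (deriveMR db dd) (deriveMR da dd) (deriveMR db dc).
rewrite -[f x]complexE' -[g x]complexE' -/(a x) -/(b x) -/(c x) -/(d x).
move: (a x) (b x) (c x) (d x) ('D_v a x) ('D_v b x) ('D_v c x) ('D_v d x).
move=> ? ? ? ? ? ? ? ?; apply/eqP; rewrite eq_complex /=.
by apply/andP; split; apply/eqP; ring.
Qed.

Lemma cDN U v f x : csmooth U f -> U x -> cD v (fun x => - f x) x = - cD v f x.
Proof.
move=> sf Ux; rewrite (_ : (fun x => _) = fun x => -1 * f x); last first.
  by apply/funext => y; rewrite mulN1r.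
by rewrite (cDM v (csmooth_cst U _) sf Ux) cD_cst mul0r add0r mulN1r.
Qed.

Lemma cDZ U v f (c : R[i]) x : csmooth U f -> U x ->
  cD v (fun x => c * f x) x = c * cD v f x.
Proof.
by move=> sf Ux; rewrite (cDM v (csmooth_cst U _) sf Ux) cD_cst mul0r add0r.
Qed.

Lemma cDJ U v f x : csmooth U f -> U x -> cD v (fun x => (f x)^*) x = (cD v f x)^*.
Proof.
move=> [sR sI] Ux; rewrite /cD /=.
rewrite [in LHS](_ : (fun x => complex.Im _) = - (fun x => complex.Im (f x))); last first.
  by apply/funext => y; rewrite fctE; case: (f y).
rewrite (deriveN (smooth_on_derivable sI Ux)).
rewrite [in LHS](_ : (fun x => complex.Re _) = (fun x => complex.Re (f x))) //.
by apply/funext => y; case: (f y).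
Qed.

Lemma cDV U v f x : open U -> (forall x, U x -> f x != 0) -> csmooth U f -> U x ->
  cD v (fun x => (f x)^-1) x = - cD v f x / f x ^+ 2.
Proof.
move=> oU f0 sf Ux; have sV := csmoothV oU f0 sf.
(* The formula is read off from the derivative of [f * f^-1 = 1], which avoids differentiating the
   two parts of the inverse. *)
have := cDM v sf sV Ux; rewrite (@cD_eq U v _ (fun=> 1) x)//; last first.
  by move=> y /f0 fy; rewrite divff.
rewrite cD_cst => /esym/eqP; rewrite addrC addr_eq0 => /eqP E.
apply: (mulfI (f0 _ Ux)); rewrite E; field; exact: f0.
Qed.

Lemma cD_sum U v (I : Type) (r : seq I) (F : I -> V -> R[i]) x : open U ->
  (forall i, csmooth U (F i)) -> U x ->
  cD v (fun x => \sum_(i <- r) F i x) x = \sum_(i <- r) cD v (F i) x.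
Proof.
move=> oU sF Ux; elim: r => [|i r IH].
  rewrite big_nil -[RHS](cD_cst v 0 x); apply: (cD_eq v oU Ux) => y _.
  by rewrite big_nil.
rewrite big_cons -IH -(cDD v (sF i) (csmooth_sum _ _ oU sF) Ux).
by apply: (cD_eq v oU Ux) => y _; rewrite big_cons.
Qed.

End ComplexCalculus.

(** * Calculus on the plane and the maximum principle *)

Section Lines.
Context {R : realType} {V : normedModType R}.
Implicit Types (F : V -> R) (U : set V).

Lemma is_derive_line F (x v : V) (t : R) : derivable F (x + t *: v) v ->
  is_derive t 1 (fun t => F (x + t *: v)) ('D_v F (x + t *: v)).
Proof.
move=> dF.
have E : (fun h : R => h^-1 *: (((fun t => F (x + t *: v)) \o shift t) (h *: 1) -
    F (x + t *: v))) = (fun h => h^-1 *: ((F \o shift (x + t *: v)) (h *: v) - F (x + t *: v))).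
  apply/funext => h /=; congr (_ *: (F _ - _)).
  by rewrite scalerDl addrCA [_%:A]mulr1.
by split; rewrite /derivable /derive E.
Qed.

Lemma MVT_line_gt F (x v : V) (h : R) : 0 < h ->
  (forall t, 0 <= t <= h -> derivable F (x + t *: v) v) ->
  exists t, [/\ 0 < t, t < h & F (x + h *: v) - F x = h * 'D_v F (x + t *: v)].
Proof.
move=> h0 dF; set g := fun t : R => F (x + t *: v).
have dg (t : R) : 0 <= t <= h -> is_derive t (1 : R) g ('D_v F (x + t *: v)).
  by move=> th; apply: is_derive_line; exact: dF.
have -> : F x = g 0 by rewrite /g scale0r addr0.
have [||c + E] := @MVT _ g (fun t => 'D_v F (x + t *: v)) 0 h h0.
- move=> t; rewrite in_itv /= => /andP[t0 th]; apply: dg.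
  by rewrite !ltW.
- apply: derivable_within_continuous => t; rewrite in_itv /= => th.
  by have [] := dg t th.
rewrite in_itv /= => /andP[c0 ch]; exists c; split=> //.
by rewrite -/(g h) E subr0 mulrC.
Qed.

Lemma MVT_line F (x v : V) (h : R) :
  (forall t, `|t| <= `|h| -> derivable F (x + t *: v) v) ->
  exists2 t, `|t| <= `|h| & F (x + h *: v) - F x = h * 'D_v F (x + t *: v).
Proof.
move=> dF; set g := fun t : R => F (x + t *: v); set g' := fun t => 'D_v F (x + t *: v).
have dg (t : R) : `|t| <= `|h| -> is_derive t (1 : R) g (g' t).
  by move=> th; apply: is_derive_line; exact: dF.
have -> : F x = g 0 by rewrite /g scale0r addr0.
have [h0|h0] := leP 0 h.
  have dg' (t : R) : t \in `[0, h] -> is_derive t (1 : R) g (g' t).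
    by rewrite in_itv /= => /andP[t0 th]; apply: dg; rewrite !ger0_norm.
  have cg : {within `[0, h], continuous g}.
    by apply: derivable_within_continuous => t /dg' [].
  have [c + E] := MVT_segment h0 (fun t th => dg' t (subset_itv_oo_cc th)) cg.
  rewrite in_itv /= => /andP[c0 ch]; exists c; first by rewrite !ger0_norm.
  by rewrite -/(g h) E subr0 mulrC.
have dg' (t : R) : t \in `[h, 0] -> is_derive t (1 : R) g (g' t).
  rewrite in_itv /= => /andP[th t0]; apply: dg.
  by rewrite !ler0_norm ?(ltW h0)// lerN2.
have cg : {within `[h, 0], continuous g}.
  by apply: derivable_within_continuous => t /dg' [].
have [c + E] := MVT_segment (ltW h0) (fun t th => dg' t (subset_itv_oo_cc th)) cg.
rewrite in_itv /= => /andP[ch c0]; exists c.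
  by rewrite !ler0_norm ?(ltW h0)// lerN2.
by apply: oppr_inj; rewrite opprB E sub0r mulrN mulrC.
Qed.

(* Both iterated derivatives are limits of the same second difference quotient. *)
Lemma derive_comm F (x u v : V) : smooth_on setT F ->
  'D_u ('D_v F) x = 'D_v ('D_u F) x.
Proof.
move=> sF.
have close (a b c d r : R) : `|a - c| < r / 2 -> `|b - d| < r / 2 -> c = d -> `|a - b| <= r.
  move=> ac bd cd; rewrite (le_trans (ler_distD c _ _))// [leRHS]splitr ltW// ltrD//.
  by rewrite cd distrC.
have dF (G : V -> R) (w y : V) : smooth_on setT G -> derivable G y w.
  by move=> sG; apply: (smooth_on_derivable sG).
have sd (a b : V) (h : R) : exists s t : R, [/\ `|s| <= `|h|, `|t| <= `|h| &
   (F (x + h *: a + h *: b) - F (x + h *: a)) - (F (x + h *: b) - F x) =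
     h * (h * 'D_b ('D_a F) (x + s *: a + t *: b))].
  pose G (y : V) := F (y + h *: b) - F y.
  have dG (y : V) : is_derive y a G ('D_a F (y + h *: b) - 'D_a F y).
    have -> : G = (fun y => F (y + h *: b)) - F by [].
    apply: is_deriveB; last by apply: derivableP; exact: dF.
    have E : (fun k : R => k^-1 *: (((fun y => F (y + h *: b)) \o shift y) (k *: a) -
      F (y + h *: b))) = (fun k => k^-1 *: ((F \o shift (y + h *: b)) (k *: a) -
      F (y + h *: b))).
      by apply/funext => k /=; rewrite addrA.
    by split; rewrite /derivable /derive E //; exact: (dF F).
  have [s sh] := @MVT_line G x a h (fun t _ => @ex_derive _ _ _ _ _ _ _ (dG _)).
  rewrite derive_val => E.
  have [t th E'] := @MVT_line ('D_a F) (x + s *: a) b h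
    (fun t _ => dF _ _ _ (smooth_on_derive a sF)).
  by exists s, t; split=> //; rewrite -E' -E.
apply/eqP; rewrite -subr_eq0 -normr_eq0.
rewrite eq_le normr_ge0 andbT; apply/ler_addgt0Pl => e e0; rewrite addr0.
set A := 'D_v ('D_u F); set B := 'D_u ('D_v F).
have cont (G : V -> R) a b : {for x, continuous G} ->
    \forall h \near 0^'+, forall s t : R, `|s| <= `|h| -> `|t| <= `|h| ->
      `|G x - G (x + s *: a + t *: b)| < e / 2.
  move=> /cvgrPdist_lt /(_ (e / 2)); rewrite divr_gt0// => /(_ isT).
  move=> /nbhs_ballP[d /= d0 dG]; set M := `|a| + `|b| + 1.
  have M0 : 0 < M by rewrite /M ltr_wpDl// addr_ge0.
  near=> h => s t sh th; apply: dG; rewrite -ball_normE /=.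
  rewrite -addrA opprD addNKr normrN.
  apply: (@le_lt_trans _ _ (`|h| * (`|a| + `|b|))).
    rewrite mulrDr (le_trans (ler_normD _ _))// !normrZ.
    by rewrite lerD// ler_wpM2r.
  apply: (@le_lt_trans _ _ (`|h| * M)); first by rewrite ler_wpM2l// lerDl.
  rewrite -ltr_pdivlMr// ger0_norm; last by near: h; exact: nbhs_right_ge.
  by near: h; apply: nbhs_right_lt; exact: divr_gt0.
have cA : {for x, continuous A}.
  by apply: (smooth_on_cont (smooth_on_derive v (smooth_on_derive u sF))).
have cB : {for x, continuous B}.
  by apply: (smooth_on_cont (smooth_on_derive u (smooth_on_derive v sF))).
have [h [h0 [hA hB]]] := filter_ex (filterI (nbhs_right_gt (0 : R))
  (filterI (cont A u v cA) (cont B v u cB))).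
have [s [t [sh th E1]]] := sd u v h; have [s' [t' [sh' th' E2]]] := sd v u h.
have E : A (x + s *: u + t *: v) = B (x + s' *: v + t' *: u).
  have h1 : h != 0 by rewrite gt_eqF.
  apply: (mulfI h1); apply: (mulfI h1).
  apply: (etrans (esym E1)); apply: (etrans _ E2); rewrite [x + h *: u + _]addrAC.
  by move: (F _) (F _) (F _) (F _) => ? ? ? ?; ring.
have := close _ _ _ _ _ (hB s' t' sh' th') (hA s t sh th) (esym E).
by [].
Unshelve. all: by end_near. Qed.

(** The first derivative vanishes at the maximum; if the second were positive near [x], two mean
    values would give [F (x + h *: v) > F x] for a small positive [h]. *)
Lemma derive2_le0_at_max F (x v : V) (d : R) : smooth_on setT F -> 0 < d ->
  (forall t, `|t| < d -> F (x + t *: v) <= F x) -> 'D_v ('D_v F) x <= 0.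
Proof.
move=> sF d0 Fmax.
have dF (G : V -> R) (y : V) : smooth_on setT G -> derivable G y v.
  by move=> sG; apply: (smooth_on_derivable sG).
have s1 := smooth_on_derive v sF; have s2 := smooth_on_derive v s1.
have D0 : 'D_v F x = 0.
  pose g (t : R) := F (x + t *: v).
  have dg (t : R) : is_derive t (1 : R) g ('D_v F (x + t *: v)) by exact/is_derive_line/dF.
  have : is_derive (0 : R) 1 g 0.
    apply: (@derive1_at_max _ g (- d) d 0).
    - by rewrite ge0_cp// ltW.
    - by move=> t _; have [] := dg t.
    - by rewrite in_itv /= oppr_lt0 d0.
    - move=> t; rewrite in_itv /= -ltr_norml => td.
      by rewrite /g scale0r addr0; exact: Fmax.
  by move=> [_ <-]; have [_ ->] := dg 0; rewrite scale0r addr0.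
rewrite leNgt; apply/negP => pos.
have c2 : {for x, continuous ('D_v ('D_v F))} by apply: (smooth_on_cont s2).
have /nbhs_ballP[r /= r0 rP] : \forall y \near x, 0 < 'D_v ('D_v F) y.
  by apply: (cvgr_gt _ c2).
(* The first bound keeps [x + h *: v] where [F x] is maximal, the second keeps the segment in the
   ball where the second derivative is positive; the [+ 1] guards against [v = 0]. *)
pose h := Num.min (d / 2) (r / (`|v| + 1) / 2).
have v0 : 0 < `|v| + 1 by rewrite ltr_wpDl.
have h0 : 0 < h by rewrite lt_min !divr_gt0.
have [t [t0 th E]] := @MVT_line_gt F x v h h0 (fun _ _ => dF _ _ sF).
have [t' [t0' th' E']] := @MVT_line_gt ('D_v F) x v t t0 (fun _ _ => dF _ _ s1).
rewrite D0 subr0 in E'.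
have hd : `|h| < d.
  by rewrite gtr0_norm// /h gt_min ltr_pdivrMr// ltr_pMr// ltr1n.
have := Fmax h hd; rewrite -subr_le0 E E' leNgt => /negP; apply.
apply: (mulr_gt0 h0); apply: (mulr_gt0 t0); apply: rP.
rewrite -ball_normE /= opprD addNKr normrN normrZ.
apply: (@le_lt_trans _ _ (h * (`|v| + 1))).
  by rewrite ler_pM// ?lerDl// gtr0_norm// ltW// (lt_trans th').
rewrite -ltr_pdivlMr// /h gt_min; apply/orP; right.
by rewrite ltr_pdivrMr// ltr_pMr ?divr_gt0// ltr1n.
Qed.

End Lines.

Section PlaneCalculus.
Context {R : realType}.
Local Notation plane := 'cV[R]_(1 + 1).
Implicit Types (F : plane -> R) (U : set plane).

Definition ex : plane := basisv R (0 : 'I_(1 + 1)).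
Definition ey : plane := basisv R (1 : 'I_(1 + 1)).

Lemma ord2P (i : 'I_(1 + 1)) : i = 0 \/ i = 1.
Proof. by case: i => -[|[|//]] i; [left|right]; apply: val_inj. Qed.

Lemma planeP (p q : plane) : p 0 0 = q 0 0 -> p 1 0 = q 1 0 -> p = q.
Proof.
move=> h0 h1; apply/matrixP => i j; rewrite (ord1 j).
by have [->|->] := ord2P i.
Qed.

Lemma plane_decomp (p : plane) : p = p 0 0 *: ex + p 1 0 *: ey.
Proof. by apply: planeP; rewrite !mxE /= ?mulr1 ?mulr0 ?addr0 ?add0r. Qed.

Lemma coord_le_norm (p : plane) i j : `|p i j| <= `|p|.
Proof. by rewrite [leRHS]/Num.Def.normr/= mx_normrE; exact: (le_bigmax _ _ (i, j)). Qed.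

Lemma norm_plane_lt (p : plane) (d : R) : 0 < d -> `|p 0 0| < d -> `|p 1 0| < d -> `|p| < d.
Proof.
move=> d0 h0 h1; rewrite [ltLHS]/Num.Def.normr/= mx_normrE.
rewrite bigmax_lt//= => -[i j] _ /=; rewrite (ord1 j).
by have [->|->] := ord2P i.
Qed.

(** The increment is split along two legs parallel to the axes. Each leg is one mean value, and the
    sup norm keeps both legs in the ball where the partial derivatives vary by less than [e / 2]. *)
Lemma C1_expansion U F x : open U -> smooth_on U F -> U x -> forall e : R, 0 < e ->
  \forall h \near (0 : plane),
    `|F (h + x) - F x - (h 0 0 * 'D_ex F x + h 1 0 * 'D_ey F x)| <= e * `|h|.
Proof.
move=> oU sF Ux e e0.
have dF (y v : plane) : U y -> derivable F y v by move=> Uy; apply: (smooth_on_derivable sF).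
have e20 : 0 < e / 2 by rewrite divr_gt0.
have near1 v : \forall y \near x, `|'D_v F x - 'D_v F y| < e / 2.
  by move/cvgrPdist_lt: (smooth_on_cont (smooth_on_derive v sF) Ux) => /(_ _ e20).
have : \forall y \near x, U y /\ (`|'D_ex F x - 'D_ex F y| < e / 2 /\
    `|'D_ey F x - 'D_ey F y| < e / 2).
  exact: filterI (open_nbhs_nbhs (conj oU Ux)) (filterI (near1 ex) (near1 ey)).
move=> /nbhs_ballP[d /= d0 dP].
apply/nbhs_ballP; exists d => //= h; rewrite -ball_normE /= sub0r normrN => hd.
have inb (s t : R) : `|s| <= `|h| -> `|t| <= `|h| -> ball x d (x + s *: ex + t *: ey).
  move=> sh th; rewrite -ball_normE /= -addrA opprD addNKr normrN.
  by apply: norm_plane_lt => //; rewrite !mxE /= ?mulr1 ?mulr0 ?addr0 ?add0r;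
    apply: le_lt_trans hd.
have [|s sh E1] := @MVT_line R _ F x ex (h 0 0).
  move=> t th; apply: dF; have := inb t 0; rewrite scale0r addr0 normr0.
  by move=> /(_ (le_trans th (coord_le_norm _ _ _)) (normr_ge0 _)) /dP[].
have [|t th E2] := @MVT_line R _ F (x + h 0 0 *: ex) ey (h 1 0).
  move=> t th; apply: dF.
  by have /dP[? []] := inb _ _ (coord_le_norm h 0 0) (le_trans th (coord_le_norm h 1 0)).
have -> : h + x = x + h 0 0 *: ex + h 1 0 *: ey.
  by rewrite {1}[h]plane_decomp addrC addrA.
have b1 : `|'D_ex F x - 'D_ex F (x + s *: ex)| < e / 2.
  have := inb s 0; rewrite scale0r addr0 normr0.
  move=> /(_ (le_trans sh (coord_le_norm _ _ _)) (normr_ge0 _)) /dP[_ [bx _]].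
  exact bx.
have b2 : `|'D_ey F x - 'D_ey F (x + h 0 0 *: ex + t *: ey)| < e / 2.
  by have /dP[? []] := inb _ _ (coord_le_norm h 0 0) (le_trans th (coord_le_norm h 1 0)).
have := coord_le_norm h 0 0; have := coord_le_norm h 1 0.
move: E1 E2 b1 b2; move: (F _) (F _) (F _) ('D_ex F x) ('D_ey F x).
move: ('D_ex F _) ('D_ey F _) => a' b' f1 f2 f3 a b E1 E2 b1 b2 h1 h0.
rewrite (_ : f1 - f2 - _ = h 0 0 * (a' - a) + h 1 0 * (b' - b)); last first.
  by rewrite !mulrBr -E1 -E2; ring.
rewrite (le_trans (ler_normD _ _))// !normrM distrC [`|b' - b|]distrC.
rewrite [e]splitr mulrDl lerD// mulrC ler_pM// ?ltW//.
Qed.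

End PlaneCalculus.

Section Differentiability.
Context {R : realType}.
Local Notation plane := 'cV[R]_(1 + 1).
Implicit Types (F : plane -> R) (U : set plane).

Definition grad_form (a b : R) (h : plane) : R := h 0 0 * a + h 1 0 * b.

Lemma grad_form_is_linear a b : linear (grad_form a b : plane -> R^o).
Proof.
by move=> k u v; rewrite /grad_form !mxE /GRing.scale /=; ring.
Qed.

HB.instance Definition _ a b := GRing.isLinear.Build R plane R^o _ (grad_form a b)
  (grad_form_is_linear a b).

Lemma grad_form_continuous a b : continuous (grad_form a b : plane -> R).
Proof.
move=> x; rewrite /continuous_at /grad_form.
by apply: (@cvgD _ _ _ (nbhs x) _ (fun h => h 0 0 * a) (fun h => h 1 0 * b)); apply: cvgM;
  [exact: coord_continuous|exact: cvg_cst|exact: coord_continuous|exact: cvg_cst].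
Qed.

Lemma C1_expansionE U F x : open U -> smooth_on U F -> U x ->
  F \o shift x = cst (F x) + (grad_form ('D_ex F x) ('D_ey F x) : {linear plane -> R^o}) +o_ (0 : plane) id.
Proof.
move=> oU sF Ux; apply/eqaddoP => e e0.
apply: filterS (C1_expansion oU sF Ux e0) => h.
move=> le; rewrite !fctE /= opprD addrA. exact: le.
Qed.

Lemma C1_diffE U F x : open U -> smooth_on U F -> U x ->
  'd F x = grad_form ('D_ex F x) ('D_ey F x) :> (plane -> R).
Proof.
move=> oU sF Ux.
by apply: (diff_unique _ (C1_expansionE oU sF Ux)); exact: grad_form_continuous.
Qed.

Lemma C1_differentiable U F x : open U -> smooth_on U F -> U x -> differentiable F x.
Proof.
move=> oU sF Ux; apply/diff_locallyP; rewrite (C1_diffE oU sF Ux); split.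
  exact: grad_form_continuous.
exact: (C1_expansionE oU sF Ux).
Qed.

Lemma differentiable_cV (V : normedModType R) n (F : V -> 'cV[R]_n) x :
  (forall i, differentiable (fun x => F x i 0 : R) x) -> differentiable F x.
Proof.
move=> dF; rewrite (_ : F = \sum_(i < n) (fun x => F x i 0 *: (delta_mx i 0 : 'cV[R]_n))).
  by apply: differentiable_sum => i; apply: differentiableZl.
apply/funext => y; rewrite fct_sumE [LHS]matrix_sum_delta.
by apply: eq_bigr => i _; rewrite big_ord1.
Qed.

Lemma smooth_differentiable_cV U n (F : plane -> 'cV[R]_n) x : open U ->
  smooth_on U F -> U x -> differentiable F x.
Proof.
move=> oU sF Ux; apply: differentiable_cV => i.
by apply: (C1_differentiable oU _ Ux); move/(smooth_on_mx _ oU): sF; apply.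
Qed.

Lemma derive_chain U (phi : plane -> plane) F x v : open U -> smooth_on U phi -> U x ->
  smooth_on setT F ->
  'D_v (F \o phi) x = ('D_v phi x) 0 0 * 'D_ex F (phi x) + ('D_v phi x) 1 0 * 'D_ey F (phi x).
Proof.
move=> oU sphi Ux sF.
have dphi := smooth_differentiable_cV oU sphi Ux.
have dF : differentiable F (phi x) by exact: (C1_differentiable openT sF I).
rewrite deriveE; last exact: differentiable_comp.
by rewrite (diff_comp dphi dF) /= (C1_diffE openT sF I) -(deriveE v dphi).
Qed.

End Differentiability.

Lemma derive_coord (R : realType) m n (v x : 'M[R]_(m, n)) i j :
  'D_v (fun x : 'M[R]_(m, n) => x i j : R) x = v i j.
Proof.
have := derive_mx (@derivable_id R _ x v); rewrite derive_id => /matrixP /(_ i j).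
by rewrite mxE.
Qed.

Section MaximumPrinciple.
Context {R : realType}.
Local Notation plane := 'cV[R]_(1 + 1).

(* On a large square, the maximum of [u + eta x^2] cannot be interior, since this
   function has Laplacian [2 eta > 0]. *)
Lemma harmonic_le0 (u : plane -> R) : smooth_on setT u ->
  (forall x, 'D_ex ('D_ex u) x + 'D_ey ('D_ey u) x = 0) ->
  (forall e, 0 < e -> exists r, forall x, r <= `|x| -> u x <= e) ->
  forall x, u x <= 0.
Proof.
move=> su Lu decay x0; apply/ler_addgt0Pl => e e0; rewrite addr0.
have [r0 r0P] := decay e e0; pose r := Num.max r0 (`|x0| + 1).
have r_gt0 : 0 < r by rewrite lt_max orbC ltr_wpDl.
have rP x : r <= `|x| -> u x <= e.
  by move=> rx; apply: r0P; apply: le_trans rx; rewrite le_max lexx.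
have x0r : `|x0| < r by rewrite lt_max orbC ltrDl ltr01.
apply/ler_addgt0Pl => e' e'0.
(* This size makes the perturbation [q] at most [e'] on the square [|x| <= r]. *)
pose eta := e' / (r ^+ 2).
have eta0 : 0 < eta by rewrite divr_gt0// exprn_gt0.
pose q (x : plane) : R := eta * (x 0 0 * x 0 0).
have sc i : smooth_on setT (fun x : plane => x i 0 : R) by apply: smooth_on_coord; exact: openT.
have sq : smooth_on setT q.
  apply: (smooth_on_eq openT _ (smooth_onM openT (@smooth_on_cst R _ R setT eta)
    (smooth_onM openT (sc 0) (sc 0)))) => x _.
  by rewrite !fctE.
pose w := u + q.
have sw : smooth_on setT w := smooth_onD openT su sq.
pose phi (p : R * R) : plane := p.1 *: ex + p.2 *: ey.
have cphi : continuous phi.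
  move=> p; apply: (@cvgD _ _ _ (nbhs p) _ (fun p => p.1 *: ex) (fun p => p.2 *: ey)).
    by apply: cvgZr_tmp; exact: cvg_fst.
  by apply: cvgZr_tmp; exact: cvg_snd.
have phiE (x : plane) : phi (x 0 0, x 1 0) = x by rewrite /phi /= -plane_decomp.
have phi0 p : phi p 0 0 = p.1 by rewrite !mxE /= mulr1 mulr0 addr0.
have phi1 p : phi p 1 0 = p.2 by rewrite !mxE /= mulr1 mulr0 add0r.
have [|||[m1 m2]] := @compact_EVT_max _ R (w \o phi) (`[-r, r] `*` `[-r, r]).
- by exists (0, 0); split; rewrite /= in_itv /= oppr_le0 ltW.
- by apply: compact_setX; exact: segment_compact.
- apply: continuous_subspaceT => p; apply: continuous_comp; first exact: cphi.
  exact: (smooth_on_cont sw).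
rewrite inE /= => -[]; rewrite /= !in_itv /= => m1r m2r wmax.
have {wmax}wm x : `|x| <= r -> w x <= w (phi (m1, m2)).
  move=> xr; rewrite -[x in w x]phiE; apply: wmax; rewrite inE.
  by split; rewrite /= in_itv /= -ler_norml (le_trans (coord_le_norm _ _ _)).
have q_le : q (phi (m1, m2)) <= e'.
  rewrite /q phi0 /= -expr2 /eta mulrAC -mulrA ler_piMr ?(ltW e'0)//.
  rewrite ler_pdivrMr ?exprn_gt0// mul1r -subr_ge0 subr_sqr mulr_ge0//.
    by case/andP: m1r; lra.
  by case/andP: m1r; lra.
have q_ge x : 0 <= q x by rewrite /q mulr_ge0 ?(ltW eta0)// -expr2 sqr_ge0.
have ux0 : u x0 <= w x0 by rewrite lerDl.
rewrite (le_trans ux0)// (le_trans (wm _ (ltW x0r)))//.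
rewrite /w fctE addrC lerD//.
(* A maximum on the boundary is bounded by the decay hypothesis; an interior one is excluded by the
   second derivative test. *)
have [/rP//|mr] := leP r `|phi (m1, m2)|.
exfalso.
have loc v t : `|t| < (r - `|phi (m1, m2)|) / (`|v| + 1) ->
    w (phi (m1, m2) + t *: v) <= w (phi (m1, m2)).
  have v0 : 0 < `|v| + 1 by rewrite ltr_wpDl.
  rewrite ltr_pdivlMr // => tr; apply: wm.
  apply: (le_trans (ler_normD _ _)); rewrite normrZ addrC -lerBrDr; apply: ltW.
  by apply: le_lt_trans tr; rewrite ler_wpM2l// lerDl.
have d0 (v : plane) : 0 < (r - `|phi (m1, m2)|) / (`|v| + 1).
  by rewrite divr_gt0 ?subr_gt0// ltr_wpDl.
have := derive2_le0_at_max sw (d0 ex) (loc ex); have := derive2_le0_at_max sw (d0 ey) (loc ey).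
move: (phi _) => m.
have dw v : 'D_v w = 'D_v u + 'D_v q.
  by apply/funext => y; rewrite deriveD//; [apply: (smooth_on_derivable su)|
    apply: (smooth_on_derivable sq)].
have dc v y : derivable (fun x : plane => x 0 0 : R) y v.
  exact: (smooth_on_derivable (sc 0) I).
have dcst (k : R) v y : derivable (cst k : plane -> R) y v by exact: derivable_cst.
have dk (k : R) v y : 'D_v (cst k * (fun x : plane => x 0 0)) y = k * v 0 0.
  by rewrite (deriveMR (dcst k v y) (dc v y)) derive_coord derive_cst mulr0 addr0.
have dq v : 'D_v q = cst (2 * eta * v 0 0) * (fun x : plane => x 0 0).
  apply/funext => y.
  have -> : q = cst eta * ((fun x : plane => x 0 0) * (fun x : plane => x 0 0)) by [].
  rewrite (deriveMR (dcst eta v y) (derivableM (dc v y) (dc v y))).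
  by rewrite (deriveMR (dc v y) (dc v y)) derive_coord derive_cst !fctE; ring.
have ddw v : 'D_v ('D_v w) m = 'D_v ('D_v u) m + 2 * eta * v 0 0 ^+ 2.
  rewrite dw deriveD; [|exact: (smooth_on_derivable (smooth_on_derive v su) I)
    |exact: (smooth_on_derivable (smooth_on_derive v sq) I)].
  by congr (_ + _); rewrite dq dk; ring.
have absurd (A B a b : R) : A = a + 2 * eta * (@ex R) 0 0 ^+ 2 ->
    B = b + 2 * eta * (@ey R) 0 0 ^+ 2 -> a + b = 0 -> B <= 0 -> A <= 0 -> False.
  by rewrite !mxE /=; clear -eta0 => *; lra.
exact (absurd _ _ _ _ (ddw ex) (ddw ey) (Lu m)).
Qed.

End MaximumPrinciple.

(** * The ring of smooth functions and the Wirtinger derivatives *)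

Section SmoothFunctions.
Variable R : realType.
Local Notation plane := 'cV[R]_(1 + 1).

Definition smooth_pred : {pred plane -> R[i]} := fun f => `[< csmooth setT f >].

Lemma smooth_predP f : reflect (csmooth setT f) (f \in smooth_pred).
Proof. exact: asboolP. Qed.

Lemma smooth_pred_subring : subring_closed smooth_pred.
Proof.
split=> [|f g /smooth_predP sf /smooth_predP sg|f g /smooth_predP sf /smooth_predP sg];
    apply/smooth_predP.
- exact: csmooth_cst.
- exact: (csmoothD openT sf (csmoothN openT sg)).
- exact: (csmoothM openT sf sg).
Qed.

HB.instance Definition _ := GRing.isSubringClosed.Build (plane -> R[i]) smooth_pred
  smooth_pred_subring.

(** Bundling smooth functions into a commutative ring with an involution and derivations turns the
    geometry into algebra: [ring] applies to functions, without smoothness side conditions. *)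
Record sfun := SFun { sfun_val :> plane -> R[i]; _ : sfun_val \in smooth_pred }.

HB.instance Definition _ := [isSub for sfun_val].
HB.instance Definition _ := [Choice of sfun by <:].
HB.instance Definition _ := [SubChoice_isSubComNzRing of sfun by <:].

Definition sfun_of (f : plane -> R[i]) (sf : csmooth setT f) : sfun :=
  SFun (introT (smooth_predP f) sf).

Lemma sfunP (f g : sfun) : (forall x, f x = g x) <-> f = g.
Proof. by split=> [fg|->//]; apply/val_inj/funext. Qed.

Lemma sfun_smooth (f : sfun) : csmooth setT f.
Proof. by apply/smooth_predP; case: f. Qed.

Lemma sfun1 x : (1 : sfun) x = 1. Proof. by []. Qed.
Lemma sfunD (f g : sfun) x : (f + g) x = f x + g x. Proof. by []. Qed.
Lemma sfunN (f : sfun) x : (- f) x = - f x. Proof. by []. Qed.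
Lemma sfunM (f g : sfun) x : (f * g) x = f x * g x. Proof. by []. Qed.

Definition ev (x : plane) (f : sfun) : R[i] := f x.
Lemma ev_is_zmod_morphism x : zmod_morphism (ev x). Proof. by []. Qed.
Lemma ev_is_monoid_morphism x : monoid_morphism (ev x). Proof. by []. Qed.
HB.instance Definition _ x := GRing.isZmodMorphism.Build sfun R[i] (ev x)
  (ev_is_zmod_morphism x).
HB.instance Definition _ x := GRing.isMonoidMorphism.Build sfun R[i] (ev x)
  (ev_is_monoid_morphism x).

Lemma sfunX (f : sfun) n x : (f ^+ n) x = f x ^+ n.
Proof. exact: (rmorphXn (ev x)). Qed.

Definition sC (c : R[i]) : sfun := sfun_of (csmooth_cst setT c).
Lemma sC_is_zmod_morphism : zmod_morphism sC. Proof. by move=> a b; apply/sfunP. Qed.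
Lemma sC_is_monoid_morphism : monoid_morphism sC.
Proof. by split=> [|a b]; apply/sfunP. Qed.
HB.instance Definition _ := GRing.isZmodMorphism.Build R[i] sfun sC sC_is_zmod_morphism.
HB.instance Definition _ := GRing.isMonoidMorphism.Build R[i] sfun sC
  sC_is_monoid_morphism.

Definition sJ (f : sfun) : sfun := sfun_of (csmoothJ openT (sfun_smooth f)).
Lemma sJ_is_zmod_morphism : zmod_morphism sJ.
Proof. by move=> f g; apply/sfunP => x; rewrite /= rmorphB. Qed.
Lemma sJ_is_monoid_morphism : monoid_morphism sJ.
Proof. by split=> [|f g]; apply/sfunP => x; rewrite /= ?rmorph1 ?rmorphM. Qed.
HB.instance Definition _ := GRing.isZmodMorphism.Build sfun sfun sJ sJ_is_zmod_morphism.
HB.instance Definition _ := GRing.isMonoidMorphism.Build sfun sfun sJ sJ_is_monoid_morphism.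

Lemma sJK : involutive sJ.
Proof. by move=> f; apply/sfunP => x /=; rewrite conjCK. Qed.

Lemma sJD f g : sJ (f + g) = sJ f + sJ g. Proof. exact: rmorphD. Qed.
Lemma sJN f : sJ (- f) = - sJ f. Proof. exact: rmorphN. Qed.
Lemma sJM f g : sJ (f * g) = sJ f * sJ g. Proof. exact: rmorphM. Qed.

Lemma sJC c : sJ (sC c) = sC c^*. Proof. exact/sfunP. Qed.

Definition sV (f : sfun) (f0 : forall x, f x != 0) : sfun :=
  sfun_of (csmoothV openT (fun x _ => f0 x) (sfun_smooth f)).

Lemma mul_sV f f0 : f * @sV f f0 = 1.
Proof. by apply/sfunP => x; rewrite sfunM /= divff. Qed.

Definition sD v (f : sfun) : sfun := sfun_of (csmooth_cD v openT (sfun_smooth f)).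

Lemma sDD v f g : sD v (f + g) = sD v f + sD v g.
Proof. by apply/sfunP => x; exact: (cDD v (sfun_smooth f) (sfun_smooth g) I). Qed.

Lemma sDN v f : sD v (- f) = - sD v f.
Proof. by apply/sfunP => x; exact: (cDN v (sfun_smooth f) I). Qed.

Lemma sDM v f g : sD v (f * g) = sD v f * g + f * sD v g.
Proof. by apply/sfunP => x; exact: (cDM v (sfun_smooth f) (sfun_smooth g) I). Qed.

Lemma sDC v c : sD v (sC c) = 0.
Proof. by apply/sfunP => x; exact: cD_cst. Qed.

Lemma sDJ v f : sD v (sJ f) = sJ (sD v f).
Proof. by apply/sfunP => x; exact: (cDJ v (sfun_smooth f) I). Qed.

Lemma sD_comm u v f : sD u (sD v f) = sD v (sD u f).
Proof.
apply/sfunP => x; have [sR sI] := sfun_smooth f.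
move: (derive_comm x u v sR) (derive_comm x u v sI).
set a := fun y => complex.Re (f y); set b := fun y => complex.Im (f y) => eR eI.
change (('D_u ('D_v a) x +i* 'D_u ('D_v b) x)%C = ('D_v ('D_u a) x +i* 'D_v ('D_u b) x)%C).
by rewrite eR eI.
Qed.

Definition dz (f : sfun) : sfun := sC 2^-1 * (sD ex f - sC 'i * sD ey f).
Definition db (f : sfun) : sfun := sC 2^-1 * (sD ex f + sC 'i * sD ey f).

Lemma dzD f g : dz (f + g) = dz f + dz g.
Proof. by rewrite /dz !sDD; ring. Qed.
Lemma dbD f g : db (f + g) = db f + db g.
Proof. by rewrite /db !sDD; ring. Qed.
Lemma dzN f : dz (- f) = - dz f.
Proof. by rewrite /dz !sDN; ring. Qed.
Lemma dzM f g : dz (f * g) = dz f * g + f * dz g.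
Proof. by rewrite /dz !sDM; ring. Qed.
Lemma dbM f g : db (f * g) = db f * g + f * db g.
Proof. by rewrite /db !sDM; ring. Qed.
Lemma dzC c : dz (sC c) = 0.
Proof. by rewrite /dz !sDC; ring. Qed.
Lemma dbC c : db (sC c) = 0.
Proof. by rewrite /db !sDC; ring. Qed.
Lemma dz0 : dz 0 = 0.
Proof. by rewrite -[X in dz X](rmorph0 sC) dzC. Qed.
Lemma dzJ f : dz (sJ f) = sJ (db f).
Proof.
have h : sJ (sC 2^-1) = sC 2^-1 by rewrite sJC fmorphV rmorph_nat.
have hi : sJ (sC 'i) = - sC 'i by rewrite sJC conjCi rmorphN.
by rewrite /dz /db !sDJ sJM sJD sJM h hi mulNr.
Qed.
Lemma dbJ f : db (sJ f) = sJ (dz f).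
Proof. by rewrite -[LHS]sJK -dzJ sJK. Qed.
Lemma dzb_comm f : dz (db f) = db (dz f).
Proof.
rewrite /dz /db !sDM !sDD !sDN !sDM !sDC (sD_comm ey ex f); ring.
Qed.

Definition Zf : sfun.
Proof.
apply: (@sfun_of (fun p => (p 0 0 +i* p 1 0)%C)).
by split; apply: smooth_on_coord; exact: openT.
Defined.

Lemma sD_Zf v : sD v Zf = sC (v 0 0 +i* v 1 0)%C.
Proof. by apply/sfunP => x; rewrite /= /cD /= !derive_coord. Qed.

Lemma sD_Zf_ex : sD ex Zf = 1.
Proof. by rewrite sD_Zf !mxE /= rmorph1. Qed.

Lemma sD_Zf_ey : sD ey Zf = sC 'i.
Proof. by rewrite sD_Zf !mxE /= -complexiE. Qed.

Lemma sCi2 : sC 'i * sC 'i = -1.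
Proof. by rewrite -rmorphM -expr2 sqrCi rmorphN rmorph1. Qed.

(** The ring of functions is not a field, so this relation replaces division by 2: the factor 1 is
    written in this form where a half is needed. *)
Lemma sC2V : sC 2^-1 + sC 2^-1 = 1.
Proof. by rewrite -rmorphD -[2^-1]mul1r -splitr rmorph1. Qed.

Lemma dz_Zf : dz Zf = 1.
Proof. by rewrite /dz sD_Zf_ex sD_Zf_ey sCi2 opprK mulrDr mulr1 sC2V. Qed.

Lemma db_Zf : db Zf = 0.
Proof. by rewrite /db sD_Zf_ex sD_Zf_ey sCi2 subrr mulr0. Qed.

Lemma sD_lap f : sD ex (sD ex f) + sD ey (sD ey f) = sC 4 * dz (db f).
Proof.
rewrite /dz /db !sDM !sDD !sDM !sDC (sD_comm ey ex f).
have -> : sC 4 = 4 by rewrite rmorph_nat.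
have E := sCi2; have E2 := sC2V.
transitivity ((sC 2^-1 + sC 2^-1) * (sC 2^-1 + sC 2^-1) *
  (sD ex (sD ex f) - (sC 'i * sC 'i) * sD ey (sD ey f))); last by ring.
by rewrite E E2; ring.
Qed.

Lemma sD_inj (f : sfun) : dz f = 0 -> db f = 0 -> forall v, v = ex \/ v = ey -> sD v f = 0.
Proof.
move=> zf bf v.
have hx : sD ex f = 0.
  have : dz f + db f = 0 by rewrite zf bf addr0.
  rewrite /dz /db -mulrDr => E; rewrite -[LHS]mul1r -sC2V -[RHS]E; ring.
have hy : sD ey f = 0.
  have : db f - dz f = 0 by rewrite zf bf subr0.
  rewrite /dz /db -mulrBr hx => E.
  have {}E : sC 'i * sD ey f = 0 by rewrite -[LHS]mul1r -sC2V -[RHS]E; ring.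
  transitivity (- (sC 'i * (sC 'i * sD ey f))); last by rewrite E mulr0 oppr0.
  by rewrite mulrA sCi2 mulN1r opprK.
by case=> ->.
Qed.

Lemma sfun_cst (f : sfun) : dz f = 0 -> db f = 0 -> forall x y, f x = f y.
Proof.
move=> zf bf.
have D0 v : v = ex \/ v = ey -> forall (x : plane) t, f (x + t *: v) = f x.
  move=> /(sD_inj zf bf) E x t; have [sR sI] := sfun_smooth f.
  have Ey y : cD v f y = 0 by have := congr1 (fun g : sfun => g y) E.
  have [s _ hR] := @MVT_line R _ _ x v t (fun s _ => smooth_on_derivable sR I).
  have [s' _ hI] := @MVT_line R _ _ x v t (fun s _ => smooth_on_derivable sI I).
  have [eR _] := Ey (x + s *: v); have [_ eI] := Ey (x + s' *: v).
  move: hR hI; rewrite eR eI !mulr0 => /subr0_eq hR /subr0_eq hI.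
  by apply/eqP; rewrite eq_complex hR hI !eqxx.
move=> x y; rewrite [x]plane_decomp [y]plane_decomp !(D0 ey); [|by right|by right].
rewrite -[x 0 0 *: ex]add0r -[y 0 0 *: ex]add0r !(D0 ex)//; by left.
Qed.

Lemma sfun_cont0 (f : sfun) x e : 0 < e ->
  exists2 d : R, 0 < d & forall y, `|x - y| < d ->
    `|complex.Re (f x) - complex.Re (f y)| < e /\ `|complex.Im (f x) - complex.Im (f y)| < e.
Proof.
move=> e0; have [sR sI] := sfun_smooth f.
have /cvgrPdist_lt /(_ e e0) cR := smooth_on_cont (x := x) sR I.
have /cvgrPdist_lt /(_ e e0) cI := smooth_on_cont (x := x) sI I.
have : \forall y \near x, `|complex.Re (f x) - complex.Re (f y)| < e /\
    `|complex.Im (f x) - complex.Im (f y)| < e by exact: filterI cR cI.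
by move=> /nbhs_ballP[d /= d0 dP]; exists d => // y xy; apply: dP; rewrite -ball_normE.
Qed.

End SmoothFunctions.

(** * Inversion and Liouville's theorem *)

Section Inversion.
Variable R : realType.
Local Notation plane := 'cV[R]_(1 + 1).
Local Notation Z := (Zf R).

Definition pl (c : R[i]) : plane := complex.Re c *: ex + complex.Im c *: ey.

Lemma plE c : (pl c 0 0 = complex.Re c) * (pl c 1 0 = complex.Im c).
Proof. by split; rewrite !mxE /= ?mulr1 ?mulr0 ?addr0 ?add0r. Qed.

Lemma Zf_pl c : Z (pl c) = c.
Proof. by rewrite /= !plE; case: c. Qed.

Lemma pl_Zf p : pl (Z p) = p.
Proof. by apply: planeP; rewrite !plE. Qed.

Lemma Zf_eq0 (p : plane) : (Z p == 0) = (p == 0).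
Proof.
apply/eqP/eqP => [E|->]; last by rewrite /= !mxE.
by rewrite -[p]pl_Zf E; apply: planeP; rewrite !plE mxE.
Qed.

(** Since [0^-1 = 0], this is an involution of the whole plane; it is the change of chart only away
    from the origin. *)
Definition invp (p : plane) : plane := pl (Z p)^-1.

Lemma invp_neq0 p : p != 0 -> invp p != 0.
Proof. by rewrite -!Zf_eq0 Zf_pl invr_eq0. Qed.

Lemma invpK p : invp (invp p) = p.
Proof. by rewrite /invp Zf_pl invrK pl_Zf. Qed.

Lemma open_neq0 : open [set p : plane | p != 0].
Proof.
rewrite (_ : [set p | _] = Num.Def.normr @^-1` [set x : R | x != 0]); last first.
  by apply/seteqP; split => p /=; rewrite normr_eq0.
by apply: open_comp; [move=> p _; exact: norm_continuous|exact: open_neq].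
Qed.

Lemma csmooth_invZ : csmooth [set p : plane | p != 0] (fun p => (Z p)^-1).
Proof.
apply: csmoothV; [exact: open_neq0| by move=> x; rewrite /= Zf_eq0|].
exact: csmoothS (subsetT _) (sfun_smooth Z).
Qed.

Lemma smooth_invp : smooth_on [set p : plane | p != 0] invp.
Proof.
have [sR sI] := csmooth_invZ; apply/(smooth_on_mx _ open_neq0) => i j; rewrite (ord1 j).
by have [->|->] := ord2P i; [apply: (smooth_on_eq open_neq0 _ sR)|
  apply: (smooth_on_eq open_neq0 _ sI)] => p _; rewrite plE.
Qed.

Lemma derive_invp p v : p != 0 ->
  'D_v invp p = pl (- (v 0 0 +i* v 1 0)%C / Z p ^+ 2).
Proof.
move=> p0; have cE : cD v (fun p => (Z p)^-1) p = - (v 0 0 +i* v 1 0)%C / Z p ^+ 2.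
  rewrite (cDV v open_neq0 _ (csmoothS (subsetT _) (sfun_smooth Z)) p0).
    by have /(congr1 (fun f : sfun R => f p)) /= -> := sD_Zf v.
  by move=> x; rewrite /= Zf_eq0.
rewrite derive_mx; last exact: (smooth_on_derivable smooth_invp p0).
have e0 : (fun y => complex.Re (Z y)^-1) = (fun y => invp y 0 0).
  by apply/funext => y; rewrite plE.
have e1 : (fun y => complex.Im (Z y)^-1) = (fun y => invp y 1 0).
  by apply/funext => y; rewrite plE.
by move: cE; rewrite /cD e0 e1 => <-; apply: planeP; rewrite mxE plE.
Qed.

(* [inv_rel f g]: f and g are the expressions of one function on the sphere in the
   coordinates z and 1 / z. *)
Definition inv_rel (f g : sfun R) : Prop := forall p : plane, p != 0 -> f p = g (invp p).

Lemma inv_relD f g f' g' : inv_rel f g -> inv_rel f' g' -> inv_rel (f + f') (g + g').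
Proof. by move=> h h' p p0; rewrite !sfunD h ?h'. Qed.

Lemma inv_relN f g : inv_rel f g -> inv_rel (- f) (- g).
Proof. by move=> h p p0; rewrite !sfunN h. Qed.

Lemma inv_relM f g f' g' : inv_rel f g -> inv_rel f' g' -> inv_rel (f * f') (g * g').
Proof. by move=> h h' p p0; rewrite !sfunM h ?h'. Qed.

Lemma inv_relC c : inv_rel (sC c) (sC c). Proof. by []. Qed.

Lemma inv_relJ f g : inv_rel f g -> inv_rel (sJ f) (sJ g).
Proof. by move=> h p p0; rewrite /= h. Qed.

Lemma cD_invp (g : sfun R) p v : p != 0 ->
  cD v (fun p => g (invp p)) p =
    ('D_v invp p 0 0)%:C%C * sD ex g (invp p) + ('D_v invp p 1 0)%:C%C * sD ey g (invp p).
Proof.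
move=> p0; have [sR sI] := sfun_smooth g.
have eR := derive_chain v open_neq0 smooth_invp p0 sR.
have eI := derive_chain v open_neq0 smooth_invp p0 sI.
have ReDM (x y : R) (a b : R[i]) : complex.Re (x%:C%C * a + y%:C%C * b) =
    x * complex.Re a + y * complex.Re b.
  by case: a b => [? ?] [? ?] /=; rewrite !mul0r !subr0.
have ImDM (x y : R) (a b : R[i]) : complex.Im (x%:C%C * a + y%:C%C * b) =
    x * complex.Im a + y * complex.Im b.
  by case: a b => [? ?] [? ?] /=; rewrite !mul0r !addr0.
apply/eqP; rewrite eq_complex ReDM ImDM.
by apply/andP; split; apply/eqP; [exact: eR|exact: eI].
Qed.

(** For w = 1 / z one has dw / dz = -1 / z^2, and inversion is holomorphic, so no derivative in the
    conjugate of w enters. Each [dz] thus costs a factor [Z * Z] and a sign. *)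
Lemma inv_rel_dz f g : inv_rel f g -> inv_rel (Z * Z * dz f) (- dz g).
Proof.
have alg (i x y z a b k : R[i]) : i * i = -1 -> z * z * (x + i * y) = -1 ->
    z * z * (k * (x * a + y * b - i * (- y * a + x * b))) = - (k * (a - i * b)).
  move=> i2 zc; transitivity (z * z * (x + i * y) * (k * (a - i * b))); last first.
    by rewrite zc; ring.
  transitivity (z * z * (k * (x * a - (i * i) * y * b + i * y * a - i * x * b))).
    by rewrite i2; ring.
  by ring.
move=> h p p0; have z0 : Z p != 0 by rewrite Zf_eq0.
have E v : sD v f p = ('D_v invp p 0 0)%:C%C * sD ex g (invp p) +
    ('D_v invp p 1 0)%:C%C * sD ey g (invp p).
  by rewrite -cD_invp//; apply: (cD_eq v open_neq0 p0) => y /h.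
have dzE (h' : sfun R) q : dz h' q = 2^-1 * (sD ex h' q - 'i * sD ey h' q) by [].
have eE : ((ex : plane) 0 0 +i* (ex : plane) 1 0)%C = 1 :> R[i] by rewrite !mxE.
have eI : ((ey : plane) 0 0 +i* (ey : plane) 1 0)%C = 'i :> R[i].
  by rewrite !mxE /= -complexiE.
set z := Z p in z0 *; set a := sD ex g (invp p); set b := sD ey g (invp p).
(* The complex derivative of 1 / z at [p]; by the Cauchy-Riemann equations its real and imaginary
   parts fill the real Jacobian. *)
pose c : R[i] := - 1 / z ^+ 2.
have zc : z * z * c = -1 by rewrite /c; field.
have ic : - 'i / z ^+ 2 = 'i * c by rewrite /c; ring.
have Rc : complex.Re ('i * c) = - complex.Im c by rewrite -complexiE ReM /=; ring.
have Ic : complex.Im ('i * c) = complex.Re c by rewrite -complexiE ImM /=; ring.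
have Ex : sD ex f p = (complex.Re c)%:C%C * a + (complex.Im c)%:C%C * b.
  by rewrite E derive_invp// !plE eE.
have Ey : sD ey f p = - (complex.Im c)%:C%C * a + (complex.Re c)%:C%C * b.
  by rewrite E derive_invp// !plE eI ic Rc Ic rmorphN.
have cE : c = (complex.Re c)%:C%C + 'i * (complex.Im c)%:C%C.
  by rewrite -complexiE; exact: complexE.
have i2 : 'i * 'i = -1 :> R[i] by rewrite -expr2 sqrCi.
rewrite sfunN [LHS]sfunM (sfunM Z Z) !dzE Ex Ey -/z -/a -/b.
by apply: alg i2 _; rewrite -cE.
Qed.

Lemma normC_le_ReIm (w : R[i]) : `|w| <= (`|complex.Re w| + `|complex.Im w|)%:C%C.
Proof.
rewrite [w in leLHS]complexE (le_trans (ler_normD _ _))// rmorphD lerD//.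
  by rewrite normc_def /= expr0n addr0 sqrtr_sqr.
rewrite normrM [`|'i%C|]normc_def /= expr0n expr1n add0r sqrtr1 mul1r.
by rewrite normc_def /= expr0n addr0 sqrtr_sqr.
Qed.

Lemma Re_le_normC (w : R[i]) : (`|complex.Re w|)%:C%C <= `|w|.
Proof. exact: normc_ge_Re. Qed.

Lemma Im_le_normC (w : R[i]) : (`|complex.Im w|)%:C%C <= `|w|.
Proof.
have := normc_ge_Re (w * 'i%C); rewrite ReiNIm normrN normrM.
by rewrite [`|'i%C|]normc_def /= expr0n expr1n add0r sqrtr1 mulr1.
Qed.

Lemma norm_le_Zf (p : plane) (r : R) : 0 < r -> r <= `|p| -> r%:C%C <= `|Z p|.
Proof.
move=> r0 rp; rewrite real_leNgt ?normr_real//; last first.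
  by rewrite ger0_real// lecR ltW.
apply/negP => lt; move: rp; rewrite leNgt => /negP; apply.
by apply: norm_plane_lt => //; rewrite -ltcR; apply: le_lt_trans lt;
  [exact: (Re_le_normC (Z p))|exact: (Im_le_normC (Z p))].
Qed.

(** The relation writes [f] as z^(-k-1) g(1 / z) with [g] continuous at 0, so [f] tends to 0 at
    infinity, and its real part is harmonic. *)
Lemma Liouville_Re_le0 (f g : sfun R) k : db f = 0 -> inv_rel (Z ^+ k.+1 * f) g ->
  forall p, complex.Re (f p) <= 0.
Proof.
move=> hol rel; have [sR sI] := sfun_smooth f; apply: (harmonic_le0 sR).
  move=> x; have := sD_lap f; rewrite hol dz0 mulr0.
  by move=> /(congr1 (fun h : sfun R => complex.Re (h x))).
move=> e e0; have [d d0 dP] := sfun_cont0 g 0 ltr01.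
(* A bound for [g] near 0, where its real and imaginary parts each move by less than 1. *)
pose M := complex.Re `|g 0| + 2.
have M0 : 0 < M.
  rewrite /M ltr_wpDl// -lecR RRe_real ?normr_real//; exact: normr_ge0.
pose r := 1 + d^-1 + M / e.
have r0 : 0 < r by rewrite /r !addr_gt0// ?invr_gt0// divr_gt0.
have r1 : 1 <= r by rewrite /r -addrA lerDl addr_ge0// ltW// ?invr_gt0// divr_gt0.
have rd : r^-1 < d.
  by rewrite invf_plt ?posrE// /r addrAC ltrDr addr_gt0// divr_gt0.
have re : M / r <= e.
  by rewrite ler_pdivrMr// mulrC -ler_pdivrMr// /r lerDr addr_ge0// ltW// invr_gt0.
exists r => p rp.
have zr := norm_le_Zf r0 rp.
have p0 : p != 0.
  by apply: contraTneq rp => ->; rewrite normr0 -ltNge.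
have z0 : Z p != 0 by rewrite Zf_eq0.
have nV : `|(Z p)^-1| <= (r^-1)%:C%C.
  have rC : 0 < r%:C%C :> R[i] by rewrite -[0]/(0%:C%C) ltcR.
  by rewrite normfV fmorphV lef_pV2// posrE// normr_gt0.
have nq : `|invp p| < d.
  apply: norm_plane_lt => //; rewrite plE.
    by rewrite (le_lt_trans _ rd)// -lecR (le_trans (Re_le_normC _)).
  by rewrite (le_lt_trans _ rd)// -lecR (le_trans (Im_le_normC _)).
have ng : `|g (invp p)| <= M%:C%C.
  have -> : g (invp p) = g 0 - (g 0 - g (invp p)) by rewrite opprB addrC subrK.
  have -> : M%:C%C = `|g 0| + (2 : R)%:C%C.
    transitivity ((complex.Re `|g 0|)%:C%C + (2 : R)%:C%C); first exact: rmorphD.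
    by rewrite RRe_real ?normr_real.
  rewrite (le_trans (ler_normB _ _))// lerD//.
  rewrite (le_trans (normC_le_ReIm _))// lecR.
  have [] := dP (invp p); first by rewrite sub0r normrN.
  rewrite !raddfB /= => h1 h2; rewrite -[2]/(1 + 1); apply: lerD; exact: ltW.
have fE : f p = (Z p)^-1 ^+ k.+1 * g (invp p).
  by rewrite -rel// sfunM sfunX mulrA -exprMn mulVf// expr1n mul1r.
apply: (le_trans (ler_norm _)); rewrite -lecR (le_trans (Re_le_normC _))// fE.
rewrite normrM normrX exprS -mulrA.
apply: (@le_trans _ _ ((r^-1)%:C%C * (1 * M%:C%C))).
  apply: (ler_pM (normr_ge0 _) (mulr_ge0 (exprn_ge0 _ (normr_ge0 _)) (normr_ge0 _)) nV).
  apply: (ler_pM (exprn_ge0 _ (normr_ge0 _)) (normr_ge0 _) _ ng).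
  apply: exprn_ile1; [exact: normr_ge0|apply: (le_trans nV)].
  by rewrite -[1]/(1%:C%C) lecR invf_le1.
by rewrite mul1r -rmorphM lecR mulrC.
Qed.

(** The one-sided bound, applied to the multiples of [f] by 1, -1, i and -i, kills both parts. The
    exponent is at least 1, which excludes nonzero constants. *)
Lemma Liouville (f g : sfun R) k : db f = 0 -> inv_rel (Z ^+ k.+1 * f) g -> f = 0.
Proof.
move=> hol rel.
have Hc c : forall p, complex.Re (c * f p) <= 0.
  apply: (@Liouville_Re_le0 (sC c * f) (sC c * g) k).
    by rewrite dbM dbC hol mulr0 mul0r addr0.
  rewrite mulrCA; exact: inv_relM (inv_relC c) rel.
apply/sfunP => p; apply/eqP; rewrite eq_complex.
have := Hc 1 p; have := Hc (-1) p; have := Hc 'i%C p; have := Hc (- 'i%C) p.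
case: (f p) => a b; rewrite !ReM /= => b1 b2 a1 a2.
by rewrite !eq_le; apply/andP; split; apply/andP; split; lra.
Qed.

End Inversion.

(** * Structure equations *)

Section MatrixDerivation.
Variables (S : comNzRingType) (d : S -> S).
Hypothesis dD : forall f g, d (f + g) = d f + d g.
Hypothesis dM : forall f g, d (f * g) = d f * g + f * d g.
Variable n : nat.
Implicit Types X Y : 'M[S]_n.+1.

Definition md X : 'M[S]_n.+1 := map_mx d X.

Lemma der0 : d 0 = 0.
Proof. by apply: (addrI (d 0)); rewrite -dD !addr0. Qed.

Lemma der1 : d 1 = 0.
Proof. by apply: (addrI (d 1)); rewrite -{1 2}[d 1]mulr1 addr0 -[in RHS](mulr1 1) dM mulr1 mul1r. Qed.

Lemma derN f : d (- f) = - d f.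
Proof. by apply/eqP; rewrite -addr_eq0 -dD addNr der0. Qed.

Lemma der_sum I (r : seq I) (F : I -> S) : d (\sum_(i <- r) F i) = \sum_(i <- r) d (F i).
Proof.
by elim: r => [|i r IH]; rewrite ?big_nil ?der0// !big_cons dD IH.
Qed.

Lemma mdD X Y : md (X + Y) = md X + md Y.
Proof. by apply/matrixP => i j; rewrite !mxE dD. Qed.

Lemma mdN X : md (- X) = - md X.
Proof. by apply/matrixP => i j; rewrite !mxE derN. Qed.

Lemma mdM X Y : md (X * Y) = md X * Y + X * md Y.
Proof.
apply/matrixP => i j; rewrite !mxE der_sum -big_split; apply: eq_bigr => k _.
by rewrite dM !mxE.
Qed.

Lemma mdZ a X : md (a *: X) = d a *: X + a *: md X.
Proof. by apply/matrixP => i j; rewrite !mxE dM. Qed.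

Lemma md1 : md 1 = 0.
Proof. by apply/matrixP => i j; rewrite !mxE; case: eqP => _; rewrite ?der1 ?der0. Qed.

Lemma md_tr X : d (\tr X) = \tr (md X).
Proof. by rewrite /mxtrace der_sum; apply: eq_bigr => i _; rewrite mxE. Qed.

End MatrixDerivation.

(* The structure equations of a minimal Lagrangian surface, written for the rank-one
   projector [P] onto the line f(z) and two commuting derivations [d], [d']. *)
Section StructureEquations.
Variables (S : comNzRingType) (d d' : S -> S).
Hypothesis dD : forall f g, d (f + g) = d f + d g.
Hypothesis dM : forall f g, d (f * g) = d f * g + f * d g.
Hypothesis d'D : forall f g, d' (f + g) = d' f + d' g.
Hypothesis d'M : forall f g, d' (f * g) = d' f * g + f * d' g.
Hypothesis dd' : forall f, d (d' f) = d' (d f).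
Variables (P : 'M[S]_3) (lam : S).
Local Notation D := (md d).
Local Notation D' := (md d').
Local Notation A := (D P).
Local Notation B := (D' P).
Local Notation H := (D' A).
Local Notation C := (D A).
Hypothesis PP : P * P = P.
Hypothesis trP : \tr P = 1.
Hypothesis rk1 : forall X, P * X * P = \tr (P * X) *: P.
Hypothesis PAAP : P * A * A * P = 0.
Hypothesis PBBP : P * B * B * P = 0.
Hypothesis PABP : P * A * B * P = lam *: P.
Hypothesis PBAP : P * B * A * P = lam *: P.
Hypothesis PH : P * H = H * P.

Lemma mx_comm (X : 'M[S]_3) : D (D' X) = D' (D X).
Proof. by apply/matrixP => i j; rewrite !mxE dd'. Qed.

Lemma trC (X Y : 'M[S]_3) : \tr (X * Y) = \tr (Y * X).
Proof. exact: mxtrace_mulC. Qed.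

Lemma AP_PA : A * P + P * A = A.
Proof. by rewrite -(mdM dD dM) PP. Qed.

Lemma BP_PB : B * P + P * B = B.
Proof. by rewrite -(mdM d'D d'M) PP. Qed.

Lemma PXP0 X : X * P + P * X = X -> P * X * P = 0.
Proof.
move=> E; apply: (addrI (P * X * P)); rewrite addr0 -{3}E mulrDr mulrDl.
by rewrite -!mulrA PP !mulrA PP.
Qed.

Lemma PAP : P * A * P = 0. Proof. exact: PXP0 AP_PA. Qed.
Lemma PBP : P * B * P = 0. Proof. exact: PXP0 BP_PB. Qed.

Lemma AP_E X : X * P + P * X = X -> X * P = X - P * X.
Proof. by move=> {2}<-; rewrite addrK. Qed.

(* [X * P + P * X = X] says that [X] is off-diagonal for the splitting defined by [P]. *)
Lemma offdiag2 X Y : X * P + P * X = X -> Y * P + P * Y = Y -> X * Y * P = P * X * Y.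
Proof.
move=> /AP_E EX /AP_E EY; rewrite -mulrA EY mulrBr mulrA EX mulrBl.
by rewrite opprB addrCA subrr addr0.
Qed.

Lemma XYP X Y c : X * P + P * X = X -> Y * P + P * Y = Y -> P * X * Y * P = c *: P ->
  X * Y * P = c *: P.
Proof. by move=> hX hY <-; rewrite -(offdiag2 hX hY) -[RHS]mulrA PP. Qed.

Lemma ABP : A * B * P = lam *: P. Proof. exact: XYP AP_PA BP_PB PABP. Qed.
Lemma BAP : B * A * P = lam *: P. Proof. exact: XYP BP_PB AP_PA PBAP. Qed.
Lemma PAB : P * A * B = lam *: P. Proof. by rewrite -(offdiag2 AP_PA BP_PB) ABP. Qed.
Lemma PBA : P * B * A = lam *: P. Proof. by rewrite -(offdiag2 BP_PB AP_PA) BAP. Qed.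
Lemma AAP : A * A * P = 0.
Proof. by rewrite -(scale0r P); apply: XYP AP_PA AP_PA _; rewrite PAAP scale0r. Qed.
Lemma BBP : B * B * P = 0.
Proof. by rewrite -(scale0r P); apply: XYP BP_PB BP_PB _; rewrite PBBP scale0r. Qed.
Lemma PAA : P * A * A = 0. Proof. by rewrite -(offdiag2 AP_PA AP_PA) AAP. Qed.
Lemma PBB : P * B * B = 0. Proof. by rewrite -(offdiag2 BP_PB BP_PB) BBP. Qed.

Lemma AAA : A * A * A = 0.
Proof.
have -> : A * A * A = (A * P + P * A) * A * A by rewrite AP_PA.
rewrite !mulrDl PAA mul0r addr0 -[A * P * A]mulrA -mulrA PAA mulr0 //.
Qed.

(** On the basis e, A e, B e of C^3 the operator [A * B + B * A] should act by 2 lam, lam, lam; [Q]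
    measures the failure of this. By [QQ] and [trQ] its square has trace 0, which forces a Hermitian
    [Q] to vanish; the size 3 enters through the trace of the identity. *)
Definition Q : 'M[S]_3 := lam *: (1 + P) - (A * B + B * A).

Lemma ABAB : A * B * A * B = lam *: (A * B).
Proof.
have -> : A * B * A * B = (A * P + P * A) * B * A * B by rewrite AP_PA.
rewrite !mulrDl PAB -!scalerAl -[A * P * B]mulrA -[A * (P * B) * A]mulrA PBA -scalerAr -scalerAl.
by rewrite -scalerDr -mulrDl AP_PA.
Qed.

Lemma BABA : B * A * B * A = lam *: (B * A).
Proof.
have -> : B * A * B * A = (B * P + P * B) * A * B * A by rewrite BP_PB.
rewrite !mulrDl PBA -!scalerAl -[B * P * A]mulrA -[B * (P * A) * B]mulrA PAB -scalerAr -scalerAl.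
by rewrite -scalerDr -mulrDl BP_PB.
Qed.

Lemma ABBA : A * B * B * A = lam ^+ 2 *: P.
Proof.
have -> : A * B * B * A = (A * P + P * A) * B * B * A by rewrite AP_PA.
rewrite !mulrDl PAB -!scalerAl PBA scalerA -expr2.
by rewrite -[A * P * B]mulrA -[A * (P * B) * B]mulrA PBB mulr0 mul0r add0r.
Qed.

Lemma BAAB : B * A * A * B = lam ^+ 2 *: P.
Proof.
have -> : B * A * A * B = (B * P + P * B) * A * A * B by rewrite BP_PB.
rewrite !mulrDl PBA -!scalerAl PAB scalerA -expr2.
by rewrite -[B * P * A]mulrA -[B * (P * A) * A]mulrA PAA mulr0 mul0r add0r.
Qed.

Local Notation M := (A * B + B * A).

Lemma MP : M * P = (lam *+ 2) *: P.
Proof. by rewrite mulrDl ABP BAP -scalerDl mulr2n. Qed.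

Lemma PM : P * M = (lam *+ 2) *: P.
Proof. by rewrite mulrDr !mulrA PAB PBA -scalerDl mulr2n. Qed.

Lemma MM : M * M = lam *: M + (lam ^+ 2 *+ 2) *: P.
Proof.
rewrite mulrDl !mulrDr !mulrA ABAB ABBA BAAB BABA scalerDr mulr2n scalerDl.
by rewrite [X in _ + X = _]addrC addrACA.
Qed.

Lemma trAB : \tr (A * B) = lam *+ 2.
Proof.
by rewrite -{1}AP_PA mulrDl raddfD /= PAB -mulrA trC PBA !linearZ /= trP mulr1 mulr2n.
Qed.

Lemma QQ : Q * Q = lam *: Q.
Proof.
have E : lam * (lam *+ 2) = lam ^+ 2 *+ 2 by ring.
have PQ : P * Q = 0.
  by rewrite /Q mulrBr -scalerAr mulrDr mulr1 PP PM scalerDr -scalerDl -mulr2n subrr.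
have MQ : M * Q = 0.
  by rewrite /Q mulrBr -scalerAr mulrDr mulr1 MP MM scalerDr scalerA E subrr.
by rewrite {1}/Q mulrBl MQ subr0 -scalerAl mulrDl mul1r PQ addr0.
Qed.

Lemma trQ : \tr Q = 0.
Proof.
rewrite /Q raddfB /= linearZ /= raddfD /= mxtrace1 trP raddfD /= (trC B) trAB.
by ring.
Qed.

Lemma trQQ : \tr (Q * Q) = 0.
Proof. by rewrite QQ linearZ /= trQ mulr0. Qed.

Hypothesis Q0 : Q = 0.

Lemma ABBA_E : A * B + B * A = lam *: (1 + P).
Proof. by apply/esym/subr0_eq. Qed.

(** Applying [D'] to [A * P + P * A = A] gives H = H P + P H + (A B + B A), whose last term is known
    from [Q0]. Since [H] commutes with [P], multiplying by [P] determines H P. *)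
Lemma H_E : H = lam *: (1 - P *+ 3).
Proof.
have E : H = H * P + P * H + lam *: (1 + P).
  rewrite -ABBA_E -{1}AP_PA (mdD d'D) !(mdM d'D d'M).
  by rewrite -!addrA; congr (_ + _); rewrite [RHS]addrC -addrA.
have HP : H * P = - ((lam *+ 2) *: P).
  have := congr1 (fun X => X * P) E.
  rewrite !mulrDl -!scalerAl mulrDl mul1r PP -!mulrA PP -PH mulrA PP PH -addrA.
  move=> /eqP; rewrite -subr_eq0 opprD addrA subrr sub0r oppr_eq0 addr_eq0 => /eqP ->.
  by rewrite scalerDr -scalerDl mulr2n.
rewrite {1}E PH HP; rewrite -!scaleNr -scalerDl scalerDr scalerBr -scalerMnr.
rewrite addrCA; congr (_ + _); rewrite -scalerDl scalerMnl -scaleNr; congr (_ *: _).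
by ring.
Qed.

Local Notation l := (d lam).
Local Notation l' := (d' lam).

Lemma C_E : C = C * P + P * C + (A * A) *+ 2.
Proof.
have := congr1 (fun X => D X) AP_PA; rewrite (mdD dD) !(mdM dD dM) => {1}<-.
by rewrite [X in _ + X]addrC addrACA mulr2n.
Qed.

Lemma PCP : P * C * P = 0.
Proof.
have := congr1 (fun X => P * X * P) C_E.
rewrite mulr2n !mulrDr !mulrDl !mulrA PAA mul0r !addr0 -[P * C * P * P]mulrA !PP.
by rewrite -{1}[P * C * P]addr0 => /addrI/esym.
Qed.

Lemma ABA : A * B * A = lam *: A.
Proof.
rewrite -{1}AP_PA !mulrDl PAB -[A * P * B]mulrA -[A * (P * B) * A]mulrA PBA.
by rewrite -scalerAr -scalerAl -scalerDr AP_PA.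
Qed.

Lemma BAA : B * A * A = lam *: (P * A).
Proof.
have := congr1 (fun X => X * A) ABBA_E; rewrite mulrDl ABA -scalerAl mulrDl mul1r scalerDr.
by move/addrI.
Qed.

Lemma AAB : A * A * B = lam *: (A * P).
Proof.
have := congr1 (fun X => A * X) ABBA_E; rewrite mulrDr !mulrA ABA -scalerAr mulrDr mulr1.
by rewrite scalerDr [LHS]addrC => /addrI.
Qed.

(** The derivative of [BAP]: the terms free of [C] are known by [H_E] and [BAA] and sum to
    [lam *: A], which cancels against the derivative of [P] on the right. *)
Lemma BCP : B * C * P = l *: P.
Proof.
have := congr1 (fun X => D X) BAP.
rewrite (mdM dD dM) (mdM dD dM) (mdZ dM) mx_comm H_E BAA -scalerAl mulrBl mul1r.
rewrite mulrDl -[lam *: _ * P]scalerAl mulrBl mulrnAl mulrnAl PAP mul0rn subr0.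
by rewrite -[X in _ = _ + lam *: X]AP_PA scalerDr addrAC [RHS]addrC => /addrI.
Qed.

Lemma PCB : P * C * B = l *: P.
Proof.
have := congr1 (fun X => D X) PAB.
rewrite (mdM dD dM) (mdM dD dM) (mdZ dM) mx_comm H_E mulrDl AAB.
rewrite -scalerAr mulrBr mulr1 mulrnAr PAP mul0rn subr0.
by rewrite -[X in _ = _ + lam *: X]AP_PA scalerDr addrAC [RHS]addrC => /addrI.
Qed.

(** The coefficient of the cubic differential: in the application [B] is the adjoint of [A], and for
    a unit vector e of the line this is the Hermitian product of C e with B e. *)
Definition psi : S := \tr (P * A * C).

Lemma tr0 (X : 'M[S]_3) : P * X * P = 0 -> \tr (P * X) = 0.
Proof. by move=> E; rewrite -{1}PP -mulrA trC E raddf0. Qed.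

(** By [H_E] the [D']-derivatives of [A] and [C] are combinations of [1], [P] and [A]; every
    resulting trace vanishes through P C P, P A P, P A A or A A A. *)
Lemma der_psi : d' psi = 0.
Proof.
have trPC : \tr (P * C) = 0 := tr0 PCP.
have trPA : \tr (P * A) = 0 := tr0 PAP.
have D'C : D' C = l *: (1 - P *+ 3) + lam *: (- (A *+ 3)).
  rewrite -mx_comm H_E (mdZ dM) (mdD dD) (mdN dD) (md1 dD dM) add0r; congr (_ + _ *: - _).
  by rewrite !mulrS mulr0n !addr0 !(mdD dD).
have trBAC : \tr (B * A * C) = 0.
  rewrite {1}C_E mulr2n !mulrDr !raddfD /=.
  have -> : \tr (B * A * (C * P)) = 0.
    by rewrite mulrA trC !mulrA PBA -scalerAl linearZ /= trPC mulr0.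
  have -> : \tr (B * A * (P * C)) = 0.
    by rewrite mulrA BAP -scalerAl linearZ /= trPC mulr0.
  by rewrite -mulrA (mulrA A) AAA mulr0 raddf0 !addr0.
rewrite /psi (md_tr d'D) (mdM d'D d'M) (mdM d'D d'M) mulrDl !raddfD /= trBAC.
rewrite PH H_E D'C mulrDr -!scalerAr -!scalerAl mulrBl mul1r mulrnAl PP mulrBl mulrnAl.
rewrite mulrBr mulr1 mulrnAr mulrN mulrnAr PAA mul0rn oppr0 scaler0 addr0 PAP mul0rn subr0.
by rewrite !linearZ /= raddfB /= raddfMn /= trPC trPA mul0rn subr0 !mulr0 !addr0.
Qed.

Hypothesis psi0 : psi = 0.

Lemma PAC : P * A * C = 0.
Proof.
rewrite {1}C_E mulr2n !mulrDr !mulrA PAP mul0r PAA mul0r !addr0.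
by rewrite -[P * A * C]mulrA rk1 mulrA [\tr _]psi0 scale0r.
Qed.

Lemma PCA : P * C * A = 0.
Proof.
have := congr1 (fun X => D X) PAA.
rewrite !(mdM dD dM) mulrDl AAA add0r PAC addr0 => ->.
by apply/matrixP => i j; rewrite !mxE (der0 dD).
Qed.

(** As P C P = 0, the factor [A * B + B * A = lam *: (1 + P)] acts as [lam] on C P from the left and
    on P C from the right. One of its two terms is known from [BCP] or [PCB]; the other is killed by
    [psi0], through [PAC] and [PCA]. *)
Lemma lamC : lam *: C = l *: A + lam *: ((A * A) *+ 2).
Proof.
have CP : lam *: (C * P) = l *: (A * P).
  have -> : lam *: (C * P) = (A * B + B * A) * (C * P).
    by rewrite ABBA_E -scalerAl mulrDl mul1r mulrA PCP addr0.
  rewrite mulrDl -[A * B * (C * P)]mulrA [B * (C * P)]mulrA BCP -scalerAr.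
  suff -> : B * A * (C * P) = 0 by rewrite addr0.
  rewrite -[B * A * _]mulrA [A * (C * P)]mulrA -{1}AP_PA !mulrDl -[A * P * C]mulrA.
  by rewrite PAC -[A * (P * C) * P]mulrA PCP mulr0 mul0r addr0 mulr0.
have PC : lam *: (P * C) = l *: (P * A).
  have -> : lam *: (P * C) = P * C * (A * B + B * A).
    by rewrite ABBA_E -scalerAr mulrDr mulr1 PCP addr0.
  by rewrite mulrDr !mulrA PCA mul0r add0r PCB -scalerAl.
by rewrite {1}C_E !scalerDr CP PC -scalerDr AP_PA.
Qed.

Variable k : S.
Hypothesis klam : k * lam = 1.

Definition dlog : S := k * l.
Definition dlogb : S := k * l'.
Definition opN : 'M[S]_3 := k *: A.
(** Once psi vanishes, the derivative of A A is [dlog *+ 2] times A A, so dividing by [lam ^+ 2]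
    gives an operator killed by [D]. It sends B e to a multiple of A e and kills e and A e. *)
Definition opE : 'M[S]_3 := k ^+ 2 *: (A * A).

Lemma der_inv (e : S -> S) : (forall f g, e (f + g) = e f + e g) ->
  (forall f g, e (f * g) = e f * g + f * e g) -> e k = - (k ^+ 2 * e lam).
Proof.
move=> eD eM; have := eM k lam; rewrite klam (der1 eM) => E1.
transitivity (e k * (k * lam)); first by rewrite klam mulr1.
transitivity (k * (e k * lam + k * e lam) - k ^+ 2 * e lam); first by ring.
by rewrite -E1 mulr0 sub0r.
Qed.

Lemma dN_E : D opN = (lam *+ 2) *: opE.
Proof.
have CE : C = dlog *: A + (A * A) *+ 2.
  rewrite -[LHS]scale1r -klam -scalerA lamC scalerDr scalerA.
  by rewrite scalerA klam scale1r.
rewrite /opN (mdZ dM) (der_inv dD dM) CE scalerDr !scalerA /dlog.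
have -> : k * (k * l) = k ^+ 2 * l by ring.
rewrite addrA -scalerDl addNr scale0r add0r /opE -scalerMnr scalerMnl.
by congr (_ *: _); transitivity ((k * lam) * k *+ 2); [rewrite klam; ring|ring].
Qed.

Lemma dE_E : D opE = 0.
Proof.
have CE : C = dlog *: A + (A * A) *+ 2.
  rewrite -[LHS]scale1r -klam -scalerA lamC scalerDr scalerA.
  by rewrite scalerA klam scale1r.
rewrite /opE (mdZ dM) (mdM dD dM) CE mulrDl mulrDr mulrnAl mulrnAr mulrA AAA mul0rn !addr0.
rewrite -scalerAl -scalerAr -scalerDl scalerA -scalerDl.
rewrite expr2 dM (der_inv dD dM) /dlog -[RHS](scale0r (A * A)); congr (_ *: _); ring.
Qed.

Lemma d'N_E : D' opN = 1 - P *+ 3 - dlogb *: opN.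
Proof.
rewrite /opN (mdZ d'M) (der_inv d'D d'M) H_E !scalerA klam scale1r addrC; congr (_ + _).
by rewrite -scaleNr /dlogb; congr (_ *: _); ring.
Qed.

Lemma d'E_E : D' opE = - opN - (dlogb *+ 2) *: opE.
Proof.
have HA : H * A + A * H = - (lam *: A).
  rewrite H_E -scalerAl -scalerAr -scalerDr mulrBl mulrBr mul1r mulr1 mulrnAl mulrnAr.
  rewrite addrACA -opprD -mulrnDl [P * A + _]addrC AP_PA -mulr2n -scalerN; congr (_ *: _).
  by rewrite (mulrSr A 2) opprD addrA subrr sub0r.
rewrite /opE (mdZ d'M) (mdM d'D d'M) HA expr2 d'M (der_inv d'D d'M) scalerN scalerA addrC.
rewrite scalerA -[k * k * lam]mulrA klam mulr1 -[X in _ = _ + X]scaleNr.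
by congr (_ + _ *: _); rewrite /dlogb; ring.
Qed.

Lemma trAABB : \tr (A * A * (B * B)) = lam ^+ 2.
Proof. by rewrite trC -mulrA trC !mulrA BAAB linearZ /= trP mulr1. Qed.

Variable half : S.
Hypothesis half2 : half + half = 1.

(** Liouville's equation for the logarithm of [lam]: the induced metric has constant positive
    curvature. It is the integrability condition D D' = D' D on [opE]; pairing with B B extracts the
    scalar. *)
Lemma d_dlogb : d dlogb = - lam.
Proof.
have : D (D' opE) = 0 by rewrite mx_comm dE_E; apply/matrixP => i j; rewrite !mxE (der0 d'D).
rewrite d'E_E (mdD dD) !(mdN dD) (mdZ dM) dE_E scaler0 addr0 dN_E -opprD -scalerDl.
move=> /eqP; rewrite oppr_eq0 => /eqP /(congr1 (fun X => \tr (X * (B * B)))).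
rewrite mul0r raddf0 -scalerAl linearZ /= /opE -scalerAl linearZ /= trAABB.
rewrite -exprMn klam expr1n mulr1 mulr2n dD.
move=> E0; apply/eqP; rewrite -addr_eq0; apply/eqP.
transitivity ((half + half) * (d dlogb + lam)); first by rewrite half2 mul1r.
by transitivity (half * (lam + lam + (d dlogb + d dlogb))); [ring|rewrite E0 mulr0].
Qed.

Lemma d'_dlog : d' dlog = - lam.
Proof.
rewrite -d_dlogb /dlog /dlogb dM d'M (der_inv dD dM) (der_inv d'D d'M) dd'; ring.
Qed.

(* Twice the Schwarzian derivative of a primitive of [lam] is holomorphic. *)
Lemma der_schwarzian : d' (d dlog + d dlog - dlog ^+ 2) = 0.
Proof.
have El : dlog * lam = l by rewrite /dlog mulrAC klam mul1r.
rewrite !d'D (derN d'D) expr2 d'M -dd' d'_dlog (derN dD) -El; ring.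
Qed.

End StructureEquations.

(* Entrywise, the system satisfied by [E, N, 3P - 1] and their adjoints makes [E] a
   polynomial of degree 4 in the conjugate coordinate [zb]. *)
Section Taylor.
Variables (S : comNzRingType) (d d' : S -> S).
Hypothesis dD : forall f g, d (f + g) = d f + d g.
Hypothesis dM : forall f g, d (f * g) = d f * g + f * d g.
Hypothesis d'D : forall f g, d' (f + g) = d' f + d' g.
Hypothesis d'M : forall f g, d' (f * g) = d' f * g + f * d' g.
Hypothesis dd' : forall f, d (d' f) = d' (d f).
Variables (h r s : S).
Hypothesis h2 : h + h = 1.
Hypothesis r6 : 6 * r = 1.
Hypothesis s24 : 24 * s = 1.
Variables (lam mb e n f nb eb : S).
Hypothesis d'lam : d' lam = lam * mb.
Hypothesis d'mb : d' mb = h * mb ^+ 2.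
Hypothesis d'e : d' e = - n - 2 * mb * e.
Hypothesis d'n : d' n = - f - mb * n.
Hypothesis d'f : d' f = 3 * (lam * nb).
Hypothesis d'nb : d' nb = 2 * (lam * eb).
Hypothesis d'eb : d' eb = 0.
Hypothesis de : d e = 0.

(** Successive [d']-derivatives of [e], reduced by the system. They stay polynomials in the same
    unknowns because [mb] satisfies a Riccati equation, and the fifth is 0. *)
Definition tay1 : S := - n - 2 * mb * e.
Definition tay2 : S := f + 3 * mb * n + 3 * mb ^+ 2 * e.
Definition tay3 : S := h * (6 * lam * nb - 6 * mb * f - 9 * mb ^+ 2 * n - 6 * mb ^+ 3 * e).
Definition tay4 : S := h * (12 * lam ^+ 2 * eb - 12 * lam * mb * nb + 6 * mb ^+ 2 * f +
  6 * mb ^+ 3 * n + 3 * mb ^+ 4 * e).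

Lemma d'nat i : d' i%:R = 0.
Proof. by elim: i => [|i IH]; rewrite ?(der0 d'D)// -natr1 d'D IH (der1 d'M) addr0. Qed.

Lemma der_unit_nat (u : S) i : i%:R * u = 1 -> d' u = 0 /\ d u = 0.
Proof.
move=> E; have dnat j : d j%:R = 0.
  by elim: j => [|j IH]; rewrite ?(der0 dD)// -natr1 dD IH (der1 dM) addr0.
have h' := congr1 d' E; have h'' := congr1 d E.
rewrite d'M d'nat mul0r add0r (der1 d'M) in h'.
rewrite dM dnat mul0r add0r (der1 dM) in h''.
split; rewrite -[LHS]mul1r -E -mulrA [u * _]mulrC mulrA ?h' ?h''; exact: mul0r.
Qed.

Lemma h_nat : 2%:R * h = 1. Proof. by rewrite mulr_natl mulr2n h2. Qed.

Lemma d'h : d' h = 0. Proof. by case: (der_unit_nat h_nat). Qed.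

Ltac der := rewrite ?(exprS, expr0, mulr1);
  rewrite ?(d'D, derN d'D, d'M, d'nat, d'h, d'lam, d'mb, d'e, d'n, d'f, d'nb, d'eb).

(** All that is known of [h] is [h + h = 1]. The witness [z] is the quotient of the difference of
    the two sides by [1 - (h + h)], after which [ring] applies. *)
Lemma eq_mod_half (x y z : S) : x = y + (1 - (h + h)) * z -> x = y.
Proof. by move=> ->; rewrite h2 subrr mul0r addr0. Qed.

Lemma d'e0 : d' e = tay1. Proof. exact: d'e. Qed.

Lemma d'tay1 : d' tay1 = tay2.
Proof. by rewrite /tay1; der; apply: (@eq_mod_half _ _ (mb ^+ 2 * e)); rewrite /tay2; ring. Qed.

Lemma d'tay2 : d' tay2 = tay3.
Proof.
rewrite /tay2; der; rewrite /tay3.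
apply: (@eq_mod_half _ _ (3 * lam * nb - 3 * mb * f - 6 * mb ^+ 2 * n - 6 * mb ^+ 3 * e)).
by ring.
Qed.

Lemma d'tay3 : d' tay3 = tay4.
Proof.
rewrite /tay3; der; rewrite /tay4.
by apply: (@eq_mod_half _ _ (h * (3 * mb ^+ 2 * f + 9 * mb ^+ 3 * n + 9 * mb ^+ 4 * e))); ring.
Qed.

Lemma d'tay4 : d' tay4 = 0.
Proof.
rewrite /tay4; der.
apply: (@eq_mod_half _ _ (h * (6 * lam * mb ^+ 2 * nb - 6 * mb ^+ 3 * f - 9 * mb ^+ 4 * n -
  6 * mb ^+ 5 * e))).
by ring.
Qed.

Lemma de_all : [/\ d tay1 = 0, d tay2 = 0, d tay3 = 0 & d tay4 = 0].
Proof.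
have E1 : d tay1 = 0 by rewrite -d'e0 dd' de (der0 d'D).
have E2 : d tay2 = 0 by rewrite -d'tay1 dd' E1 (der0 d'D).
have E3 : d tay3 = 0 by rewrite -d'tay2 dd' E2 (der0 d'D).
by split=> //; rewrite -d'tay3 dd' E3 (der0 d'D).
Qed.

Variables (zb t : S).
Hypothesis d'zb : d' zb = 1.
Hypothesis dzb : d zb = 0.
Hypothesis d't : d' t = 0.
Hypothesis dt : d t = 0.

(** The expansion of [e] around [zb], evaluated at the constant [t], with 1/2, 1/6, 1/24 for [h],
    [r], [s]. Both derivations kill it, so its value where [zb = t], which is that of [e], equals
    its value at the origin. *)
Definition taylor : S := let u := t - zb in
  e + u * tay1 + h * u ^+ 2 * tay2 + r * u ^+ 3 * tay3 + s * u ^+ 4 * tay4.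

Lemma der_taylor : d taylor = 0.
Proof.
have [E1 E2 E3 E4] := de_all.
have [_ dh] := der_unit_nat h_nat.
have [_ dr] := der_unit_nat r6; have [_ ds] := der_unit_nat s24.
rewrite /taylor !(exprS, expr0, mulr1).
move: tay1 tay2 tay3 tay4 E1 E2 E3 E4 => ? ? ? ? E1 E2 E3 E4.
by rewrite !(dD, dM) !(derN dD) dzb dt dh dr ds de E1 E2 E3 E4; ring.
Qed.

Lemma der_taylor' : d' taylor = 0.
Proof.
have [dr _] := der_unit_nat r6; have [ds _] := der_unit_nat s24.
have rh : 3 * r = h.
  transitivity (6 * r * h); last by rewrite r6 mul1r.
  by transitivity (3 * r * (2%:R * h)); [rewrite h_nat mulr1|ring].
have sr : 4 * s = r.
  transitivity (24 * s * r); last by rewrite s24 mul1r.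
  by transitivity (4 * s * (6 * r)); [rewrite r6 mulr1|ring].
rewrite /taylor !(exprS, expr0, mulr1).
move: tay1 tay2 tay3 tay4 d'e0 d'tay1 d'tay2 d'tay3 d'tay4 => f1 f2 f3 f4 E0 E1 E2 E3 E4.
rewrite !(d'D, d'M) !(derN d'D) d'zb d't d'h dr ds E0 E1 E2 E3 E4.
set u := t - zb.
transitivity ((1 - (h + h)) * u * f2 + (h - 3 * r) * u ^+ 2 * f3 + (r - 4 * s) * u ^+ 3 * f4).
  by ring.
by rewrite h2 rh sr !subrr !mul0r !addr0.
Qed.

End Taylor.

Local Open Scope sesquilinear_scope.
Local Open Scope ring_scope.

(** * Hermitian products and the Fubini-Study metric *)

Section Hermitian.
Variable R : realType.
Local Notation C := R[i].

Lemma Re_eq (x y : C) : x + x^* = y + y^* -> complex.Re x = complex.Re y.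
Proof.
case: x y => [a b] [c e] /eqP; rewrite eq_complex /= => /andP[/eqP h _].
by lra.
Qed.

Section Hdot.
Variable n : nat.
Implicit Types (a b c : 'cV[C]_n) (z : C).

Lemma hdotDl a b c : hdot (a + b) c = hdot a c + hdot b c.
Proof. by rewrite /hdot -big_split; apply: eq_bigr => i _; rewrite mxE mulrDl. Qed.

Lemma hdotDr a b c : hdot a (b + c) = hdot a b + hdot a c.
Proof. by rewrite /hdot -big_split; apply: eq_bigr => i _; rewrite mxE rmorphD mulrDr. Qed.

Lemma hdotZl z a b : hdot (z *: a) b = z * hdot a b.
Proof. by rewrite /hdot mulr_sumr; apply: eq_bigr => i _; rewrite mxE mulrA. Qed.

Lemma hdotZr z a b : hdot a (z *: b) = z^* * hdot a b.
Proof. by rewrite /hdot mulr_sumr; apply: eq_bigr => i _; rewrite mxE rmorphM mulrCA. Qed.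

Lemma hdotC a b : (hdot a b)^* = hdot b a.
Proof. by rewrite /hdot rmorph_sum; apply: eq_bigr => i _; rewrite rmorphM /= conjCK mulrC. Qed.

Lemma hdotNl a b : hdot (- a) b = - hdot a b.
Proof. by rewrite -scaleN1r hdotZl mulN1r. Qed.

Lemma hdotNr a b : hdot a (- b) = - hdot a b.
Proof. by rewrite -scaleN1r hdotZr rmorphN rmorph1 mulN1r. Qed.

Lemma hdot0l b : hdot 0 b = 0.
Proof. by rewrite -(scale0r 0) hdotZl mul0r. Qed.

Lemma hdot0r b : hdot b 0 = 0.
Proof. by rewrite -hdotC hdot0l rmorph0. Qed.

Lemma hdot_ge0 a : 0 <= hdot a a.
Proof. by rewrite sumr_ge0// => i _; rewrite mul_conjC_ge0. Qed.

Lemma hdot_eq0 a : (hdot a a == 0) = (a == 0).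
Proof.
apply/idP/eqP => [|->]; last by rewrite hdot0l.
rewrite psumr_eq0 => [/allP h|i _]; last by rewrite mul_conjC_ge0.
apply/matrixP => i j; rewrite (ord1 j) mxE; apply/eqP.
by have := h i (mem_index_enum _); rewrite mul_conjC_eq0.
Qed.

Lemma hdot_real a : (hdot a a)^* = hdot a a.
Proof. exact: hdotC. Qed.

End Hdot.

Lemma hdot_mul (n : nat) (A : 'M[C]_n) (a b : 'cV[C]_n) : A \is unitarymx ->
  hdot (A *m a) (A *m b) = hdot a b.
Proof.
have E m (x y : 'cV[C]_m) : hdot x y = (y ^t* *m x) 0 0.
  by rewrite mxE; apply: eq_bigr => i _; rewrite !mxE mulrC.
move=> uA; rewrite !E trmx_mul map_mxM mulmxA -[_ *m A]mulmxA.
have -> : A ^t* *m A = 1%:M by rewrite -invmx_unitary// mulVmx// unitarymx_unit.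
by rewrite mulmx1.
Qed.

Section Insert.
Variable n : nat.
Implicit Types (p q u v : 'cV[R]_(n + n)) (w : 'cV[C]_n) (k : 'I_n.+1).

Lemma of_realE p i : of_real p i 0 = (p (lshift n i) 0 +i* p (rshift n i) 0)%C.
Proof. by rewrite !mxE. Qed.

Lemma of_realD p q : of_real (p + q) = of_real p + of_real q.
Proof. by apply/matrixP => i j; rewrite !mxE. Qed.

Lemma of_realZ (c : R) p : of_real (c *: p) = c%:C%C *: of_real p.
Proof.
apply/matrixP => i j; rewrite !mxE.
by apply/eqP; rewrite eq_complex /= !mul0r subr0 addr0 !eqxx.
Qed.

Lemma of_real0 : of_real (0 : 'cV[R]_(n + n)) = 0.
Proof. by apply/matrixP => i j; rewrite !mxE. Qed.

Lemma of_realJ p : of_real (cplxJ p) = 'i *: of_real p.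
Proof.
apply/matrixP => i j; rewrite (ord1 j) of_realE /cplxJ col_mxEu col_mxEd !mxE -complexiE.
by apply/eqP; rewrite eq_complex /= !mul0r !mul1r sub0r add0r !eqxx.
Qed.

Lemma to_realK p : to_real (of_real p) = p.
Proof.
apply/matrixP => i j; rewrite (ord1 j); case: (split_ordP i) => a ->.
  by rewrite col_mxEu !mxE.
by rewrite col_mxEd !mxE.
Qed.

Lemma of_realK w : of_real (to_real w) = w.
Proof.
apply/matrixP => i j; rewrite (ord1 j) of_realE /to_real col_mxEu col_mxEd !mxE.
by case: (w i 0).
Qed.

Lemma insertD k a b w w' : insert k (a + b) (w + w') = insert k a w + insert k b w'.
Proof. by apply/matrixP => i j; rewrite !mxE; case: unliftP => [?|] _; rewrite ?mxE. Qed.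

Lemma insertZ k c a w : insert k (c * a) (c *: w) = c *: insert k a w.
Proof. by apply/matrixP => i j; rewrite !mxE; case: unliftP => [?|] _; rewrite ?mxE. Qed.

Lemma insert_k k a w : insert k a w k 0 = a.
Proof. by rewrite mxE unlift_none. Qed.

Lemma insert_lift k a w i : insert k a w (lift k i) 0 = w i 0.
Proof. by rewrite mxE liftK. Qed.

Lemma insert_eq0 k w : insert k 0 w = 0 -> w = 0.
Proof.
move=> E; apply/matrixP => i j; rewrite (ord1 j) -(insert_lift k 0 w i) E !mxE //.
Qed.

Definition point k p : 'cV[C]_n.+1 := insert k 1 (of_real p).
Definition tvec k u : 'cV[C]_n.+1 := insert k 0 (of_real u).

Lemma tvecD k u v : tvec k (u + v) = tvec k u + tvec k v.
Proof. by rewrite /tvec of_realD -insertD addr0. Qed.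

Lemma tvecZ k (c : R) u : tvec k (c *: u) = c%:C%C *: tvec k u.
Proof. by rewrite /tvec of_realZ -insertZ mulr0. Qed.

Lemma tvecJ k u : tvec k (cplxJ u) = 'i *: tvec k u.
Proof. by rewrite /tvec of_realJ -insertZ mulr0. Qed.

Lemma tvec_eq0 k u : tvec k u = 0 -> u = 0.
Proof. by move=> /insert_eq0 E; rewrite -[u]to_realK E -[0 in LHS]of_real0 to_realK. Qed.

Lemma point_neq0 k p : point k p != 0.
Proof.
by apply/eqP => /matrixP/(_ k 0); rewrite insert_k mxE => /eqP; rewrite oner_eq0.
Qed.

End Insert.

End Hermitian.

(** * Calculus of matrix-valued functions *)

Section MatrixCalculus.
Context {R : realType} {V : normedModType R}.
Local Notation C := R[i].

Definition msmooth m n (U : set V) (M : V -> 'M[C]_(m, n)) : Prop :=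
  forall i j, csmooth U (fun y => M y i j).

Definition mcD m n (v : V) (M : V -> 'M[C]_(m, n)) (x : V) : 'M[C]_(m, n) :=
  \matrix_(i, j) cD v (fun y => M y i j) x.

Variables (U : set V) (oU : open U).

Lemma msmooth_cst m n (M : 'M[C]_(m, n)) : msmooth U (fun=> M).
Proof. by move=> i j; exact: csmooth_cst. Qed.

Lemma msmoothM m n p (M : V -> 'M[C]_(m, n)) (M' : V -> 'M[C]_(n, p)) :
  msmooth U M -> msmooth U M' -> msmooth U (fun x => M x *m M' x).
Proof.
move=> sM sM' i j.
apply: (csmooth_eq oU _ (@csmooth_sum _ _ U _ (index_enum _) xpredT
  (fun k x => M x i k * M' x k j) oU (fun k => csmoothM oU (sM i k) (sM' k j)))).
by move=> x _; rewrite mxE.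
Qed.

Lemma msmoothZ m n (f : V -> C) (M : V -> 'M[C]_(m, n)) :
  csmooth U f -> msmooth U M -> msmooth U (fun x => f x *: M x).
Proof.
move=> sf sM i j; apply: (csmooth_eq oU _ (csmoothM oU sf (sM i j))).
by move=> x _; rewrite mxE.
Qed.

Lemma msmooth_adj m n (M : V -> 'M[C]_(m, n)) :
  msmooth U M -> msmooth U (fun x => (M x)^t*).
Proof.
move=> sM i j; apply: (csmooth_eq oU _ (csmoothJ oU (sM j i))).
by move=> x _; rewrite !mxE.
Qed.

Lemma msmooth_mcD m n v (M : V -> 'M[C]_(m, n)) : msmooth U M -> msmooth U (mcD v M).
Proof.
move=> sM i j; apply: (csmooth_eq oU _ (csmooth_cD v oU (sM i j))).
by move=> x _; rewrite mxE.
Qed.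

Lemma mcD_eq m n v (M M' : V -> 'M[C]_(m, n)) x : U x -> (forall y, U y -> M y = M' y) ->
  mcD v M x = mcD v M' x.
Proof.
move=> Ux E; apply/matrixP => i j; rewrite !mxE.
by apply: (cD_eq v oU Ux) => y /E ->.
Qed.

Lemma mcD_cst m n v (M : 'M[C]_(m, n)) x : mcD v (fun=> M) x = 0.
Proof. by apply/matrixP => i j; rewrite !mxE cD_cst. Qed.

Lemma mcDM m n p v (M : V -> 'M[C]_(m, n)) (M' : V -> 'M[C]_(n, p)) x :
  msmooth U M -> msmooth U M' -> U x ->
  mcD v (fun x => M x *m M' x) x = mcD v M x *m M' x + M x *m mcD v M' x.
Proof.
move=> sM sM' Ux; apply/matrixP => i j; rewrite !mxE -big_split /=.
have s k : csmooth U (fun x => M x i k * M' x k j) := csmoothM oU (sM i k) (sM' k j).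
have -> : cD v (fun y => (M y *m M' y) i j) x =
    cD v (fun y => \sum_k M y i k * M' y k j) x.
  by apply: (cD_eq v oU Ux) => y _; rewrite mxE.
rewrite (cD_sum v (index_enum _) oU s Ux); apply: eq_bigr => k _.
by rewrite (cDM v (sM i k) (sM' k j) Ux) !mxE.
Qed.

Lemma mcDD m n v (M M' : V -> 'M[C]_(m, n)) x :
  msmooth U M -> msmooth U M' -> U x ->
  mcD v (fun x => M x + M' x) x = mcD v M x + mcD v M' x.
Proof.
move=> sM sM' Ux; apply/matrixP => i j; rewrite [LHS]mxE [RHS]mxE 2![in RHS]mxE.
rewrite -(cDD v (sM i j) (sM' i j) Ux).
by apply: (cD_eq v oU Ux) => y _; rewrite mxE.
Qed.

Lemma mcDZ m n v (f : V -> C) (M : V -> 'M[C]_(m, n)) x :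
  csmooth U f -> msmooth U M -> U x ->
  mcD v (fun x => f x *: M x) x = cD v f x *: M x + f x *: mcD v M x.
Proof.
move=> sf sM Ux; apply/matrixP => i j; rewrite !mxE -(cDM v sf (sM i j) Ux).
by apply: (cD_eq v oU Ux) => y _; rewrite mxE.
Qed.

Lemma mcD_adj m n v (M : V -> 'M[C]_(m, n)) x : msmooth U M -> U x ->
  mcD v (fun x => (M x)^t*) x = (mcD v M x)^t*.
Proof.
move=> sM Ux; apply/matrixP => i j; rewrite !mxE -(cDJ v (sM j i) Ux).
by apply: (cD_eq v oU Ux) => y _; rewrite !mxE.
Qed.

Lemma hdot_mulE n (x y : 'cV[C]_n) : hdot x y = (y ^t* *m x) 0 0.
Proof. by rewrite mxE; apply: eq_bigr => i _; rewrite !mxE mulrC. Qed.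

Lemma csmooth_hdot n (F G : V -> 'cV[C]_n) : msmooth U F -> msmooth U G ->
  csmooth U (fun x => hdot (F x) (G x)).
Proof.
move=> sF sG; apply: (csmooth_eq oU _ (msmoothM (msmooth_adj sG) sF 0 0)).
by move=> x _; rewrite hdot_mulE.
Qed.

Lemma cD_hdot n v (F G : V -> 'cV[C]_n) x : msmooth U F -> msmooth U G -> U x ->
  cD v (fun x => hdot (F x) (G x)) x = hdot (mcD v F x) (G x) + hdot (F x) (mcD v G x).
Proof.
move=> sF sG Ux; rewrite !hdot_mulE -mcD_adj// addrC.
have /matrixP/(_ 0 0) := mcDM v (msmooth_adj sG) sF Ux.
rewrite mxE [RHS]mxE => <-.
by apply: (cD_eq v oU Ux) => y _; rewrite hdot_mulE.
Qed.

End MatrixCalculus.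

(** * The Levi-Civita connection of the Fubini-Study metric in an affine chart *)

Section FubiniStudy.
Variables (R : realType) (n : nat) (k : 'I_n.+1).
Local Notation C := R[i].
Local Notation F := (@point R n k).
Local Notation T := (@tvec R n k).
Local Notation g := (@fubini_study R n k).
Implicit Types (p q u v a b : 'cV[R]_(n + n)).

Lemma msmooth_point : msmooth setT F.
Proof.
move=> i j; rewrite (ord1 j).
case: (unliftP k i) => [l ->|->].
  apply: (csmooth_eq openT (f := fun p => (p (lshift n l) 0 +i* p (rshift n l) 0)%C)).
    by move=> p _; rewrite insert_lift of_realE.
  by split; apply: smooth_on_coord; exact: openT.
apply: (csmooth_eq openT _ (csmooth_cst setT 1)) => p _.
by rewrite insert_k.
Qed.

Lemma mcD_point v p : mcD v F p = T v.
Proof.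
apply/matrixP => i j; rewrite mxE (ord1 j).
case: (unliftP k i) => [l ->|->].
  transitivity (cD v (fun p => (p (lshift n l) 0 +i* p (rshift n l) 0)%C) p).
    by apply: (cD_eq v openT I) => q _; rewrite insert_lift of_realE.
  by rewrite insert_lift of_realE /cD !derive_coord.
rewrite insert_k; transitivity (cD v (fun=> 1) p); last exact: cD_cst.
by apply: (cD_eq v openT I) => q _; rewrite insert_k.
Qed.

Lemma point_hdot_neq0 p : hdot (F p) (F p) != 0.
Proof. by rewrite hdot_eq0 point_neq0. Qed.

Definition fs_der p a u v : C :=
  let s := hdot (F p) (F p) in let s' := hdot (T a) (F p) + hdot (F p) (T a) in
  (hdot (T u) (T v) * s' - (hdot (T u) (T a) * hdot (F p) (T v) +
    hdot (T u) (F p) * hdot (T a) (T v))) / s ^+ 2 -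
  2 * (hdot (T u) (T v) * s - hdot (T u) (F p) * hdot (F p) (T v)) * s' / s ^+ 3.

Lemma cD_fs_herm p a u v :
  cD a (fun q => fs_herm (F q) (T u) (T v)) p = fs_der p a u v.
Proof.
have sF := msmooth_point.
have sT w : msmooth setT (fun _ : 'cV[R]_(n + n) => T w) by exact: msmooth_cst.
have ss := csmooth_hdot openT sF sF.
have sb := csmooth_hdot openT (sT u) sF.
have sc := csmooth_hdot openT sF (sT v).
have sbc := csmoothM openT sb sc.
have sal := csmoothM openT (csmooth_cst setT (hdot (T u) (T v))) ss.
have s0 (q : 'cV[R]_(n + n)) (_ : setT q) := point_hdot_neq0 q.
have si := csmoothV openT s0 ss.
have sii := csmoothM openT si si.
have snum := csmoothD openT sal (csmoothN openT sbc).
transitivity (cD a (fun q => (hdot (T u) (T v) * hdot (F q) (F q) -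
    hdot (T u) (F q) * hdot (F q) (T v)) * ((hdot (F q) (F q))^-1 * (hdot (F q) (F q))^-1)) p).
  by apply: (cD_eq a openT I) => q _; rewrite /fs_herm expr2 invfM.
rewrite (cDM a snum sii I) (cDM a si si I) (cDV a openT s0 ss I).
rewrite (cDD a sal (csmoothN openT sbc) I) (cDN a sbc I) (cDM a sb sc I).
rewrite (cDZ a _ ss I) (cD_hdot openT a sF sF I) (cD_hdot openT a (sT u) sF I).
rewrite (cD_hdot openT a sF (sT v) I) !mcD_point !mcD_cst !hdot0l !hdot0r add0r addr0.
rewrite /fs_der; field; exact: point_hdot_neq0.
Qed.

Lemma fs_hermD (w a a' b : 'cV[C]_n.+1) :
  fs_herm w (a + a') b = fs_herm w a b + fs_herm w a' b.
Proof. by rewrite /fs_herm !hdotDl; ring. Qed.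

Lemma fs_hermZ (w a b : 'cV[C]_n.+1) z : fs_herm w (z *: a) b = z * fs_herm w a b.
Proof. by rewrite /fs_herm !hdotZl; ring. Qed.

Lemma fs_hermC (w a b : 'cV[C]_n.+1) : (fs_herm w a b)^* = fs_herm w b a.
Proof.
rewrite /fs_herm rmorphM fmorphV rmorphXn rmorphB !rmorphM /= !hdotC.
by congr (_ / _); ring.
Qed.

Lemma fs_hermZr (w a b : 'cV[C]_n.+1) z : fs_herm w a (z *: b) = z^* * fs_herm w a b.
Proof. by rewrite -!(fs_hermC w _ a) -rmorphM -fs_hermZ. Qed.

(* Cauchy-Schwarz, with its equality case. *)
Lemma fs_hermE (w a : 'cV[C]_n.+1) : w != 0 ->
  let c := hdot a w / hdot w w in
  fs_herm w a a = hdot (a - c *: w) (a - c *: w) / hdot w w.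
Proof.
rewrite -hdot_eq0 => w0 /=; rewrite /fs_herm !(hdotDl, hdotDr, hdotNl, hdotNr, hdotZl, hdotZr).
rewrite rmorphM fmorphV /= hdotC hdot_real; field; exact: w0.
Qed.

Lemma ge0_Re_eq0 (z : C) : 0 <= z -> complex.Re z = 0 -> z = 0.
Proof. by move=> /ger0_Im; case: z => a b /= -> ->. Qed.

Lemma fs_eq0 p u : g p u u = 0 -> u = 0.
Proof.
rewrite /fubini_study -/(point k p) -/(tvec k u) fs_hermE ?point_neq0//.
set c := hdot (T u) (F p) / hdot (F p) (F p) => E.
have h0 : hdot (T u - c *: F p) (T u - c *: F p) / hdot (F p) (F p) = 0.
  have ge0 : 0 <= hdot (T u - c *: F p) (T u - c *: F p) / hdot (F p) (F p).
    by rewrite divr_ge0// hdot_ge0.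
  exact: ge0_Re_eq0 ge0 E.
move/eqP: h0; rewrite mulf_eq0 invr_eq0 (negbTE (point_hdot_neq0 p)) orbF hdot_eq0.
rewrite subr_eq0 => /eqP Tu.
(* In slot [k] a tangent vector has entry 0 and the point has entry 1. *)
have c0 : c = 0.
  have := congr1 (fun M : 'cV[C]_n.+1 => M k 0) Tu.
  by rewrite !mxE !unlift_none mulr1.
by apply: (@tvec_eq0 _ _ k); rewrite Tu c0 scale0r.
Qed.

Lemma real_linear_sum N (phi : 'cV[R]_N -> R) (u : 'cV[R]_N) :
  (forall x y, phi (x + y) = phi x + phi y) -> (forall (c : R) x, phi (c *: x) = c * phi x) ->
  phi u = \sum_i u i 0 * phi (basisv R i).
Proof.
move=> pD pZ; have p0 : phi 0 = 0 by rewrite -(scale0r 0) pZ mul0r.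
have ps (I : Type) (r : seq I) (f : I -> 'cV[R]_N) :
    phi (\sum_(i <- r) f i) = \sum_(i <- r) phi (f i).
  by elim: r => [|i r IH]; rewrite ?big_nil ?p0// !big_cons pD IH.
rewrite [u in LHS]matrix_sum_delta ps; apply: eq_bigr => i _.
by rewrite big_ord1 pZ.
Qed.

Lemma gDl p u u' v : g p (u + u') v = g p u v + g p u' v.
Proof. by rewrite /fubini_study -!/(tvec k _) tvecD fs_hermD raddfD. Qed.

Lemma gZl p (c : R) u v : g p (c *: u) v = c * g p u v.
Proof. by rewrite /fubini_study -!/(tvec k _) tvecZ fs_hermZ ReM /= mul0r subr0. Qed.

Lemma gC p u v : g p u v = g p v u.
Proof. by rewrite /fubini_study -!/(tvec k _) -fs_hermC; case: (fs_herm _ _ _). Qed.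

Lemma gDr p u v v' : g p u (v + v') = g p u v + g p u v'.
Proof. by rewrite gC gDl !(gC p u). Qed.

Lemma gZr p (c : R) u v : g p u (c *: v) = c * g p u v.
Proof. by rewrite gC gZl gC. Qed.

Lemma gram_mul p v i : (gram g p *m v) i 0 = g p (basisv R i) v.
Proof.
rewrite mxE (@real_linear_sum _ (g p (basisv R i)) v (gDr p _) (gZr p ^~ _)).
by apply: eq_bigr => j _; rewrite mxE mulrC.
Qed.

Lemma gram_unit p : gram g p \in unitmx.
Proof.
rewrite -row_free_unit; apply: inj_row_free => v vG.
suff : v^T = 0 by move=> /(congr1 trmx); rewrite trmxK trmx0.
apply: (@fs_eq0 p); rewrite (@real_linear_sum _ ((g p)^~ v^T) v^T).
- rewrite big1 // => i _; rewrite -gram_mul.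
  have -> : gram g p *m v^T = (v *m gram g p)^T.
    rewrite trmx_mul; congr (_ *m _); apply/matrixP => a b; rewrite !mxE; exact: gC.
  by rewrite vG trmx0 [X in _ * X]mxE mulr0.
- by move=> x y; rewrite gDl.
- by move=> c x; rewrite gZl.
Qed.

Lemma derive_gram p a i j : 'D_a (fun q => gram g q i j : R^o) p =
  complex.Re (fs_der p a (basisv R i) (basisv R j)).
Proof.
rewrite -cD_fs_herm /cD /=.
rewrite (_ : (fun q => _) = (fun q => complex.Re (fs_herm (F q) (T (basisv R i)) (T (basisv R j))))) //.
by apply/funext => q; rewrite mxE.
Qed.

Lemma fs_derDa p a a' u v : fs_der p (a + a') u v = fs_der p a u v + fs_der p a' u v.
Proof.
rewrite /fs_der !tvecD !(hdotDl, hdotDr); field; exact: point_hdot_neq0.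
Qed.

Lemma fs_derZa p (c : R) a u v : fs_der p (c *: a) u v = c%:C%C * fs_der p a u v.
Proof.
rewrite /fs_der !tvecZ !(hdotZl, hdotZr) (_ : (c%:C%C)^* = c%:C%C); last exact: conjc_real.
field; exact: point_hdot_neq0.
Qed.

Lemma fs_derDu p a u u' v : fs_der p a (u + u') v = fs_der p a u v + fs_der p a u' v.
Proof.
rewrite /fs_der !tvecD !(hdotDl, hdotDr); field; exact: point_hdot_neq0.
Qed.

Lemma fs_derZu p (c : R) a u v : fs_der p a (c *: u) v = c%:C%C * fs_der p a u v.
Proof.
rewrite /fs_der !tvecZ !(hdotZl, hdotZr); field; exact: point_hdot_neq0.
Qed.

Lemma fs_derDv p a u v v' : fs_der p a u (v + v') = fs_der p a u v + fs_der p a u v'.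
Proof.
rewrite /fs_der !tvecD !(hdotDl, hdotDr); field; exact: point_hdot_neq0.
Qed.

Lemma fs_derZv p (c : R) a u v : fs_der p a u (c *: v) = c%:C%C * fs_der p a u v.
Proof.
rewrite /fs_der !tvecZ !(hdotZl, hdotZr) (_ : (c%:C%C)^* = c%:C%C); last exact: conjc_real.
field; exact: point_hdot_neq0.
Qed.

Lemma ReZ (c : R) (z : C) : complex.Re (c%:C%C * z) = c * complex.Re z.
Proof. by rewrite ReM /= mul0r subr0. Qed.

(** Closed form of the Christoffel symbols contracted twice with [u]: a complex multiple of [u].
    Only this diagonal contraction is computed, since conformality reduces the trace in
    [mean_curvature] to equal indices. *)
Definition fs_gamma p u : 'cV[R]_(n + n) :=
  to_real ((- 2 * hdot (T u) (F p) / hdot (F p) (F p)) *: of_real u).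

Lemma tvec_gamma p u :
  T (fs_gamma p u) = (- 2 * hdot (T u) (F p) / hdot (F p) (F p)) *: T u.
Proof. by rewrite /fs_gamma /tvec of_realK -insertZ mulr0. Qed.

(** Koszul's formula on the diagonal; as the metric is nondegenerate, it characterizes
    [fs_gamma]. *)
Lemma koszul p u d :
  complex.Re (fs_der p u u d) - 2^-1 * complex.Re (fs_der p d u u) = g p d (fs_gamma p u).
Proof.
rewrite /fubini_study -!/(tvec k _) -/(point k p) tvec_gamma fs_hermZr.
have -> : 2^-1 * complex.Re (fs_der p d u u) = complex.Re (2^-1 * fs_der p d u u).
  have -> : 2^-1 = (2^-1)%:C%C :> C by rewrite fmorphV rmorph_nat.
  by rewrite ReZ.
rewrite -raddfB; apply: Re_eq.
rewrite /fs_der /fs_herm !(rmorphB, rmorphM, rmorphD, rmorphN, fmorphV, rmorphXn, rmorph_nat) /=.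
rewrite !hdotC.
field; exact: point_hdot_neq0.
Qed.

Lemma christoffel_sum p u c :
  \sum_a \sum_b christoffel g c a b p * u a 0 * u b 0 = fs_gamma p u c 0.
Proof.
pose D a b d := complex.Re (fs_der p a b d).
have DDa a a' b d : D (a + a') b d = D a b d + D a' b d by rewrite /D fs_derDa raddfD.
have DZa x a b d : D (x *: a) b d = x * D a b d by rewrite /D fs_derZa ReZ.
have DDb a b b' d : D a (b + b') d = D a b d + D a b' d by rewrite /D fs_derDu raddfD.
have DZb x a b d : D a (x *: b) d = x * D a b d by rewrite /D fs_derZu ReZ.
have DDd a b d d' : D a b (d + d') = D a b d + D a b d' by rewrite /D fs_derDv raddfD.
have DZd x a b d : D a b (x *: d) = x * D a b d by rewrite /D fs_derZv ReZ.
have S1 d : \sum_a \sum_b D (basisv R a) (basisv R b) d * u a 0 * u b 0 = D u u d.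
  rewrite (@real_linear_sum _ (D ^~ u ^~ d) u) //; apply: eq_bigr => a _.
  rewrite (@real_linear_sum _ (D _ ^~ d) u) // mulr_sumr; apply: eq_bigr => b _; ring.
have S2 d : \sum_a \sum_b D (basisv R b) (basisv R a) d * u a 0 * u b 0 = D u u d.
  rewrite exchange_big -S1; apply: eq_bigr => a _; apply: eq_bigr => b _; ring.
have S3 d : \sum_a \sum_b D d (basisv R a) (basisv R b) * u a 0 * u b 0 = D d u u.
  rewrite (@real_linear_sum _ (D d ^~ u) u) //; apply: eq_bigr => a _.
  rewrite (@real_linear_sum _ (D d _) u) // mulr_sumr; apply: eq_bigr => b _; ring.
(* Writing [fs_gamma] as the inverse Gram matrix times the Gram matrix times itself lets [koszul] be
   used entry by entry. *)
rewrite -[in RHS](mulKmx (gram_unit p) (fs_gamma p u)) [RHS]mxE.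
transitivity (\sum_d invmx (gram g p) c d * (\sum_a \sum_b
    2^-1 * (D (basisv R a) (basisv R b) (basisv R d) + D (basisv R b) (basisv R a) (basisv R d) -
      D (basisv R d) (basisv R a) (basisv R b)) * u a 0 * u b 0)).
  under [RHS]eq_bigr => d _ do rewrite mulr_sumr.
  rewrite [RHS]exchange_big; apply: eq_bigr => a _.
  under [RHS]eq_bigr => d _ do rewrite mulr_sumr.
  rewrite [RHS]exchange_big; apply: eq_bigr => b _.
  rewrite /christoffel mulr_sumr !mulr_suml; apply: eq_bigr => d _.
  rewrite !derive_gram -!/(D _ _ _). ring.
apply: eq_bigr => d _; congr (_ * _); rewrite gram_mul -koszul -!/(D _ _ _).
rewrite -(S3 (basisv R d)).
transitivity (2^-1 * (D u u (basisv R d) + D u u (basisv R d)) - 2^-1 *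
  (\sum_a \sum_b D (basisv R d) (basisv R a) (basisv R b) * u a 0 * u b 0)); last by field.
rewrite -{1}S1 -S2 -mulrBr -big_split -sumrB mulr_sumr; apply: eq_bigr => a _.
rewrite -big_split -sumrB mulr_sumr; apply: eq_bigr => b _ /=; ring.
Qed.

End FubiniStudy.

(** * The projector of a minimal Lagrangian sphere *)

Section Projector.
Variables (R : realType) (n : nat).
Local Notation C := R[i].
Implicit Types v w : 'cV[C]_n.

Definition proj v : 'M[C]_n := (hdot v v)^-1 *: (v *m v^t*).

Lemma adj_mul v w : v^t* *m w = (hdot w v)%:M.
Proof.
by apply/matrixP => i j; rewrite (ord1 i) (ord1 j) [RHS]mxE mulr1n hdot_mulE.
Qed.

Lemma adjZ m k (c : C) (M : 'M[C]_(m, k)) : (c *: M)^t* = c^* *: M^t*.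
Proof. by apply/matrixP => i j; rewrite !mxE rmorphM. Qed.

Lemma adjM m k p (M : 'M[C]_(m, k)) (M' : 'M[C]_(k, p)) : (M *m M')^t* = M'^t* *m M^t*.
Proof. by rewrite trmx_mul map_mxM. Qed.

Lemma adjK m k (M : 'M[C]_(m, k)) : (M^t*)^t* = M.
Proof. by apply/matrixP => i j; rewrite !mxE conjCK. Qed.

Lemma proj_mul v w : proj v *m w = (hdot w v / hdot v v) *: v.
Proof. by rewrite /proj -scalemxAl -mulmxA adj_mul mul_mx_scalar scalerA mulrC. Qed.

Lemma proj_id v : v != 0 -> proj v *m v = v.
Proof. by move=> v0; rewrite proj_mul divff ?scale1r// hdot_eq0. Qed.

Lemma proj_adj v : (proj v)^t* = proj v.
Proof. by rewrite /proj adjZ adjM adjK fmorphV /= hdot_real. Qed.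

Lemma projZ c v : c != 0 -> proj (c *: v) = proj v.
Proof.
move=> c0; have [->|v0] := eqVneq v 0; first by rewrite scaler0.
rewrite /proj hdotZl hdotZr adjZ -scalemxAl -scalemxAr !scalerA; congr (_ *: _).
by field; rewrite hdot_eq0 v0 conjC_eq0 c0.
Qed.

Lemma proj_tr v : v != 0 -> \tr (proj v) = 1.
Proof.
move=> v0; rewrite /proj linearZ /= mxtrace_mulC adj_mul mxtrace_scalar mulr1n mulVf//.
by rewrite hdot_eq0.
Qed.

Lemma proj_rk1 v (X : 'M[C]_n) : proj v *m X *m proj v = \tr (proj v *m X) *: proj v.
Proof.
rewrite -mulmxA {2}/proj -!scalemxAr [X *m (v *m _)]mulmxA mulmxA proj_mul -scalemxAl.
rewrite [in RHS]/proj -!scalemxAl mxtraceZ -[v *m _ *m X]mulmxA mxtrace_mulC -mulmxA.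
rewrite adj_mul mxtrace_scalar mulr1n !scalerA; congr (_ *: _); ring.
Qed.

End Projector.

Section LocalExpression.
Variables (R : realType) (V : normedModType R) (n : nat) (k : 'I_n.+1).
Local Notation C := R[i].
Variables (U : set V) (oU : open U) (W : V -> 'cV[R]_(n + n)).
Hypothesis sW : smooth_on U W.

Lemma csmooth_coord (a b : 'I_(n + n)) :
  csmooth U (fun x => (W x a 0 +i* W x b 0)%C).
Proof. by move/(smooth_on_mx _ oU): sW => s; split; exact: s. Qed.

Lemma cD_coord (a b : 'I_(n + n)) v x : U x ->
  cD v (fun x => (W x a 0 +i* W x b 0)%C) x = ('D_v W x a 0 +i* 'D_v W x b 0)%C.
Proof. by move=> Ux; rewrite /cD derive_mx ?mxE//; exact: (smooth_on_derivable sW). Qed.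

Lemma msmooth_insert (t : C) : msmooth U (fun x => insert k t (of_real (W x))).
Proof.
move=> i j; rewrite (ord1 j); case: (unliftP k i) => [l ->|->].
  apply: (csmooth_eq oU _ (csmooth_coord (lshift n l) (rshift n l))) => x _.
  by rewrite insert_lift of_realE.
by apply: (csmooth_eq oU _ (csmooth_cst U t)) => x _; rewrite insert_k.
Qed.

Lemma mcD_insert (t : C) v x : U x ->
  mcD v (fun x => insert k t (of_real (W x))) x = tvec k ('D_v W x).
Proof.
move=> Ux; apply/matrixP => i j; rewrite mxE (ord1 j); case: (unliftP k i) => [l ->|->].
  rewrite insert_lift of_realE -(cD_coord _ _ _ Ux).
  by apply: (cD_eq v oU Ux) => y _; rewrite insert_lift of_realE.
rewrite insert_k; transitivity (cD v (fun=> t) x); last exact: cD_cst.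
by apply: (cD_eq v oU Ux) => y _; rewrite insert_k.
Qed.

End LocalExpression.

(** * The hypotheses on the immersion in a pair of charts *)

Section MinimalEquation.
Variables (R : realType) (f : S2 R -> CP R 2).
Local Notation C := R[i].
Local Notation plane := 'cV[R]_(1 + 1).
Hypothesis hf : minimal_lagrangian_immersion f.
Variables (j : 'I_2) (k : 'I_3) (x : plane).
Hypothesis Ux : local_dom f j k x.
Local Notation w := (local_rep f j k).
Local Notation d i := ('D_(basisv R i) w x).
Local Notation g := (@fubini_study R 2 k).

Lemma gram_conformal (lam : R) :
  (forall u v, pullback g w x u v = lam * (u^T *m v) 0 0) -> gram (pullback g w) x = lam%:M.
Proof.
move=> E; apply/matrixP => a b; rewrite !mxE E -mulr_natr; congr (_ * _).
rewrite /basisv trmx_delta mul_delta_mx_cond; case: eqP => _.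
  by rewrite mulr1n mxE !eqxx.
by rewrite mulr0n mxE.
Qed.

Lemma normal_part_sum (lam : R) (y : 'cV[R]_(2 + 2)) : lam != 0 ->
  (forall u v, pullback g w x u v = lam * (u^T *m v) 0 0) ->
  normal_part g w x y = y - \sum_i (lam^-1 * g (w x) y (d i)) *: d i.
Proof.
move=> lam0 E; rewrite /normal_part; congr (_ - _).
rewrite (gram_conformal E).
rewrite invmx_scalar; apply: eq_bigr => i _.
rewrite (bigD1 i) //= big1 ?addr0; last first.
  by move=> l li; rewrite mxE eq_sym (negbTE li) mulr0n mul0r scale0r.
by rewrite mxE eqxx mulr1n.
Qed.

(** Vanishing mean curvature makes the sum of the covariant derivatives tangent, with unknown real
    coefficients [r]; the other term comes from [fs_gamma]. Conformality will show that the [r i]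
    are 0, in [tangential_coeff0]. *)
Lemma minimal_laplacian : exists r : 'I_2 -> R,
  \sum_(i < 2) (mcD (basisv R i) (mcD (basisv R i) (fun x => point k (w x))) x) =
  \sum_(i < 2) ((2 * (hdot (tvec k (d i)) (point k (w x)) /
     hdot (point k (w x)) (point k (w x))) + (r i)%:C%C) *: tvec k (d i)).
Proof.
have [[sf _] conf min _] := hf; have [oU sw] := sf j k.
have [lam lam_gt0 E] := conf j k x Ux; have lam0 : lam != 0 by rewrite gt_eqF.
pose cov i := covariant_hess g w x i i.
have cov0 : \sum_i normal_part g w x (cov i) = 0.
  have := min j k x Ux; rewrite /mean_curvature (gram_conformal E) invmx_scalar.
  move=> /eqP; rewrite scaler_eq0 invr_eq0 pnatr_eq0 /= => /eqP S0.
  apply/eqP; rewrite -[_ == 0](_ : (lam^-1 *: \sum_i normal_part g w x (cov i) == 0) = _); last first.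
    by rewrite scaler_eq0 invr_eq0 (negbTE lam0).
  rewrite -[X in _ == X]S0 scaler_sumr; apply/eqP/eq_bigr => i _.
  rewrite (bigD1 i) //= big1 ?addr0; last first.
    by move=> l li; rewrite mxE eq_sym (negbTE li) mulr0n scale0r.
  by rewrite mxE eqxx mulr1n.
pose r l := \sum_i lam^-1 * g (w x) (cov i) (d l).
have covE : \sum_i cov i = \sum_l r l *: d l.
  apply/eqP; rewrite -subr_eq0 -[X in _ == X]cov0; apply/eqP.
  under [RHS]eq_bigr => i _ do rewrite (normal_part_sum _ lam0 E).
  rewrite sumrB exchange_big; congr (_ - _); apply: eq_bigr => l _.
  by rewrite /r scaler_suml.
exists r.
have tsum (I : Type) (s : seq I) (F : I -> 'cV[R]_(2 + 2)) :
    tvec k (\sum_(i <- s) F i) = \sum_(i <- s) tvec k (F i).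
  elim: s => [|i s IH]; last by rewrite !big_cons tvecD IH.
  by rewrite !big_nil -(scale0r 0) tvecZ rmorph0 scale0r.
have covT i : mcD (basisv R i) (mcD (basisv R i) (fun x => point k (w x))) x =
    tvec k (cov i) + (2 * (hdot (tvec k (d i)) (point k (w x)) /
     hdot (point k (w x)) (point k (w x)))) *: tvec k (d i).
  have -> : cov i = 'D_(basisv R i) ('D_(basisv R i) w) x + fs_gamma k (w x) (d i).
    rewrite /cov /covariant_hess; congr (_ + _); apply/matrixP => c c'.
    by rewrite (ord1 c') mxE christoffel_sum.
  rewrite tvecD tvec_gamma -addrA -scalerDl.
  rewrite [X in X *: _](_ : _ = 0) ?scale0r ?addr0; last by ring.
  rewrite -(mcD_insert k oU (smooth_on_derive (basisv R i) sw) 0 _ Ux).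
  by apply: (mcD_eq oU _ Ux) => y Uy; rewrite (mcD_insert k oU sw).
under eq_bigr => i _ do rewrite covT.
rewrite big_split /= -tsum covE tsum -big_split; apply: eq_bigr => i _ /=.
by rewrite tvecZ -scalerDl addrC.
Qed.

(** Conformality gives the real part of the Hermitian form, the Lagrangian condition its imaginary
    part. *)
Lemma conformal_lagrangian : exists2 lam : R, 0 < lam &
  forall a b : 'I_2, fs_herm (point k (w x)) (tvec k (d a)) (tvec k (d b)) =
    (lam * (a == b)%:R)%:C%C.
Proof.
have [_ conf _ lag] := hf.
have [lam lam_gt0 E] := conf j k x Ux; exists lam => // a b.
have hR : complex.Re (fs_herm (point k (w x)) (tvec k (d a)) (tvec k (d b))) =
    lam * (a == b)%:R.
  have := congr1 (fun M : 'M[R]_(1 + 1) => M a b) (gram_conformal E).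
  by rewrite !mxE mulr_natr.
have hI : complex.Im (fs_herm (point k (w x)) (tvec k (d a)) (tvec k (d b))) = 0.
  have := lag j k x Ux (basisv R a) (basisv R b).
  rewrite /kahler_form /fubini_study -/(tvec k (cplxJ (d a))) -/(tvec k (d b)).
  rewrite tvecJ -/(point k (w x)) fs_hermZ -complexiE ReM /= mul0r mul1r sub0r.
  by move/eqP; rewrite oppr_eq0 => /eqP.
by apply/eqP; rewrite eq_complex hR hI !eqxx.
Qed.

End MinimalEquation.

Section ProjectorCalculus.
Variables (R : realType) (n : nat).
Local Notation C := R[i].
Implicit Types v w a b : 'cV[C]_n.

Lemma hdot_adj (M : 'M[C]_n) a b : hdot (M *m a) b = hdot a (M^t* *m b).
Proof. by rewrite !hdot_mulE adjM adjK mulmxA. Qed.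

Lemma proj_trM v (Y : 'M[C]_n) : \tr (proj v *m Y) = hdot (Y *m v) v / hdot v v.
Proof.
rewrite /proj -scalemxAl mxtraceZ -mulmxA mxtrace_mulC -mulmxA adj_mul mxtrace_scalar mulr1n.
by rewrite mulrC.
Qed.

Lemma proj_proj v : v != 0 -> proj v *m proj v = proj v.
Proof. by move=> v0; rewrite {2}/proj -scalemxAr mulmxA proj_id. Qed.

Lemma fs_herm_proj (v a b : 'cV[C]_n) : v != 0 ->
  fs_herm v a b = hdot (a - proj v *m a) (b - proj v *m b) / hdot v v.
Proof.
rewrite -hdot_eq0 => v0; rewrite !proj_mul /fs_herm.
rewrite !(hdotDl, hdotDr, hdotNl, hdotNr, hdotZl, hdotZr).
rewrite rmorphM fmorphV /= !hdotC; field; exact: v0.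
Qed.

End ProjectorCalculus.

(** * The projector as a matrix function on the whole plane *)

Section GlobalProjector.
Variables (R : realType) (f : S2 R -> CP R 2).
Local Notation C := R[i].
Local Notation plane := 'cV[R]_(1 + 1).
Hypothesis hf : minimal_lagrangian_immersion f.
Variable j : 'I_2.

Definition gen (x : plane) : 'cV[C]_3 := generator (f (unchart j x)).

Lemma generator_neq0 m (L : CP R m) : generator L != 0.
Proof.
rewrite /generator vpick0 /line; case: L => L /= /eqP dL.
by apply: contra_eq_neq dL => ->; rewrite dimv0.
Qed.

Lemma vec_neq0 m (v : 'cV[C]_m) : v != 0 -> exists i, v i 0 != 0.
Proof.
move=> v0; apply: contrapT => h; move/eqP: v0; apply.
apply/matrixP => i l; rewrite (ord1 l) mxE; apply/eqP/negPn/negP => vi.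
by apply: h; exists i.
Qed.

Lemma point_chart m (L : CP R m) k : generator L k 0 != 0 ->
  point k (chart k L) = (generator L k 0)^-1 *: generator L.
Proof.
move=> L0; apply/matrixP => i l; rewrite (ord1 l) [RHS]mxE.
case: (unliftP k i) => [i' ->|->].
  by rewrite insert_lift /chart of_realK mxE mulrC.
by rewrite insert_k mulVf.
Qed.

(** [gen] depends on an arbitrary choice and need not be continuous in [x]. The projector does not
    see the scale of the generator, so on each chart domain it agrees with the projector of the
    affine lift and is smooth. *)
Definition Pf (x : plane) : 'M[C]_3 := proj (gen x).

Local Notation w k := (local_rep f j k).
Local Notation dom k := (local_dom f j k).

Lemma cover x : exists k, dom k x.
Proof. by have [k gk] := vec_neq0 (generator_neq0 (f (unchart j x))); exists k. Qed.

Lemma Pf_local k x : dom k x -> Pf x = proj (point k (w k x)).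
Proof. move=> kx; rewrite /Pf /gen (point_chart kx) projZ//.
by rewrite invr_eq0; exact kx. Qed.

Lemma open_dom k : open (dom k).
Proof. by have [[sf _] _ _ _] := hf; have [] := sf j k. Qed.

Lemma smooth_w k : smooth_on (dom k) (w k).
Proof. by have [[sf _] _ _ _] := hf; have [] := sf j k. Qed.

Lemma msmooth_G k : msmooth (dom k) (fun x => point k (w k x)).
Proof. exact: (msmooth_insert k (@open_dom k) (@smooth_w k) 1). Qed.

Lemma msmooth_Pf_dom k : msmooth (dom k) Pf.
Proof.
have oU := @open_dom k; have sG := @msmooth_G k.
have sh := csmoothV oU (fun x _ => point_hdot_neq0 k (w k x)) (csmooth_hdot oU sG sG).
have sp := msmoothZ oU sh (msmoothM oU sG (msmooth_adj oU sG)).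
by move=> a b; apply: (csmooth_eq oU _ (sp a b)) => x /Pf_local ->.
Qed.

Lemma msmooth_Pf : msmooth setT Pf.
Proof.
move=> a b; split=> s x _; have [k kx] := cover x.
  by have [h _] := @msmooth_Pf_dom k a b; exact: (h s x kx).
by have [_ h] := @msmooth_Pf_dom k a b; exact: (h s x kx).
Qed.

Definition e_ (i : 'I_2) : plane := basisv R i.
Local Notation X i := (mcD (e_ i) Pf).

Lemma Pf_adj x : (Pf x)^t* = Pf x. Proof. exact: proj_adj. Qed.

Lemma X_adj i x : (X i x)^t* = X i x.
Proof.
rewrite -(mcD_adj openT (e_ i) msmooth_Pf I).
by apply: (mcD_eq openT _ I) => y _; exact: Pf_adj.
Qed.

Section Pointwise.
Variables (k : 'I_3) (x : plane).
Hypothesis kx : dom k x.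
Local Notation G := (point k (w k x)).
Local Notation Gd i := (tvec k ('D_(basisv R i) (w k) x)).
Let oU := @open_dom k.
Let sG := @msmooth_G k.
Let sP := @msmooth_Pf_dom k.

Lemma mcD_G i y : dom k y -> mcD (e_ i) (fun x => point k (w k x)) y =
  tvec k ('D_(basisv R i) (w k) y).
Proof. exact: (mcD_insert k oU (@smooth_w k) 1 (e_ i)). Qed.

Lemma PG y : dom k y -> Pf y *m point k (w k y) = point k (w k y).
Proof. by move=> ky; rewrite (Pf_local ky) proj_id// point_neq0. Qed.

Lemma XG i y : dom k y -> X i y *m point k (w k y) =
  mcD (e_ i) (fun x => point k (w k x)) y - Pf y *m mcD (e_ i) (fun x => point k (w k x)) y.
Proof.
move=> ky; have := mcDM oU (e_ i) sP sG ky.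
rewrite (mcD_eq oU (e_ i) ky (fun y ky => PG ky)) => {1}->.
by rewrite addrK.
Qed.

Lemma XXG i : let M := mcD (e_ i) (fun x => point k (w k x)) in
  mcD (e_ i) (X i) x *m G + X i x *m M x + (X i x *m M x + Pf x *m mcD (e_ i) M x) =
  mcD (e_ i) M x.
Proof.
set M := mcD (e_ i) (fun x => point k (w k x)) => /=.
have sX : msmooth (dom k) (X i) := msmooth_mcD oU (e_ i) sP.
have sM : msmooth (dom k) M := msmooth_mcD oU (e_ i) sG.
have sXG := msmoothM oU sX sG; have sPM := msmoothM oU sP sM.
have E1 y : dom k y -> X i y *m point k (w k y) + Pf y *m M y = M y.
  by move=> ky; rewrite XG// subrK.
have E3 := mcDD oU (e_ i) sXG sPM kx.
rewrite (mcD_eq oU (e_ i) kx E1) in E3.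
have E4 := mcDM oU (e_ i) sX sG kx; have E5 := mcDM oU (e_ i) sP sM kx.
by apply/esym; apply: (etrans E3); rewrite E4 E5.
Qed.

End Pointwise.

Lemma X_offdiag i x : X i x *m Pf x + Pf x *m X i x = X i x.
Proof.
rewrite -(mcDM openT (e_ i) msmooth_Pf msmooth_Pf I).
apply: (mcD_eq openT _ I) => y _.
exact: proj_proj (generator_neq0 _).
Qed.

End GlobalProjector.

(** P G = G is differentiated twice. The coefficients [a i], which depend on the lift [G], cancel
    because X_i M_i contains a_i X_i G; the remaining X_i X_i G lie in the range of [P], so only the
    [r i] survive. *)
Lemma harmonic_algebra (K : comNzRingType) n (P : 'M[K]_n) (X L : 'I_2 -> 'M[K]_n)
    (G : 'cV[K]_n) (M N : 'I_2 -> 'cV[K]_n) (a r : 'I_2 -> K) :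
  P *m P = P -> (forall i, X i *m P + P *m X i = X i) -> P *m G = G ->
  (forall i, X i *m G = M i - P *m M i) -> (forall i, P *m M i = a i *: G) ->
  (forall i, L i *m G + X i *m M i + (X i *m M i + P *m N i) = N i) ->
  \sum_i N i = \sum_i (2 * a i + r i) *: M i ->
  (\sum_i L i) *m G - P *m ((\sum_i L i) *m G) = \sum_i r i *: (X i *m G).
Proof.
move=> PP XP PG XG PM LG NE.
have PXG i : P *m (X i *m G) = 0.
  rewrite XG mulmxBr !mulmxA PP subrr //.
have PXXG i : P *m (X i *m (X i *m G)) = X i *m (X i *m G).
  by rewrite -{3}[X i]XP mulmxDl -[X i *m P *m _]mulmxA PXG mulmx0 add0r mulmxA.
have XM i : X i *m M i = X i *m (X i *m G) + a i *: (X i *m G).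
  have E : M i = X i *m G + a i *: G by rewrite XG -PM subrK.
  by rewrite [in LHS]E mulmxDr -scalemxAr.
have LGE : (\sum_i L i) *m G = \sum_i (r i *: (X i *m G) - (X i *m (X i *m G)) *+ 2).
  have E : (\sum_i L i) *m G = \sum_i (N i - P *m N i - (X i *m M i) *+ 2).
    rewrite mulmx_suml; apply: eq_bigr => i _; rewrite -{1}LG mulr2n opprD addrA.
    by rewrite [_ + (_ + P *m N i)]addrA addrK addrK addrK.
  rewrite E !sumrB -mulmx_sumr NE mulmx_sumr -!sumrB; apply: eq_bigr => i _.
  rewrite -scalemxAr -scalerBr -XG XM; move: (X i *m (X i *m G)) (X i *m G) => y z.
  by apply/matrixP => p q; rewrite !mxE; ring.
rewrite LGE mulmx_sumr -sumrB; apply: eq_bigr => i _.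
by rewrite mulmxBr -scalemxAr PXG scaler0 sub0r mulr2n mulmxDr PXXG opprK subrK.
Qed.

Section SmoothMatrices.
Variable R : realType.
Local Notation C := R[i].
Local Notation plane := 'cV[R]_(1 + 1).
Local Notation S := (sfun R).

Definition evM m n (x : plane) (M : 'M[S]_(m, n)) : 'M[C]_(m, n) := map_mx (ev x) M.

Lemma evMP m n (M M' : 'M[S]_(m, n)) : (forall x, evM x M = evM x M') -> M = M'.
Proof.
move=> E; apply/matrixP => i j; apply/sfunP => x.
by have /matrixP/(_ i j) := E x; rewrite !mxE.
Qed.

Lemma evM_mul m n p x (M : 'M[S]_(m, n)) (M' : 'M[S]_(n, p)) :
  evM x (M *m M') = evM x M *m evM x M'.
Proof. exact: map_mxM. Qed.

Lemma evMM n x (M M' : 'M[S]_n.+1) : evM x (M * M') = evM x M *m evM x M'.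
Proof. exact: map_mxM. Qed.

Lemma evMD m n x (M M' : 'M[S]_(m, n)) : evM x (M + M') = evM x M + evM x M'.
Proof. exact: map_mxD. Qed.

Lemma evMN m n x (M : 'M[S]_(m, n)) : evM x (- M) = - evM x M.
Proof. exact: map_mxN. Qed.

Lemma evMZ m n x c (M : 'M[S]_(m, n)) : evM x (c *: M) = c x *: evM x M.
Proof. exact: map_mxZ. Qed.

Lemma evM0 m n x : evM x (0 : 'M[S]_(m, n)) = 0.
Proof. exact: map_mx0. Qed.

Lemma evM1 n x : evM x (1 : 'M[S]_n.+1) = 1%:M.
Proof. exact: map_mx1. Qed.

Lemma evM_tr n x (M : 'M[S]_n) : (\tr M) x = \tr (evM x M).
Proof. by rewrite -[LHS]/(ev x (\tr M)) /mxtrace rmorph_sum; apply: eq_bigr => i _; rewrite mxE. Qed.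

Lemma evM_sD n v (M : 'M[S]_n.+1) x : evM x (md (sD v) M) = mcD v (fun y => evM y M) x.
Proof.
apply/matrixP => i j; rewrite !mxE; apply: (cD_eq v openT I) => y _.
by rewrite mxE.
Qed.

Definition star m n (M : 'M[S]_(m, n)) : 'M[S]_(n, m) := map_mx (@sJ R) M^T.

Lemma evM_star m n x (M : 'M[S]_(m, n)) : evM x (star M) = (evM x M)^t*.
Proof. by apply/matrixP => i j; rewrite !mxE. Qed.

Lemma starM n (M M' : 'M[S]_n.+1) : star (M * M') = star M' * star M.
Proof. by rewrite /star trmx_mul (map_mxM (@sJ R)). Qed.

Lemma starD m n (M M' : 'M[S]_(m, n)) : star (M + M') = star M + star M'.
Proof. by apply/matrixP => i j; rewrite !mxE sJD. Qed.

Lemma starN m n (M : 'M[S]_(m, n)) : star (- M) = - star M.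
Proof. by apply/matrixP => i j; rewrite !mxE sJN. Qed.

Lemma starZ m n c (M : 'M[S]_(m, n)) : star (c *: M) = sJ c *: star M.
Proof. by apply/matrixP => i j; rewrite !mxE sJM. Qed.

Lemma star0 m n : star (0 : 'M[S]_(m, n)) = 0.
Proof. by apply/matrixP => i j; rewrite !mxE rmorph0. Qed.

Lemma star1 n : star (1 : 'M[S]_n.+1) = 1.
Proof. by rewrite /star trmx1 (map_mx1 (@sJ R)). Qed.

Lemma starK m n (M : 'M[S]_(m, n)) : star (star M) = M.
Proof. by apply/matrixP => i j; rewrite !mxE sJK. Qed.

Lemma star_dz n (M : 'M[S]_n.+1) : star (md (@dz R) M) = md (@db R) (star M).
Proof. by apply/matrixP => i j; rewrite !mxE dbJ. Qed.

Lemma star_db n (M : 'M[S]_n.+1) : star (md (@db R) M) = md (@dz R) (star M).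
Proof. by apply/matrixP => i j; rewrite !mxE dzJ. Qed.

Lemma star_sD n v (M : 'M[S]_n.+1) : star (md (sD v) M) = md (sD v) (star M).
Proof. by apply/matrixP => i j; rewrite !mxE sDJ. Qed.

(** For Hermitian [M] this trace is, pointwise, the sum of the squared moduli of the entries. *)
Lemma tr_hermitian_sq n (M : 'M[S]_n.+1) : star M = M -> \tr (M * M) = 0 -> M = 0.
Proof.
move=> hM tM; apply: evMP => x; rewrite evM0; apply/matrixP => i j; rewrite [RHS]mxE.
have : \sum_i \sum_j `|evM x M i j| ^+ 2 = 0.
  rewrite -[RHS](_ : (\tr (M * M)) x = 0); last by rewrite tM.
  rewrite evM_tr evMM /mxtrace; apply: eq_bigr => a _; rewrite mxE; apply: eq_bigr => b _.
  by rewrite -{3}hM evM_star !mxE normCK.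
move/eqP; rewrite psumr_eq0 => [/allP/(_ i (mem_index_enum _))|a _]; last first.
  by rewrite sumr_ge0 // => b _; rewrite exprn_ge0.
rewrite psumr_eq0 => [/allP/(_ j (mem_index_enum _))|b _]; last by rewrite exprn_ge0.
by rewrite sqrf_eq0 normr_eq0 => /eqP.
Qed.

End SmoothMatrices.

Lemma tr_offdiag (R : realType) n (P Xa Xb : 'M[R[i]]_n) (G Ma Mb : 'cV[R[i]]_n) :
  G != 0 -> P = proj G -> Xa^t* = Xa -> Xa *m G = Ma - P *m Ma -> Xb *m G = Mb - P *m Mb ->
  \tr (P *m Xa *m Xb) = fs_herm G Mb Ma.
Proof.
move=> G0 PE hX XaG XbG.
by rewrite -mulmxA PE proj_trM -mulmxA hdot_adj hX XaG XbG PE fs_herm_proj.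
Qed.

Section GlobalEquations.
Variables (R : realType) (f : S2 R -> CP R 2).
Local Notation C := R[i].
Local Notation plane := 'cV[R]_(1 + 1).
Local Notation S := (sfun R).
Hypothesis hf : minimal_lagrangian_immersion f.
Variable j : 'I_2.
Local Notation Pf := (Pf f j).
Local Notation X i := (mcD (e_ R i) Pf).
Local Notation L i := (mcD (e_ R i) (X i)).

Lemma trPXX_ev x : exists2 lam : R, 0 < lam & forall a b,
  \tr (Pf x *m X a x *m X b x) = (lam * (a == b)%:R)%:C%C.
Proof.
have [k kx] := cover f j x.
have [lam lam0 E] := conformal_lagrangian hf kx; exists lam => // a b.
rewrite (tr_offdiag (point_neq0 _ _) (Pf_local kx) (X_adj hf j a x) (XG hf a kx) (XG hf b kx)).
by rewrite (mcD_G hf a kx) (mcD_G hf b kx) E eq_sym.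
Qed.

Lemma harmonic_ev x : exists r : 'I_2 -> R,
  (\sum_i L i x) *m Pf x - Pf x *m ((\sum_i L i x) *m Pf x) =
  \sum_i (r i)%:C%C *: (X i x *m Pf x).
Proof.
have [k kx] := cover f j x; have [r E] := minimal_laplacian hf kx; exists r.
set G := point k (local_rep f j k x).
pose M i := mcD (e_ R i) (fun x => point k (local_rep f j k x)).
have H : (\sum_i L i x) *m G - Pf x *m ((\sum_i L i x) *m G) =
    \sum_i (r i)%:C%C *: (X i x *m G).
  apply: (@harmonic_algebra _ _ _ _ _ _ (fun i => M i x) (fun i => mcD (e_ R i) (M i) x)
    (fun i => hdot (M i x) G / hdot G G)).
  - exact: proj_proj (generator_neq0 _).
  - by move=> i; exact: X_offdiag.
  - exact: PG.
  - by move=> i; exact: XG.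
  - by move=> i; rewrite (Pf_local kx) proj_mul.
  - by move=> i; exact: (XXG hf kx).
  - rewrite E; apply: eq_bigr => i _.
    by rewrite /M mcD_G.
have PE : Pf x = (hdot G G)^-1 *: (G *m G^t*) by rewrite (Pf_local kx).
move: (\sum_i L i x) (Pf x) H PE => LL P H PE.
(* [P] is a multiple of [G] times its adjoint, so the identity on the vector [G] becomes one between
   matrices. *)
have HP Y : Y *m P = (hdot G G)^-1 *: ((Y *m G) *m G^t*).
  by rewrite PE -scalemxAr mulmxA.
rewrite !HP -scalemxAr mulmxA -scalerBr -mulmxBl H mulmx_suml scaler_sumr.
by apply: eq_bigr => i _; rewrite HP -scalemxAl !scalerA mulrC.
Qed.

End GlobalEquations.

(* By conformality the Laplacian is orthogonal to the tangent vectors [X k]. *)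
Lemma tangential_coeff0 (R : realType) n (P LL : 'M[R[i]]_n) (X : 'I_2 -> 'M[R[i]]_n)
    (r : 'I_2 -> R) (l : R) :
  0 < l -> P *m P = P -> (forall i, X i *m P + P *m X i = X i) ->
  P^t* = P -> LL^t* = LL -> (forall i, (X i)^t* = X i) ->
  (forall a b, \tr (P *m X a *m X b) = (l * (a == b)%:R)%:C%C) ->
  (forall k, \tr (LL *m X k) = 0) ->
  LL *m P - P *m (LL *m P) = \sum_i (r i)%:C%C *: (X i *m P) ->
  forall k, r k = 0.
Proof.
move=> l0 PP XP hP hL hX T tL E k.
have PXP : P *m X k *m P = 0.
  have : P *m (X k *m P + P *m X k) *m P = P *m X k *m P by rewrite XP.
  rewrite mulmxDr mulmxDl !mulmxA PP -[P *m X k *m P *m P]mulmxA PP.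
  by rewrite -{3}[P *m X k *m P]addr0 => /addrI.
have h1 : \tr (LL *m P *m X k) = (r k * l)%:C%C.
  have := congr1 (fun M => \tr (M *m X k)) E.
  rewrite mulmxBl raddfB /=.
  have -> : \tr (P *m (LL *m P) *m X k) = 0.
    by rewrite -!mulmxA mxtrace_mulC -!mulmxA [P *m (X k *m P)]mulmxA PXP mulmx0 raddf0.
  rewrite subr0 => ->; rewrite mulmx_suml raddf_sum /=.
  have Ti i : \tr ((r i)%:C%C *: (X i *m P) *m X k) = (r i)%:C%C * (l * (k == i)%:R)%:C%C.
    by rewrite -scalemxAl mxtraceZ -mulmxA mxtrace_mulC T.
  rewrite (bigD1 k) //= big1 ?addr0 => [|i ik]; rewrite Ti.
    by rewrite eqxx mulr1 -rmorphM.
  by rewrite eq_sym (negbTE ik) mulr0 mulr0.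
have h2 : \tr (LL *m X k *m P) = (r k * l)%:C%C.
  have -> : LL *m X k *m P = (P *m X k *m LL)^t* by rewrite !adjM hP hX hL mulmxA.
  have trJ (M : 'M[R[i]]_n) : \tr (M^t*) = (\tr M)^*.
    by rewrite /mxtrace rmorph_sum; apply: eq_bigr => i _; rewrite !mxE.
  rewrite trJ mxtrace_mulC mulmxA h1; exact: conjc_real.
have := tL k; rewrite -{1}XP mulmxDr raddfD /= !mulmxA h1 h2.
move=> /eqP; rewrite eq_complex /= => /andP[/eqP rl _].
by have /eqP := rl; rewrite -mulr2n mulrn_eq0 /= mulf_eq0 (gt_eqF l0) orbF => /eqP.
Qed.

Lemma tr_bilinear (K : comNzRingType) n (P X Y : 'M[K]_n.+1) (t a b c e : K) :
  \tr (P * X * X) = t -> \tr (P * Y * Y) = t -> \tr (P * X * Y) = 0 -> \tr (P * Y * X) = 0 ->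
  \tr (P * (a *: X + b *: Y) * (c *: X + e *: Y)) = (a * c + b * e) * t.
Proof.
move=> XX YY XY YX.
rewrite [P * (_ + _)]mulrDr mulrDl !mulrDr -!scalerAr -!scalerAl !mxtraceD !mxtraceZ.
by rewrite XX YY XY YX; ring.
Qed.

Lemma scalerI_unit (K : comNzRingType) m n (a b : K) (X Y : 'M[K]_(m, n)) :
  a * b = 1 -> b *: X = b *: Y -> X = Y.
Proof. by move=> ab E; rewrite -[X]scale1r -ab -scalerA E scalerA ab scale1r. Qed.

Lemma tr_offdiag_mul (K : comNzRingType) n (P X Y : 'M[K]_n.+1) : X * P + P * X = X ->
  \tr (X * Y) = \tr (P * Y * X) + \tr (P * X * Y).
Proof.
move=> {1}<-; rewrite mulrDl mxtraceD; congr (_ + _).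
by rewrite -mulrA; exact: mxtrace_mulC.
Qed.

(** * The projector over the ring of smooth functions *)

Section SmoothProjector.
Variables (R : realType) (f : S2 R -> CP R 2).
Local Notation C := R[i].
Local Notation plane := 'cV[R]_(1 + 1).
Local Notation S := (sfun R).
Hypothesis hf : minimal_lagrangian_immersion f.
Variable j : 'I_2.

Definition Ps : 'M[S]_3 := \matrix_(a, b) sfun_of (msmooth_Pf hf j a b).
Definition Xs (i : 'I_2) : 'M[S]_3 := md (sD (e_ R i)) Ps.
Definition Ls (i : 'I_2) : 'M[S]_3 := md (sD (e_ R i)) (Xs i).

Lemma evM_Ps x : evM x Ps = Pf f j x.
Proof. by apply/matrixP => a b; rewrite [LHS]mxE [in LHS]mxE. Qed.

Lemma evM_PsE : (fun x => evM x Ps) = Pf f j.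
Proof. by apply/funext => x; exact: evM_Ps. Qed.

Lemma evM_Xs i x : evM x (Xs i) = mcD (e_ R i) (Pf f j) x.
Proof. by rewrite /Xs evM_sD evM_PsE. Qed.

Lemma evM_Ls i x : evM x (Ls i) = mcD (e_ R i) (mcD (e_ R i) (Pf f j)) x.
Proof.
by rewrite /Ls evM_sD (_ : (fun x => _) = mcD (e_ R i) (Pf f j))//; apply/funext => y; exact: evM_Xs.
Qed.

Lemma PsPs : Ps * Ps = Ps.
Proof. by apply: evMP => x; rewrite evMM !evM_Ps /Pf proj_proj// generator_neq0. Qed.

Lemma star_Ps : star Ps = Ps.
Proof. by apply: evMP => x; rewrite evM_star evM_Ps Pf_adj. Qed.

Lemma tr_Ps : \tr Ps = 1.
Proof. by apply/sfunP => x; rewrite evM_tr evM_Ps proj_tr// generator_neq0. Qed.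

Lemma Ps_rk1 M : Ps * M * Ps = \tr (Ps * M) *: Ps.
Proof.
by apply: evMP => x; rewrite evMZ !evMM evM_tr evMM !evM_Ps; exact: proj_rk1.
Qed.

Lemma star_Xs i : star (Xs i) = Xs i.
Proof. by rewrite /Xs star_sD star_Ps. Qed.

Lemma star_Ls i : star (Ls i) = Ls i.
Proof. by rewrite /Ls star_sD star_Xs. Qed.

Lemma Xs_offdiag i : Xs i * Ps + Ps * Xs i = Xs i.
Proof. by rewrite -(mdM (sDD _) (sDM _)) PsPs. Qed.

Definition lam0 : S := \tr (Ps * Xs 0 * Xs 0).

Lemma lam0_ev x : exists2 l : R, 0 < l & lam0 x = l%:C%C /\
  forall a b, \tr (Ps * Xs a * Xs b) x = (l * (a == b)%:R)%:C%C.
Proof.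
have [l l0 E] := trPXX_ev hf j x; exists l => //.
have E' a b : \tr (Ps * Xs a * Xs b) x = (l * (a == b)%:R)%:C%C.
  by rewrite evM_tr !evMM evM_Ps !evM_Xs E.
by split=> //; rewrite /lam0 E' eqxx mulr1.
Qed.

Lemma trPXX a b : \tr (Ps * Xs a * Xs b) = lam0 *+ (a == b).
Proof.
apply/sfunP => x; have [l _ [El ->]] := lam0_ev x.
by case: eqP => _; rewrite ?mulr1 ?mulr0.
Qed.

Lemma trXX a b : \tr (Xs a * Xs b) = lam0 *+ (a == b) *+ 2.
Proof.
by rewrite (tr_offdiag_mul _ (Xs_offdiag a)) !trPXX eq_sym mulr2n.
Qed.

Lemma Xs_comm a b : md (sD (e_ R a)) (Xs b) = md (sD (e_ R b)) (Xs a).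
Proof. by apply/matrixP => p q; rewrite !mxE sD_comm. Qed.

Lemma der_trXX c a b : \tr (md (sD (e_ R c)) (Xs a) * Xs b) + \tr (Xs a * md (sD (e_ R c)) (Xs b)) =
  sD (e_ R c) lam0 *+ (a == b) *+ 2.
Proof.
have := congr1 (sD (e_ R c)) (trXX a b).
rewrite (md_tr (sDD _)) (mdM (sDD _) (sDM _)) raddfD /= => ->.
have dn m h : sD (e_ R c) (h *+ m) = sD (e_ R c) h *+ m.
  by elim: m => [|m IH]; rewrite ?(der0 (sDD _))// !mulrS sDD IH.
by rewrite !dn.
Qed.

Lemma sfun_half (h : S) : h + h = 0 -> h = 0.
Proof. by move=> E; rewrite -[h]mul1r -sC2V mulrDl -mulrDr E mulr0. Qed.

(** The relations [trXX] are differentiated for equal and for distinct indices; the two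
    contributions are opposite multiples of a derivative of [lam0]. This is the classical fact that
    the Laplacian of a conformal immersion of a surface is normal to it. *)
Lemma tr_lap k : \tr ((\sum_i Ls i) * Xs k) = 0.
Proof.
have -> : \sum_i Ls i = Ls 0 + Ls 1.
  by rewrite big_ord_recl big_ord1; congr (_ + Ls _); exact: val_inj.
rewrite mulrDl raddfD /=; apply: sfun_half; rewrite addrACA.
have same i : \tr (Ls i * Xs i) + \tr (Ls i * Xs i) = sD (e_ R i) lam0 *+ 2.
  by have := der_trXX i i i; rewrite eqxx mulr1n (trC (Xs i)).
have diff i : i != k -> \tr (Ls i * Xs k) + \tr (Ls i * Xs k) = - (sD (e_ R k) lam0 *+ 2).
  move=> ik; have := der_trXX i i k; rewrite (negbTE ik) mulr0n mul0rn => /eqP.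
  rewrite addr_eq0 => /eqP E; have := der_trXX k i i.
  rewrite eqxx mulr1n (trC (md _ _)) -{1 2}Xs_comm => <-.
  by rewrite [\tr (Ls i * _)]E opprD.
case: (ord2P k) => kE; rewrite kE in diff *.
  exact (etrans (congr2 +%R (same 0) (diff 1 isT)) (subrr _)).
exact (etrans (congr2 +%R (diff 0 isT) (same 1)) (addNr _)).
Qed.

Lemma lap_ev x : (\sum_i evM x (Ls i)) *m Pf f j x = Pf f j x *m ((\sum_i evM x (Ls i)) *m Pf f j x).
Proof.
have [r E] := harmonic_ev hf j x; have [l l0 [_ T]] := lam0_ev x.
have {E} : (\sum_i evM x (Ls i)) *m Pf f j x - Pf f j x *m ((\sum_i evM x (Ls i)) *m Pf f j x) =
    \sum_i (r i)%:C%C *: (evM x (Xs i) *m Pf f j x).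
  under eq_bigr => i _ do rewrite evM_Ls; rewrite E.
  by apply: eq_bigr => i _; rewrite evM_Xs.
move=> E; apply/eqP; rewrite -subr_eq0 E; apply/eqP; rewrite big1 // => k _.
suff -> : r k = 0 by rewrite scale0r.
have LLE : \sum_i evM x (Ls i) = evM x (\sum_i Ls i) by rewrite /evM raddf_sum.
apply: (tangential_coeff0 l0 _ _ _ _ _ _ _ E) => [|i||||a b|c].
- exact: proj_proj (generator_neq0 _).
- by rewrite -evM_Ps -!evMM -evMD Xs_offdiag.
- exact: proj_adj.
- rewrite LLE -evM_star; congr evM; rewrite (_ : \sum_i Ls i = Ls 0 + Ls 1).
    by rewrite starD !star_Ls.
  by rewrite big_ord_recl big_ord1; congr (_ + Ls _); exact: val_inj.
- by move=> i; rewrite -evM_star star_Xs.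
- by rewrite -evM_Ps -!evMM -evM_tr T.
- by rewrite LLE -evMM -evM_tr tr_lap.
Qed.

Local Notation A := (md (@dz R) Ps).
Local Notation B := (md (@db R) Ps).

Lemma A_E : A = sC 2^-1 *: (Xs 0 - sC 'i *: Xs 1).
Proof. by apply/matrixP => a b; rewrite !mxE. Qed.

Lemma B_E : B = sC 2^-1 *: (Xs 0 + sC 'i *: Xs 1).
Proof. by apply/matrixP => a b; rewrite !mxE. Qed.

(** The half arises because [A] and [B] each carry a factor 1/2 while the two coordinate directions
    contribute equally to P A B P. *)
Definition lam : S := sC 2^-1 * lam0.

Lemma rk1_tr (M M' : 'M[S]_3) c : \tr (Ps * M * M') = c -> Ps * M * M' * Ps = c *: Ps.
Proof. by move=> <-; rewrite -[Ps * M * M']mulrA Ps_rk1. Qed.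

Lemma trPXX_comb (a b c e : S) :
  \tr (Ps * (a *: Xs 0 + b *: Xs 1) * (c *: Xs 0 + e *: Xs 1)) = (a * c + b * e) * lam0.
Proof.
exact: (tr_bilinear _ _ _ _ (trPXX 0 0) (trPXX 1 1) (trPXX 0 1) (trPXX 1 0)).
Qed.

Lemma A_lin : A = sC 2^-1 *: Xs 0 + (- (sC 2^-1 * sC 'i)) *: Xs 1.
Proof. by rewrite A_E scalerBr scalerA scaleNr. Qed.

Lemma B_lin : B = sC 2^-1 *: Xs 0 + (sC 2^-1 * sC 'i) *: Xs 1.
Proof. by rewrite B_E scalerDr scalerA. Qed.

Lemma PAAP_Ps : Ps * A * A * Ps = 0.
Proof.
rewrite (@rk1_tr _ _ 0) ?scale0r// A_lin trPXX_comb.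
transitivity (sC 2^-1 * sC 2^-1 * (1 + sC 'i * sC 'i) * lam0); first by ring.
by rewrite sCi2 subrr mulr0 mul0r.
Qed.

Lemma PBBP_Ps : Ps * B * B * Ps = 0.
Proof.
rewrite (@rk1_tr _ _ 0) ?scale0r// B_lin trPXX_comb.
transitivity (sC 2^-1 * sC 2^-1 * (1 + sC 'i * sC 'i) * lam0); first by ring.
by rewrite sCi2 subrr mulr0 mul0r.
Qed.

Lemma lam_alg : sC 2^-1 * sC 2^-1 * (1 - sC 'i * sC 'i) * lam0 = lam.
Proof.
rewrite sCi2 opprK /lam; transitivity ((sC 2^-1 + sC 2^-1) * sC 2^-1 * lam0); first by ring.
by rewrite sC2V mul1r.
Qed.

Lemma PABP_Ps : Ps * A * B * Ps = lam *: Ps.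
Proof. by apply: rk1_tr; rewrite A_lin B_lin trPXX_comb -lam_alg; ring. Qed.

Lemma PBAP_Ps : Ps * B * A * Ps = lam *: Ps.
Proof. by apply: rk1_tr; rewrite A_lin B_lin trPXX_comb -lam_alg; ring. Qed.

Lemma starA : star A = B.
Proof. by rewrite star_dz star_Ps. Qed.

(** The derivative H is a quarter of the Laplacian, so [lap_ev] gives H P = P H P. Since the two
    derivations commute, H is self-adjoint, and the adjoint identity is P H = P H P. *)
Lemma PH_Ps : Ps * md (@db R) A = md (@db R) A * Ps.
Proof.
have E : sC 4 *: md (@db R) A = \sum_i Ls i.
  have -> : \sum_i Ls i = Ls 0 + Ls 1.
    by rewrite big_ord_recl big_ord1; congr (_ + Ls _); exact: val_inj.
  by apply/matrixP => a b; rewrite !mxE -dzb_comm -sD_lap.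
set H := md (@db R) A in E *.
have HP : H * Ps = Ps * (H * Ps).
  have : sC 4 *: (H * Ps) = sC 4 *: (Ps * (H * Ps)).
    have -> : sC 4 *: (H * Ps) = (\sum_i Ls i) * Ps by rewrite -E scalerAl.
    have -> : sC 4 *: (Ps * (H * Ps)) = Ps * ((\sum_i Ls i) * Ps).
      by rewrite -E -scalerAl -scalerAr.
    apply: evMP => x; rewrite !evMM evM_Ps.
    by have := lap_ev x; rewrite /evM raddf_sum.
  apply: scalerI_unit (_ : sC 4^-1 * sC 4 = 1).
  by rewrite -rmorphM mulVf ?pnatr_eq0// rmorph1.
have hH : star H = H by rewrite /H star_db starA mx_comm // => h; exact: dzb_comm.
have := congr1 (@star _ _ _) HP; rewrite !starM star_Ps hH => {1}->.
by rewrite -mulrA -HP.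
Qed.

Lemma lam_ev x : exists2 l : R, 0 < l & lam x = l%:C%C.
Proof.
have [l l0 [E _]] := lam0_ev x; exists (2^-1 * l); first by rewrite mulr_gt0 ?invr_gt0.
by rewrite /lam sfunM E rmorphM fmorphV rmorph_nat.
Qed.

Lemma sJ_lam : sJ lam = lam.
Proof. by apply/sfunP => x; have [l _ E] := lam_ev x; rewrite -[LHS]/((lam x)^*) E; exact: conjc_real. Qed.

Lemma Q0_Ps : Q (@dz R) (@db R) Ps lam = 0.
Proof.
apply: tr_hermitian_sq; last first.
  exact: (trQQ (@dzD R) (@dzM R) (@dbD R) (@dbM R) PsPs tr_Ps PAAP_Ps PBBP_Ps PABP_Ps PBAP_Ps).
rewrite /Q starD starN !(starD, starM) starZ sJ_lam starD star1 star_Ps starA.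
have -> : star B = A by rewrite -starA starK.
by [].
Qed.

End SmoothProjector.

(** * Holomorphic differentials on the sphere *)

Lemma vlineZ (K : fieldType) (V : vectType K) (c : K) (v : V) : c != 0 ->
  (<[c *: v]> = <[v]>)%VS.
Proof.
move=> c0; apply/vspaceP => u; apply/vlineP/vlineP => -[k ->].
  by exists (k * c); rewrite scalerA.
by exists (k / c); rewrite scalerA divfK.
Qed.

Section ChartChange.
Variables (R : realType) (f : S2 R -> CP R 2).
Local Notation C := R[i].
Local Notation plane := 'cV[R]_(1 + 1).
Local Notation S := (sfun R).
Local Notation Z := (Zf R).
Hypothesis hf : minimal_lagrangian_immersion f.

Lemma insert01 (t : C) (v : 'cV[C]_1) : insert (0 : 'I_2) t v 1 0 = v 0 0.
Proof. by rewrite -(insert_lift 0 t v 0); congr (insert _ _ _ _ _); exact: val_inj. Qed.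

Lemma insert10 (t : C) (v : 'cV[C]_1) : insert (1 : 'I_2) t v 0 0 = v 0 0.
Proof. by rewrite -(insert_lift 1 t v 0); congr (insert _ _ _ _ _); exact: val_inj. Qed.

Lemma of_real_Zf (p : plane) : of_real (n := 1) p 0 0 = Z p.
Proof. by rewrite of_realE; congr (p _ 0 +i* p _ 0)%C; exact: val_inj. Qed.

Lemma unchart_invp (p : plane) : p != 0 -> unchart 0 p = unchart 1 (invp p) :> S2 R.
Proof.
move=> p0; apply: val_inj => /=; have z0 : Z p != 0 by rewrite Zf_eq0.
have -> : insert 0 1 (of_real (n := 1) p) = Z p *: insert 1 1 (of_real (n := 1) (invp p)).
  apply/matrixP => i l; rewrite (ord1 l) [RHS]mxE; case: (ord2P i) => ->.
    by rewrite insert_k insert10 of_real_Zf Zf_pl mulfV.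
  by rewrite insert_k insert01 of_real_Zf mulr1.
exact: vlineZ.
Qed.

Definition mrel m n (M M' : 'M[S]_(m, n)) : Prop := forall i j, inv_rel (M i j) (M' i j).

Lemma inv_rel_sum (I : Type) (r : seq I) (F F' : I -> S) :
  (forall i, inv_rel (F i) (F' i)) -> inv_rel (\sum_(i <- r) F i) (\sum_(i <- r) F' i).
Proof.
move=> h; elim: r => [|i r IH]; rewrite ?big_nil ?big_cons //.
exact: inv_relD.
Qed.

Lemma mrelM n (M M' N N' : 'M[S]_n.+1) : mrel M M' -> mrel N N' -> mrel (M * N) (M' * N').
Proof.
move=> h h' i l; rewrite !mxE; apply: inv_rel_sum => k; exact: inv_relM.
Qed.

Lemma mrel_tr n (M M' : 'M[S]_n) : mrel M M' -> inv_rel (\tr M) (\tr M').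
Proof. by move=> h; apply: inv_rel_sum => i; exact: h. Qed.

Lemma mrel_dz n (M M' : 'M[S]_n.+1) : mrel M M' ->
  mrel ((Z * Z) *: md (@dz R) M) (- md (@dz R) M').
Proof. by move=> h i l; rewrite !mxE; exact: inv_rel_dz. Qed.

Lemma mrel_star m n (M M' : 'M[S]_(m, n)) : mrel M M' -> mrel (star M) (star M').
Proof. by move=> h i l; rewrite !mxE; exact: inv_relJ. Qed.

Lemma mrel_Ps : mrel (Ps hf 0) (Ps hf 1).
Proof.
move=> a b p p0; rewrite !mxE /= /Pf /gen.
by rewrite (unchart_invp p0).
Qed.

End ChartChange.

(* [P], [P'] are the projectors in the two charts of the sphere. *)
Section HolomorphicDifferentials.
Variable R : realType.
Local Notation C := R[i].
Local Notation plane := 'cV[R]_(1 + 1).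
Local Notation S := (sfun R).
Local Notation Z := (Zf R).
Local Notation D := (md (@dz R)).
Local Notation D' := (md (@db R)).

Lemma tr_psi (P A B : 'M[S]_3) (z u w : S) : P * A * A = 0 ->
  \tr (P * (z *: A) * (w *: (u *: A + z *: B))) = w * z * z * \tr (P * A * B).
Proof.
move=> PAA; rewrite -[P * (z *: A)]scalerAr -scalerAl -scalerAr mulrDr -!scalerAr PAA.
by rewrite scaler0 add0r !scalerA mxtraceZ; congr (_ * _); ring.
Qed.

(** Each of the three [dz] in [psi] contributes [Z * Z], hence the weight 6. Differentiating a
    factor [Z * Z] only adds a multiple of P A A, which vanishes. *)
Lemma psi_rel (P P' : 'M[S]_3) : mrel P P' -> P * D P * D P = 0 ->
  inv_rel (Z ^+ 6 * psi (@dz R) P) (- psi (@dz R) P').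
Proof.
move=> rP PAA0; have rA := mrel_dz rP; have rC := mrel_dz rA.
have := mrel_tr (mrelM (mrelM rP rA) rC).
rewrite (mdZ (@dzM R)) dzM dz_Zf mul1r mulr1 (mdN (@dzD R)) opprK.
rewrite (tr_psi _ _ _ _ PAA0) => h p p0; move: (h p p0).
rewrite mulrN mulNr -mulrA -/(D _) [in RHS]raddfN /= /psi !mulrA => <-.
by congr (_ p); rewrite !exprS expr0 mulr1; ring.
Qed.

Lemma lam_rel (P P' : 'M[S]_3) (l l' : S) : mrel P P' -> star P = P -> star P' = P' ->
  \tr P = 1 -> \tr P' = 1 -> P * D' P * D P = l *: P -> P' * D' P' * D P' = l' *: P' ->
  inv_rel (sJ (Z * Z) * (Z * Z) * l) l'.
Proof.
move=> rP hP hP' tP tP' El El'; have rA := mrel_dz rP; have rB := mrel_star rA.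
have := mrel_tr (mrelM (mrelM rP rB) rA).
rewrite starZ starN !star_dz hP hP' -[P * (_ *: _)]scalerAr -scalerAl -scalerAr.
rewrite !mulrN mulNr opprK El El' !mxtraceZ tP tP' !mulr1.
by rewrite mulrA.
Qed.

(** A logarithmic derivative transforms like a connection coefficient, hence the inhomogeneous term
    [Z + Z]; the conjugate factor of [lam_rel] is constant for [dz] and drops out. *)
Lemma dlog_rel (l l' k k' : S) : inv_rel (sJ (Z * Z) * (Z * Z) * l) l' ->
  k * l = 1 -> k' * l' = 1 ->
  inv_rel (Z + Z + Z * Z * dlog (@dz R) l k) (- dlog (@dz R) l' k').
Proof.
move=> rl kl kl' p p0; have := inv_rel_dz rl p0; have := rl p p0.
have -> : dz (sJ (Z * Z) * (Z * Z) * l) = sJ (Z * Z) * ((Z + Z) * l + Z * Z * dz l).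
  by rewrite !dzM sJM !dzM !dzJ db_Zf dz_Zf rmorph0; ring.
have /(congr1 (fun h : S => h p)) := kl; have /(congr1 (fun h : S => h (invp p))) := kl'.
rewrite /dlog; have z0 : Z p != 0 by rewrite Zf_eq0.
have zb0 : sJ (Z * Z) p != 0 by rewrite conjC_eq0 mulf_neq0.
move: (dz l) (dz l') (sJ _) zb0 => dl dl' W zb0.
move: (Zf R) z0 => z z0; rewrite !(sfunM, sfunD, sfunN, sfun1).
move: (dl p) (dl' (invp p)) (l p) (l' (invp p)) (k p) (k' (invp p)) => {dl dl'} dl dl' a a' b b'.
move: (W p) zb0 (z p) z0 => {W z} w w0 z z0 b'a' ba Ea Ed.
have a0 : a != 0 by apply: contra_eq_neq ba => ->; rewrite mulr0 eq_sym oner_eq0.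
have bE : b = a^-1 by rewrite -[LHS]mulr1 -(mulfV a0) mulrA ba mul1r.
have a'0 : a' != 0 by apply: contra_eq_neq b'a' => ->; rewrite mulr0 eq_sym oner_eq0.
have bE' : b' = a'^-1 by rewrite -[LHS]mulr1 -(mulfV a'0) mulrA b'a' mul1r.
rewrite bE bE' -mulrN -Ed.
by rewrite -Ea; field; rewrite z0 w0 a0.
Qed.

Fact schwarzian_algebra (T : comNzRingType) (z m d : T) :
  z ^+ 4 * (d + d - m ^+ 2) =
  z * z * (1 + 1 + ((z + z) * m + z * z * d)) + z * z * (1 + 1 + ((z + z) * m + z * z * d)) -
  (z + z + z * z * m) * (z + z + z * z * m).
Proof. by ring. Qed.

(** In this combination the inhomogeneous term of [dlog_rel] cancels, which leaves a quadratic
    differential, of weight 4. *)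
Lemma schwarzian_rel (mu mu' : S) : inv_rel (Z + Z + Z * Z * mu) (- mu') ->
  inv_rel (Z ^+ 4 * (dz mu + dz mu - mu ^+ 2)) (dz mu' + dz mu' - mu' ^+ 2).
Proof.
move=> r; have r' := inv_rel_dz r.
have := inv_relD (inv_relD r' r') (inv_relN (inv_relM r r)).
rewrite dzN !dzD !dzM dz_Zf => h p p0; have := h p p0.
have -> : - - dz mu' + - - dz mu' + - (- mu' * - mu') = dz mu' + dz mu' - mu' ^+ 2 by ring.
by move=> <-; rewrite !mul1r !mulr1; rewrite schwarzian_algebra.
Qed.

End HolomorphicDifferentials.

(** * Integration of the structure equations *)

Section Projector.
Variables (S : comNzRingType) (d d' : S -> S).
Hypothesis dD : forall f g, d (f + g) = d f + d g.
Hypothesis dM : forall f g, d (f * g) = d f * g + f * d g.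
Hypothesis d'D : forall f g, d' (f + g) = d' f + d' g.
Hypothesis d'M : forall f g, d' (f * g) = d' f * g + f * d' g.
Variables (P : 'M[S]_3) (lam : S).
Local Notation A := (md d P).
Local Notation B := (md d' P).
Hypothesis PP : P * P = P.
Hypothesis PABP : P * A * B * P = lam *: P.
Hypothesis PBAP : P * B * A * P = lam *: P.
Hypothesis Q0 : Q d d' P lam = 0.

Lemma Q_sym : Q d' d P lam = 0.
Proof. by rewrite -[RHS]Q0 /Q [A * B + _]addrC. Qed.

Lemma AABB_BBAA : A * A * (B * B) + B * B * (A * A) = lam ^+ 2 *: (1 - P).
Proof.
have EA := AAB dD dM d'D d'M PP PABP PBAP Q0.
have EB := AAB d'D d'M dD dM PP PBAP PABP Q_sym.
have E1 := PAB dD dM d'D d'M PP PABP; have E2 := PBA dD dM d'D d'M PP PBAP.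
rewrite !mulrA EA EB -!scalerAl -scalerDr expr2 -scalerA; congr (_ *: _).
have hA := AP_PA dD dM PP; have hB := AP_PA d'D d'M PP.
have EAB : A * B = A * P * B + lam *: P by rewrite -{1}hA mulrDl E1.
have EBA : B * A = B * P * A + lam *: P by rewrite -{1}hB mulrDl E2.
have := ABBA_E Q0; rewrite EAB EBA addrACA -scalerDl => /(canRL (addrK _)) ->.
by rewrite scalerDl scalerDr scalerBr opprD addrA addrK.
Qed.

Hypothesis PAAP : P * A * A * P = 0.
Hypothesis PBBP : P * B * B * P = 0.
Variable k : S.
Hypothesis klam : k * lam = 1.
Local Notation N := (opN d P k).
Local Notation N' := (opN d' P k).
Local Notation E := (opE d P k).
Local Notation E' := (opE d' P k).
Local Notation F := (P *+ 3 - 1).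

Lemma opE_P : E * P = 0.
Proof. by rewrite -scalerAl (AAP dD dM PP PAAP) scaler0. Qed.

Lemma opE_AP : E * (A * P) = 0.
Proof. by rewrite -scalerAl mulrA (AAA dD dM PP PAAP) mul0r scaler0. Qed.

Lemma opE_BP : E * (B * P) = k *: (A * P).
Proof.
rewrite -scalerAl mulrA (AAB dD dM d'D d'M PP PABP PBAP Q0) -scalerAl -mulrA PP scalerA.
by rewrite expr2 -mulrA klam mulr1.
Qed.

Lemma opN_P : N * P = k *: (A * P).
Proof. by rewrite -scalerAl. Qed.

Lemma opN_AP : N * (A * P) = 0.
Proof. by rewrite -scalerAl mulrA (AAP dD dM PP PAAP) scaler0. Qed.

Lemma opN_BP : N * (B * P) = P.
Proof. by rewrite -scalerAl mulrA (ABP dD dM d'D d'M PP PABP) scalerA klam scale1r. Qed.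

Lemma opF_P : F * P = 2 *: P.
Proof. by rewrite mulrBl mul1r mulrnAl PP mulrSr addrK scaler_nat. Qed.

Lemma opF_AP : F * (A * P) = - (A * P).
Proof. by rewrite mulrBl mul1r mulrnAl mulrA (PAP dD dM PP) mul0rn sub0r. Qed.

(** E E' and E' E are [k ^+ 2] times the projectors onto the lines of A e and B e. A vector killed
    by both [E] and [E'] therefore lies in the range of [P], which is how [P] is recovered. *)
Lemma opE_opE : k ^+ 2 *: (1 - P) = E * E' + E' * E.
Proof.
rewrite -!scalerAl -!scalerAr -!scalerDr AABB_BBAA !scalerA; congr (_ *: _).
by transitivity (k ^+ 2 * (k * lam) ^+ 2); [rewrite klam; ring|ring].
Qed.

End Projector.

(* Here [u], [b], [b'] stand for the conjugate of [z], for [1 - m u / 2] and its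
   conjugate; the vectors are [e], [A e], [B e] at the base point. *)
Lemma quartic_kills (K : comNzRingType) n (E N F N' E' : 'M[K]_n) (x0 x1 x2 : 'M[K]_n)
    (k l h z u b b' : K) :
  k * l = 1 -> h + h = 1 ->
  E *m x0 = 0 -> E *m x1 = 0 -> E *m x2 = k *: x1 ->
  N *m x0 = k *: x1 -> N *m x1 = 0 -> N *m x2 = x0 ->
  F *m x0 = 2 *: x0 -> F *m x1 = - x1 -> F *m x2 = - x2 ->
  N' *m x0 = k *: x2 -> N' *m x1 = x0 -> N' *m x2 = 0 ->
  E' *m x0 = 0 -> E' *m x1 = k *: x2 -> E' *m x2 = 0 ->
  (b ^+ 4 *: E - (u * b ^+ 3) *: N + (h * u ^+ 2 * b ^+ 2) *: F + (h * l * u ^+ 3 * b) *: N' +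
   (h ^+ 2 * l ^+ 2 * u ^+ 4) *: E') *m
  ((b * b' - h * l * (z * u)) *: x0 + (z * b) *: x1 + (u * b') *: x2) = 0.
Proof.
move=> kl h2 E0 E1 E2 N0 N1 N2 F0 F1 F2 N'0 N'1 N'2 E'0 E'1 E'2.
rewrite !mulmxDl !mulNmx -!scalemxAl !mulmxDr -!scalemxAr.
rewrite E0 E1 E2 N0 N1 N2 F0 F1 F2 N'0 N'1 N'2 E'0 E'1 E'2.
apply/matrixP => i j; rewrite !mxE; move: (x0 i j) (x1 i j) (x2 i j) => e a c.
transitivity ((h + h - 1) * (u ^+ 2 * b ^+ 3 * b' - h * l * z * u ^+ 3 * b ^+ 2) * e +
  (k * l - 1) * (h * u ^+ 2 * b ^+ 3 * z * a + h * u ^+ 3 * b ^+ 2 * b' * c)); first by ring.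
by rewrite kl h2 subrr !mul0r addr0.
Qed.

Lemma rmorph_taylor (S T : comNzRingType) (phi : {rmorphism S -> T}) h r s l m e n f n' e' z t :
  phi (taylor h r s l m e n f n' e' z t) =
  taylor (phi h) (phi r) (phi s) (phi l) (phi m) (phi e) (phi n) (phi f) (phi n') (phi e')
    (phi z) (phi t).
Proof.
by rewrite /taylor /tay1 /tay2 /tay3 /tay4 /= !(rmorph_nat, rmorphXn, rmorphD, rmorphN, rmorphM).
Qed.

Lemma taylor_tt (S : comNzRingType) (h r s l m e n f n' e' t : S) :
  taylor h r s l m e n f n' e' t t = e.
Proof. by rewrite /taylor subrr /=; ring. Qed.

Lemma taylor_0t (K : numFieldType) (l m e n f n' e' t : K) :
  let b := 1 - 2^-1 * m * t in
  taylor 2^-1 6^-1 24^-1 l m e n f n' e' 0 t =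
  b ^+ 4 * e - (t * b ^+ 3) * n + (2^-1 * t ^+ 2 * b ^+ 2) * f + (2^-1 * l * t ^+ 3 * b) * n' +
  ((2^-1) ^+ 2 * l ^+ 2 * t ^+ 4) * e'.
Proof. by rewrite /taylor /tay1 /tay2 /tay3 /tay4 /=; field. Qed.

Lemma entry_md (S : comNzRingType) (d : S -> S) n (M X : 'M[S]_n.+1) i j :
  md d M = X -> d (M i j) = X i j.
Proof. by move=> <-; rewrite mxE. Qed.

Lemma entryBZ (S : comNzRingType) n (M N : 'M[S]_n) c i j :
  (- M - c *: N) i j = - M i j - c * N i j.
Proof. by rewrite !mxE. Qed.

Lemma entryZ (S : comNzRingType) n (M : 'M[S]_n) c i j : (c *: M) i j = c * M i j.
Proof. by rewrite mxE. Qed.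

Lemma sC_natV (R : realType) n : n.+1%:R * sC (n.+1%:R^-1 : R[i]) = 1.
Proof.
rewrite -(rmorph_nat (@sC R)) -rmorphM mulfV ?rmorph1// pnatr_eq0 //.
Qed.

Lemma taylor_ev (R : realType) (p : 'cV[R]_(1 + 1)) (l m e n f n' e' : sfun R) :
  taylor (sC 2^-1) (sC 6^-1) (sC 24^-1) l m e n f n' e' (sJ (Zf R)) (sC (Zf R p)^*) p =
  taylor (sC 2^-1) (sC 6^-1) (sC 24^-1) l m e n f n' e' (sJ (Zf R)) (sC (Zf R p)^*) 0 ->
  let u := (Zf R p)^* in let l0 := l 0 in let b := 1 - 2^-1 * m 0 * u in
  e p = b ^+ 4 * e 0 - (u * b ^+ 3) * n 0 + (2^-1 * u ^+ 2 * b ^+ 2) * f 0 +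
    (2^-1 * l0 * u ^+ 3 * b) * n' 0 + (2^-1 ^+ 2 * l0 ^+ 2 * u ^+ 4) * e' 0.
Proof.
have E x : taylor (sC 2^-1) (sC 6^-1) (sC 24^-1) l m e n f n' e' (sJ (Zf R)) (sC (Zf R p)^*) x =
    taylor 2^-1 6^-1 24^-1 (l x) (m x) (e x) (n x) (f x) (n' x) (e' x) (Zf R x)^* (Zf R p)^*.
  exact (rmorph_taylor (ev x) _ _ _ _ _ _ _ _ _ _ _ _).
have Z0 : Zf R 0 = 0 by apply/eqP; rewrite Zf_eq0.
by rewrite !E Z0 taylor_tt rmorph0 => ->; exact: taylor_0t.
Qed.

Section Solution.
Variables (R : realType) (f : S2 R -> CP R 2).
Local Notation C := R[i].
Local Notation plane := 'cV[R]_(1 + 1).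
Local Notation S := (sfun R).
Local Notation Z := (Zf R).
Hypothesis hf : minimal_lagrangian_immersion f.
Local Notation P := (Ps hf).
Local Notation A j := (md (@dz R) (P j)).
Local Notation B j := (md (@db R) (P j)).

Lemma lam_neq0 j x : lam hf j x != 0.
Proof. by have [l l0 ->] := lam_ev hf j x; rewrite (inj_eq (@complexI R)) gt_eqF. Qed.

Definition lamV j : S := sV (lam_neq0 j).

Lemma lamVK j : lamV j * lam hf j = 1.
Proof. by rewrite mulrC; exact: mul_sV. Qed.

Lemma sJ_lamV j : sJ (lamV j) = lamV j.
Proof.
rewrite -[LHS]mulr1 -(lamVK j) mulrCA -{1}(sJ_lam hf j) -sJM [_ * lam _ _]mulrC mul_sV.
by rewrite rmorph1 mulr1.
Qed.

Lemma PAA_Ps j : P j * A j * A j = 0.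
Proof. exact (PAA (@dzD R) (@dzM R) (PsPs hf j) (PAAP_Ps hf j)). Qed.

Lemma PBA_Ps j : P j * B j * A j = lam hf j *: P j.
Proof.
exact (PBA (@dzD R) (@dzM R) (@dbD R) (@dbM R) (PsPs hf j) (PBAP_Ps hf j)).
Qed.

Lemma psi_eq0 : psi (@dz R) (P 0) = 0.
Proof.
(* The index is one less than the weight 6 of the cubic differential. *)
apply: (Liouville (k := 5)) (psi_rel (mrel_Ps hf) (PAA_Ps 0)).
exact (der_psi (@dzD R) (@dzM R) (@dbD R) (@dbM R) (@dzb_comm R) (PsPs hf 0) (PAAP_Ps hf 0)
  (PBAP_Ps hf 0) (PH_Ps hf 0) (Q0_Ps hf 0)).
Qed.

Local Notation l := (lam hf 0).
Local Notation k := (lamV 0).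
Local Notation mu := (dlog (@dz R) l k).
Local Notation mb := (dlogb (@db R) l k).

Lemma schwarzian_eq0 : dz mu + dz mu - mu ^+ 2 = 0.
Proof.
have rl := lam_rel (mrel_Ps hf) (star_Ps hf 0) (star_Ps hf 1) (tr_Ps hf 0) (tr_Ps hf 1)
  (PBA_Ps 0) (PBA_Ps 1).
apply: (Liouville (k := 3)) (schwarzian_rel (dlog_rel rl (lamVK 0) (lamVK 1))).
exact (der_schwarzian (@dzD R) (@dzM R) (@dbD R) (@dbM R) (@dzb_comm R) (PsPs hf 0) (tr_Ps hf 0)
  (Ps_rk1 hf 0) (PAAP_Ps hf 0) (PABP_Ps hf 0)
  (PBAP_Ps hf 0) (PH_Ps hf 0) (Q0_Ps hf 0) psi_eq0 (lamVK 0) (sC2V R)).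
Qed.

(** The conjugate of the vanishing Schwarzian, a Riccati equation that closes the system for the
    derivatives of [E]. *)
Lemma db_mb : db mb = sC 2^-1 * mb ^+ 2.
Proof.
have : sJ (dz mu + dz mu - mu ^+ 2) = 0 by rewrite schwarzian_eq0 rmorph0.
have E : sJ mu = mb by rewrite sJM sJ_lamV -dbJ sJ_lam.
rewrite sJD sJN sJD rmorphXn /= -dbJ E => /subr0_eq <-.
by rewrite mulrDr -mulrDl sC2V mul1r.
Qed.

Local Notation N := (opN (@dz R) (P 0) k).
Local Notation E := (opE (@dz R) (P 0) k).
Local Notation F := (P 0 *+ 3 - 1).

Lemma d_E : md (@dz R) E = 0.
Proof.
exact (dE_E (@dzD R) (@dzM R) (@dbD R) (@dbM R) (@dzb_comm R) (PsPs hf 0)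
  (Ps_rk1 hf 0) (PAAP_Ps hf 0) (PABP_Ps hf 0)
  (PBAP_Ps hf 0) (PH_Ps hf 0) (Q0_Ps hf 0) psi_eq0 (lamVK 0)).
Qed.

Lemma d_N : md (@dz R) N = (l *+ 2) *: E.
Proof.
exact (dN_E (@dzD R) (@dzM R) (@dbD R) (@dbM R) (@dzb_comm R) (PsPs hf 0)
  (Ps_rk1 hf 0) (PAAP_Ps hf 0) (PABP_Ps hf 0)
  (PBAP_Ps hf 0) (PH_Ps hf 0) (Q0_Ps hf 0) psi_eq0 (lamVK 0)).
Qed.

Lemma db_E : md (@db R) E = - N - (mb *+ 2) *: E.
Proof.
exact (d'E_E (@dzD R) (@dzM R) (@dbD R) (@dbM R) (PsPs hf 0) (PH_Ps hf 0) (Q0_Ps hf 0) (lamVK 0)).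
Qed.

Lemma db_N : md (@db R) N = - F - mb *: N.
Proof.
rewrite opprB.
exact (d'N_E (@dzD R) (@dzM R) (@dbD R) (@dbM R) (PsPs hf 0) (PH_Ps hf 0) (Q0_Ps hf 0) (lamVK 0)).
Qed.

Lemma star_N : star N = k *: B 0.
Proof. by rewrite starZ sJ_lamV starA. Qed.

Lemma star_E : star E = k ^+ 2 *: (B 0 * B 0).
Proof. by rewrite starZ rmorphXn /= sJ_lamV starM starA. Qed.

Lemma db_F : md (@db R) F = (3 * l) *: star N.
Proof.
rewrite star_N scalerA -mulrA [l * k]mulrC lamVK mulr1 (mdD (@dbD R)) (mdN (@dbD R)).
by rewrite (md1 (@dbD R) (@dbM R)) oppr0 addr0 mulrSr !mulr2n
  !(mdD (@dbD R)) scaler_nat mulrSr mulr2n.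
Qed.

Lemma db_starN : md (@db R) (star N) = (2 * l) *: star E.
Proof. by rewrite -star_dz d_N starZ rmorphMn /= sJ_lam mulr_natl. Qed.

Lemma db_starE : md (@db R) (star E) = 0.
Proof. by rewrite -star_dz d_E star0. Qed.

Lemma E_formula p i j : let u := (Z p)^* in let l0 := l 0 in let b := 1 - 2^-1 * mb 0 * u in
  E i j p = b ^+ 4 * E i j 0 - (u * b ^+ 3) * N i j 0 + (2^-1 * u ^+ 2 * b ^+ 2) * F i j 0 +
    (2^-1 * l0 * u ^+ 3 * b) * star N i j 0 + (2^-1 ^+ 2 * l0 ^+ 2 * u ^+ 4) * star E i j 0.
Proof.
have h2 := sC2V R.
(* [sC_natV] takes the predecessor: 5 and 23 stand for 6 and 24. *)
have r6 := @sC_natV R 5; have s24 := @sC_natV R 23.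
have hl : db l = l * mb by rewrite mulrA [l * k]mulrC lamVK mul1r.
have hE : db (E i j) = - N i j - 2 * mb * E i j.
  by rewrite (entry_md i j db_E) entryBZ mulr_natl.
have hN : db (N i j) = - F i j - mb * N i j.
  by rewrite (entry_md i j db_N); exact (entryBZ F N mb i j).
have hF : db (F i j) = 3 * (l * star N i j) by rewrite (entry_md i j db_F) entryZ mulrA.
have hN' : db (star N i j) = 2 * (l * star E i j).
  by rewrite (entry_md i j db_starN) entryZ mulrA.
have hE' : db (star E i j) = 0 by rewrite (entry_md i j db_starE) mxE.
have hdE : dz (E i j) = 0 by rewrite (entry_md i j d_E) mxE.
have zb : db (sJ Z) = 1 by rewrite dbJ dz_Zf rmorph1.
have zb0 : dz (sJ Z) = 0 by rewrite dzJ db_Zf rmorph0.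
have Tz := der_taylor (@dzD R) (@dzM R) (@dbD R) (@dbM R) (@dzb_comm R) h2 r6 s24 hl db_mb hE
  hN hF hN' hdE
  zb0 (dzC (Z p)^*).
have Tb := der_taylor' (@dzD R) (@dzM R) (@dbD R) (@dbM R) h2 r6 s24 hl db_mb hE hN hF hN' hE'
  zb (dbC (Z p)^*).
exact (taylor_ev (sfun_cst Tz Tb p 0)).
Qed.

End Solution.

(** * The Veronese parametrization *)

Section Veronese.
Variable R : realType.
Local Notation C := R[i].

Definition rt2 : C := (Num.sqrt 2 : R)%:C%C.

Lemma rt2_sq : rt2 * rt2 = 2.
Proof. by rewrite -rmorphM -expr2 sqr_sqrtr ?ler0n// rmorph_nat. Qed.

Lemma rt2_neq0 : rt2 != 0.
Proof. by apply/eqP => h; have := rt2_sq; rewrite h mul0r => /esym/eqP; rewrite pnatr_eq0. Qed.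

Lemma rt2J : rt2^* = rt2. Proof. exact: conjc_real. Qed.

Definition col3 (x y z : C) : 'cV[C]_3 := \col_i [:: x; y; z]`_i.

(** The middle term of the harmonic sequence of the Veronese conic. The factors [rt2] make its
    squared length the square of |a|^2 + |b|^2, so that SU(2) acts on these vectors through unitary
    matrices. *)
Definition veronese (a b : C) : 'cV[C]_3 :=
  col3 (rt2 * a * b^*) (b * b^* - a * a^*) (rt2 * a^* * b).

Lemma veronese_eq0 a b : veronese a b = 0 -> a = 0 /\ b = 0.
Proof.
move=> E; have E0 := congr1 (fun M : 'cV[C]_3 => M 0 0) E.
have E1 := congr1 (fun M : 'cV[C]_3 => M 1 0) E; rewrite !mxE /= in E0 E1.
move/eqP: E0; rewrite !mulf_eq0 (negbTE rt2_neq0) conjC_eq0 /= => /orP[]/eqP h; split=> //.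
  by move/eqP: E1; rewrite h mul0r subr0 -normCK expf_eq0 /= normr_eq0 => /eqP.
by move/eqP: E1; rewrite h mul0r sub0r oppr_eq0 -normCK expf_eq0 /= normr_eq0 => /eqP.
Qed.

Definition frame (s : C) (x0 x1 x2 : 'cV[C]_3) : 'M[C]_3 :=
  \matrix_(i, j) [:: s^-1 * x1 i 0; x0 i 0; s^-1 * x2 i 0]`_j.

Lemma frame_mul s x0 x1 x2 a b c : frame s x0 x1 x2 *m col3 a b c =
  (s^-1 * a) *: x1 + b *: x0 + (s^-1 * c) *: x2.
Proof.
apply/matrixP => i j; rewrite (ord1 j) !mxE !big_ord_recl big_ord0 !mxE /=; ring.
Qed.

Lemma frame_unitary s x0 x1 x2 : s != 0 -> s^* = s ->
  hdot x0 x0 = 1 -> hdot x1 x1 = s ^+ 2 -> hdot x2 x2 = s ^+ 2 ->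
  hdot x1 x0 = 0 -> hdot x2 x0 = 0 -> hdot x1 x2 = 0 -> frame s x0 x1 x2 \is unitarymx.
Proof.
move=> s0 sJ h00 h11 h22 h10 h20 h12.
have h01 : hdot x0 x1 = 0 by rewrite -hdotC h10 rmorph0.
have h02 : hdot x0 x2 = 0 by rewrite -hdotC h20 rmorph0.
have h21 : hdot x2 x1 = 0 by rewrite -hdotC h12 rmorph0.
pose y (j : 'I_3) := [:: s^-1 *: x1; x0; s^-1 *: x2]`_j.
have Ey i j : frame s x0 x1 x2 i j = y j i 0.
  by rewrite mxE /y; case: j => -[|[|[|//]]] hj /=; rewrite ?mxE.
have sv : s^-1^* = s^-1 by rewrite fmorphV /= sJ.
have hy i j : hdot (y i) (y j) = (i == j)%:R.
  have ss : s^-1 * (s^-1 * s ^+ 2) = 1 by rewrite expr2 mulKf// mulVf.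
  by rewrite /y; case: i => -[|[|[|//]]] hi; case: j => -[|[|[|//]]] hj /=;
    rewrite ?(hdotZl, hdotZr, sv, h00, h11, h22, h01, h02, h10, h20, h12, h21, ss, mulr0).
apply/unitarymxP/mulmx1C; apply/matrixP => i j; rewrite !mxE eq_sym -hy /hdot.
by apply: eq_bigr => a _; rewrite !mxE -!Ey !mxE mulrC.
Qed.

Lemma line_generator n (L : CP R n) : line L = <[generator L]>%VS.
Proof.
apply/eqP; rewrite eq_sym eqEdim -memvE memv_pick dim_vline generator_neq0.
by case: L => L /= /eqP ->.
Qed.

Lemma line_proj n (L : CP R n) (w : 'cV[C]_n.+1) : w != 0 ->
  proj (generator L) *m w = w -> line L = <[w]>%VS.
Proof.
move=> w0; rewrite proj_mul line_generator => Ew.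
rewrite -Ew vlineZ//; apply: contraNneq w0 => h.
by rewrite -Ew h scale0r.
Qed.

End Veronese.

Lemma evM_quartic (R : realType) n (M N F N' E' : 'M[sfun R]_n) p (a b c e g : R[i]) :
  (forall i j, M i j p = a * M i j 0 - b * N i j 0 + c * F i j 0 + e * N' i j 0 + g * E' i j 0) ->
  evM p M = a *: evM 0 M - b *: evM 0 N + c *: evM 0 F + e *: evM 0 N' + g *: evM 0 E'.
Proof. by move=> h; apply/matrixP => i j; rewrite !mxE; exact: h. Qed.

Lemma evM_quartic_star (R : realType) n (M N F : 'M[sfun R]_n) p (h l u b : R[i]) :
  h^* = h -> l^* = l -> star F = F ->
  (forall i j, M i j p = b ^+ 4 * M i j 0 - (u * b ^+ 3) * N i j 0 +
    (h * u ^+ 2 * b ^+ 2) * F i j 0 + (h * l * u ^+ 3 * b) * star N i j 0 +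
    (h ^+ 2 * l ^+ 2 * u ^+ 4) * star M i j 0) ->
  evM p (star M) = b^* ^+ 4 *: evM 0 (star M) - (u^* * b^* ^+ 3) *: evM 0 (star N) +
    (h * u^* ^+ 2 * b^* ^+ 2) *: evM 0 F + (h * l * u^* ^+ 3 * b^*) *: evM 0 N +
    (h ^+ 2 * l ^+ 2 * u^* ^+ 4) *: evM 0 M.
Proof.
have stE (X : 'M[sfun R]_n) i j x : X i j x = (star X j i x)^* by rewrite !mxE /= conjCK.
move=> hJ lJ sF H; apply/matrixP => i j.
rewrite [LHS]mxE /ev (stE (star M)) starK H !(rmorphXn, rmorphD, rmorphN, rmorphM) /= !hJ !lJ -!stE.
by rewrite -{1}sF -!stE !mxE.
Qed.

Lemma ker_pair (K : fieldType) n (c : K) (Q E E' W : 'M[K]_n) :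
  c != 0 -> c *: (1%:M - Q) = E *m E' + E' *m E -> E *m W = 0 -> E' *m W = 0 -> Q *m W = W.
Proof.
move=> c0 h EW E'W; have := congr1 (fun M => M *m W) h.
rewrite mulmxDl -!mulmxA EW E'W !mulmx0 addr0 -scalemxAl mulmxBl mul1mx => /eqP.
by rewrite scaler_eq0 (negbTE c0) subr_eq0 => /eqP.
Qed.

Lemma evM_ker (R : realType) n p (k : sfun R) (Q E E' : 'M[sfun R]_n.+1) :
  k ^+ 2 *: (1 - Q) = E * E' + E' * E ->
  k p ^+ 2 *: (1%:M - evM p Q) = evM p E *m evM p E' + evM p E' *m evM p E.
Proof. by move/(congr1 (evM p)); rewrite evMZ evMD evMN evM1 evMD !evMM sfunX. Qed.

(** * The parametrization in the first chart *)

Section Explicit.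
Variables (R : realType) (f : S2 R -> CP R 2).
Local Notation C := R[i].
Local Notation plane := 'cV[R]_(1 + 1).
Local Notation S := (sfun R).
Local Notation Z := (Zf R).
Hypothesis hf : minimal_lagrangian_immersion f.
Local Notation P := (Ps hf 0).
Local Notation A := (md (@dz R) P).
Local Notation B := (md (@db R) P).
Local Notation l := (lam hf 0).
Local Notation k := (lamV hf 0).
Local Notation mb := (dlogb (@db R) l k).
Local Notation N := (opN (@dz R) P k).
Local Notation E := (opE (@dz R) P k).
Local Notation N' := (opN (@db R) P k).
Local Notation E' := (opE (@db R) P k).
Local Notation F := (P *+ 3 - 1).
Local Notation P0 := (evM 0 P).
Local Notation A0 := (evM 0 A).
Local Notation B0 := (evM 0 B).

(** Applied to a generator e of the line at the origin, it gives a vector in the common kernel of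
    [E] and [E'] at [p], hence in the line at [p], expressed in the basis e, A e, B e.
    [explicit_form] identifies it with a Veronese vector. *)
Definition profile (p : plane) : 'M[C]_3 :=
  let z := Z p in let u := z^* in let b := 1 - 2^-1 * mb 0 * u in
  (b * b^* - 2^-1 * l 0 * (z * u)) *: P0 + (z * b) *: (A0 *m P0) + (u * b^*) *: (B0 *m P0).

Let z1 := @dzD R. Let z2 := @dzM R. Let b1 := @dbD R. Let b2 := @dbM R.
Let pp := PsPs hf 0. Let ab := PABP_Ps hf 0. Let ba := PBAP_Ps hf 0. Let q0 := Q0_Ps hf 0.
Let q0' := Q_sym q0. Let aa := PAAP_Ps hf 0. Let bb := PBBP_Ps hf 0. Let kl := lamVK hf 0.

Lemma half2C : (2^-1 : C) + 2^-1 = 1.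
Proof. by field. Qed.

Lemma kl0 : k 0 * l 0 = 1.
Proof. exact (congr1 (fun g : S => g 0) kl). Qed.

Lemma lamJ0 : (l 0)^* = l 0.
Proof. exact (congr1 (fun g : S => g 0) (sJ_lam hf 0)). Qed.

Lemma evM_eq x (X Y W : 'M[S]_3) : X * Y = W -> evM x X *m evM x Y = evM x W.
Proof. by move=> <-; rewrite evMM. Qed.

Lemma evM_eq0 (X Y : 'M[S]_3) : X * Y = 0 -> evM 0 X *m evM 0 Y = 0.
Proof. by move/(evM_eq 0); rewrite evM0. Qed.

Lemma evM_eqZ (X Y W : 'M[S]_3) c : X * Y = c *: W -> evM 0 X *m evM 0 Y = c 0 *: evM 0 W.
Proof. by move/(evM_eq 0); rewrite evMZ. Qed.

Lemma evM_eqN (X Y W : 'M[S]_3) : X * Y = - W -> evM 0 X *m evM 0 Y = - evM 0 W.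
Proof. by move/(evM_eq 0); rewrite evMN. Qed.

Lemma opF_P0 : evM 0 F *m P0 = 2 *: P0.
Proof.
have <- : ev 0 (2 : S) = 2 := rmorph_nat (ev 0) 2.
exact (evM_eqZ (opF_P pp)).
Qed.

Lemma E_profile p : evM p E *m profile p = 0.
Proof.
rewrite (evM_quartic (E_formula hf p)).
have -> : star E = E' := star_E hf; have -> : star N = N' := star_N hf.
rewrite /profile /= -!evMM.
exact (quartic_kills (Z p) (Z p)^* _ _ kl0 half2C
 (evM_eq0 (opE_P z1 z2 pp aa _)) (evM_eq0 (opE_AP z1 z2 pp aa _))
 (evM_eqZ (opE_BP z1 z2 b1 b2 pp ab ba q0 kl))
 (evM_eqZ (opN_P _ _ _)) (evM_eq0 (opN_AP z1 z2 pp aa _)) (evM_eq 0 (opN_BP z1 z2 b1 b2 pp ab kl))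
 opF_P0 (evM_eqN (opF_AP z1 z2 pp)) (evM_eqN (opF_AP b1 b2 pp))
 (evM_eqZ (opN_P _ _ _)) (evM_eq 0 (opN_BP b1 b2 z1 z2 pp ba kl)) (evM_eq0 (opN_AP b1 b2 pp bb _))
 (evM_eq0 (opE_P b1 b2 pp bb _)) (evM_eqZ (opE_BP b1 b2 z1 z2 pp ba ab q0' kl))
 (evM_eq0 (opE_AP b1 b2 pp bb _))).
Qed.

Lemma star_F : star F = F.
Proof. by rewrite starD starN star1 mulrS mulr2n !starD star_Ps. Qed.

(** Taking adjoints exchanges z with its conjugate and [A] with [B], so [quartic_kills] is used with
    all the pairs interchanged. *)
Lemma star_E_profile p : evM p E' *m profile p = 0.
Proof.
have <- : star E = E' := star_E hf.
have h2J : (2^-1 : C)^* = 2^-1 by rewrite fmorphV rmorph_nat.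
rewrite (evM_quartic_star h2J lamJ0 star_F (E_formula hf p)).
have -> : star E = E' := star_E hf; have -> : star N = N' := star_N hf.
rewrite /profile; set u := (Z p)^*; set b := 1 - _; rewrite -!evMM.
rewrite [X in _ *m X]addrAC [b * b^*]mulrC [Z p * u]mulrC -[Z p]conjCK -/u.
move: u b => u b.
exact (quartic_kills u u^* _ _ kl0 half2C
 (evM_eq0 (opE_P b1 b2 pp bb _)) (evM_eq0 (opE_AP b1 b2 pp bb _))
 (evM_eqZ (opE_BP b1 b2 z1 z2 pp ba ab q0' kl))
 (evM_eqZ (opN_P _ _ _)) (evM_eq0 (opN_AP b1 b2 pp bb _)) (evM_eq 0 (opN_BP b1 b2 z1 z2 pp ba kl))
 opF_P0 (evM_eqN (opF_AP b1 b2 pp)) (evM_eqN (opF_AP z1 z2 pp))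
 (evM_eqZ (opN_P _ _ _)) (evM_eq 0 (opN_BP z1 z2 b1 b2 pp ab kl)) (evM_eq0 (opN_AP z1 z2 pp aa _))
 (evM_eq0 (opE_P z1 z2 pp aa _)) (evM_eqZ (opE_BP z1 z2 b1 b2 pp ab ba q0 kl))
 (evM_eq0 (opE_AP z1 z2 pp aa _))).
Qed.

Lemma profile_line p : evM p P *m profile p = profile p.
Proof.
have k0 : k p != 0.
  have klp : k p * l p = 1 := congr1 (fun g : S => g p) kl.
  by apply: contra_eq_neq klp => ->; rewrite mul0r eq_sym oner_eq0.
have h := evM_ker p (opE_opE z1 z2 b1 b2 pp ab ba q0 kl).
exact (ker_pair (expf_neq0 2 k0) h (E_profile p) (star_E_profile p)).
Qed.

Lemma explicit_form : exists (U : 'M[C]_3) (s c : C), [/\ U \is unitarymx, s != 0 &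
  forall p, line (f (unchart 0 p)) = <[U *m veronese (s * Z p) (1 - c * Z p)]>%VS].
Proof.
pose g := generator (f (unchart 0 (0 : plane))); have g0 : g != 0 := generator_neq0 _.
have [r r0 Er] := lam_ev hf 0 0.
pose nr : R := Num.sqrt (complex.Re (hdot g g)).
have ng : nr%:C%C * nr%:C%C = hdot g g.
  have := hdot_ge0 g; rewrite lecE /= => /andP[/eqP im re].
  rewrite -rmorphM -expr2 sqr_sqrtr//; apply/eqP.
  by rewrite eq_complex /= im !eqxx.
have n0 : nr%:C%C != 0 :> C.
  by apply: contra_neq g0 => h; apply/eqP; rewrite -hdot_eq0 -ng h mul0r.
have nJ : (nr%:C%C : C)^* = nr%:C%C := conjc_real nr.
pose e := (nr%:C%C)^-1 *: g.
have ee : hdot e e = 1.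
  by rewrite hdotZl hdotZr fmorphV /= nJ -ng mulrA mulrACA mulVf// mulr1.
have Pe : P0 *m e = e by rewrite evM_Ps /Pf /gen -/g /e -scalemxAr proj_id.
have hP : P0^t* = P0 by rewrite -evM_star star_Ps.
have hA : A0^t* = B0 by rewrite -evM_star starA.
have hB : B0^t* = A0 by rewrite -hA adjK.
have AAe : A0 *m (A0 *m e) = 0.
  by rewrite -{1}Pe !mulmxA -!evMM (AAP z1 z2 pp aa) evM0 mul0mx.
have BAe : B0 *m (A0 *m e) = l 0 *: e.
  by rewrite -{1}Pe !mulmxA -!evMM (BAP z1 z2 b1 b2 pp ba) evMZ -scalemxAl Pe.
have ABe : A0 *m (B0 *m e) = l 0 *: e.
  by rewrite -{1}Pe !mulmxA -!evMM (ABP z1 z2 b1 b2 pp ab) evMZ -scalemxAl Pe.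
have eX (X : 'M[C]_3) : P0 *m X *m P0 = 0 -> hdot (X *m e) e = 0.
  by move=> PXP; rewrite -{1 2}Pe -{2}hP -hdot_adj !mulmxA PXP mul0mx hdot0l.
(* The common length of A e and B e, by which they are divided to make the frame orthonormal. *)
pose sg : C := (Num.sqrt r)%:C%C.
have sgJ : sg^* = sg := conjc_real _.
have sg2 : sg ^+ 2 = l 0 by rewrite Er -rmorphXn sqr_sqrtr// ltW.
have sg0 : sg != 0.
  by apply: contraTneq (lam_neq0 hf 0 0) => h; rewrite -sg2 h expr0n /= eqxx.
pose U := frame sg e (A0 *m e) (B0 *m e).
have Uu : U \is unitarymx.
  apply: frame_unitary => //.
  - by rewrite hdot_adj hA BAe hdotZr ee mulr1 lamJ0 sg2.
  - by rewrite hdot_adj hB ABe hdotZr ee mulr1 lamJ0 sg2.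
  - by apply: eX; rewrite -!evMM (PAP z1 z2 pp) evM0.
  - by apply: eX; rewrite -!evMM (PBP b1 b2 pp) evM0.
  - by rewrite -hA -hdot_adj AAe hdot0l.
(* This [s] makes [a * a^*] equal to the term [2^-1 * l 0 * (z * u)] of [profile]; the conjugate in
   [c] turns the [b] of [profile] into the conjugate of the second argument of [veronese]. *)
exists U, (sg / rt2 R), (2^-1 * mb 0)^*; split=> //.
  by rewrite mulf_neq0// invr_eq0 rt2_neq0.
move=> p; set a := sg / rt2 R * Z p; set b := 1 - _.
have Ew : U *m veronese a b = profile p *m e.
  rewrite frame_mul /profile !mulmxDl -!scalemxAl -!mulmxA Pe.
  have -> : 1 - 2^-1 * mb 0 * (Z p)^* = b^*.
    by rewrite rmorphB rmorph1 rmorphM /= conjCK.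
  have rs : rt2 R * (sg / rt2 R) = sg by rewrite mulrCA divff ?mulr1// rt2_neq0.
  have aJ : a^* = sg / rt2 R * (Z p)^*.
    by rewrite rmorphM rmorphM fmorphV /= rt2J sgJ.
  have aa2 : a * a^* = 2^-1 * l 0 * (Z p * (Z p)^*).
    rewrite aJ mulrACA -sg2 -rt2_sq; congr (_ * _); move: (rt2_neq0 R) => ?; by field.
  have c1 : sg^-1 * (rt2 R * a * b^*) = Z p * b^*.
    by rewrite /a [rt2 R * _]mulrA rs !mulrA mulVf ?mul1r.
  have c2 : sg^-1 * (rt2 R * a^* * b) = (Z p)^* * b.
    by rewrite aJ [rt2 R * _]mulrA rs !mulrA mulVf ?mul1r.
  by rewrite c1 c2 conjCK aa2 [b * b^*]mulrC [X in X + _]addrC.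
apply: line_proj.
  apply/eqP => h; have : veronese a b = 0.
    by rewrite -[LHS]mul1mx -(mulmx1C (unitarymxP Uu)) -mulmxA h mulmx0.
  move=> /veronese_eq0[/eqP]; rewrite /a !mulf_eq0 invr_eq0 (negbTE sg0) (negbTE (rt2_neq0 R)).
  rewrite !orFb => /eqP z0;  by rewrite /b z0 mulr0 subr0 => /eqP; rewrite oner_eq0.
by rewrite Ew mulmxA -[proj _](evM_Ps hf 0 p) profile_line.
Qed.

End Explicit.

(** * Extension over the point at infinity *)

Section Global.
Variables (R : realType) (f : S2 R -> CP R 2).
Local Notation C := R[i].
Local Notation plane := 'cV[R]_(1 + 1).
Local Notation S := (sfun R).
Local Notation Z := (Zf R).

Lemma sfun_punctured (g : S) : (forall q, q != 0 -> g q = 0) -> g 0 = 0.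
Proof.
move=> g0; apply/eqP; rewrite eq_complex /=.
have H (e : R) : 0 < e -> `|complex.Re (g 0)| < e /\ `|complex.Im (g 0)| < e.
  move=> e0; have [d d0 h] := sfun_cont0 g 0 e0.
  pose y : plane := (2^-1 * d) *: @ex R.
  have y0 : y != 0.
    by apply/eqP => /(congr1 (fun M : plane => M 0 0)); rewrite !mxE !eqxx /=; lra.
  have : `|0 - y| < d.
    rewrite sub0r normrN; apply: norm_plane_lt => //.
      by rewrite !mxE /= mulr1 gtr0_norm; lra.
    by rewrite !mxE /= mulr0 normr0.
  by move=> /h; rewrite (g0 _ y0) /= !subr0.
have Z (x : R) : (forall e, 0 < e -> `|x| < e) -> x == 0.
  by move=> hx; apply/negPn/negP => x0; have := hx `|x|; rewrite ltxx normr_gt0 => /(_ x0).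
by apply/andP; split; apply: Z => e /H[].
Qed.

Lemma veroneseZ (l a b : C) : veronese (l * a) (l * b) = (l * l^*) *: veronese a b.
Proof.
apply/matrixP => i j; rewrite (ord1 j) !mxE; case: i => -[|[|[|//]]] hi /=; rewrite !rmorphM /=.
all: move: (l^*) (a^*) (b^*) => l' a' b'; ring.
Qed.

Lemma line_mem n (L : CP R n) w : w \in line L -> proj (generator L) *m w = w.
Proof.
rewrite line_generator => /vlineP[k ->]; rewrite -scalemxAr proj_id//; exact: generator_neq0.
Qed.

Hypothesis hf : minimal_lagrangian_immersion f.

(** This is the only point missed by the first chart. Once [veroneseZ] has cleared the denominators,
    the expected vector is smooth in the second chart; its component orthogonal to the line vanishes
    off the origin, hence at the origin by continuity. *)
Lemma at_infinity (U : 'M[C]_3) (s c : C) : U \is unitarymx -> s != 0 ->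
  (forall p, line (f (unchart 0 p)) = <[U *m veronese (s * Z p) (1 - c * Z p)]>%VS) ->
  line (f (unchart 1 0)) = <[U *m veronese s (- c)]>%VS.
Proof.
move=> Uu s0 h.
pose b : S := Z - sC c.
pose V : 'cV[S]_3 := \col_i
  [:: sC (rt2 R * s) * sJ b; b * sJ b - sC (s * s^*); sC (rt2 R * s^*) * b]`_i.
have EV q : evM q V = veronese s (Z q - c).
  by apply/matrixP => i j; rewrite (ord1 j) !mxE; case: i => -[|[|[|//]]] hi /=.
pose G : 'cV[S]_3 := (1 - Ps hf 1) *m (map_mx (@sC R) U *m V).
have EG q : evM q G = (1 - Pf f 1 q) *m (U *m veronese s (Z q - c)).
  rewrite !evM_mul EV evMD evMN evM1 evM_Ps; congr (_ *m (_ *m _)).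
  by apply/matrixP => i j; rewrite !mxE.
have G0 : evM 0 G = 0.
  apply/matrixP => i j; rewrite [RHS]mxE [LHS]mxE; apply: sfun_punctured => q q0.
  suff E : evM q G = 0 by have := congr1 (fun M : 'cV[C]_3 => M i j) E; rewrite mxE [RHS]mxE.
  rewrite EG; have Eq : unchart 1 q = unchart 0 (invp q) :> S2 R.
    by rewrite (unchart_invp (invp_neq0 q0)) invpK.
  have Zi : Z (invp q) = (Z q)^-1 by rewrite /invp Zf_pl.
  rewrite mulmxBl mul1mx; apply/eqP; rewrite subr_eq0 eq_sym; apply/eqP.
  have z0 : Z q != 0 by rewrite Zf_eq0.
  apply: line_mem; rewrite Eq h Zi.
  have -> : s / Z q = (Z q)^-1 * s by rewrite mulrC.
  have -> : 1 - c / Z q = (Z q)^-1 * (Z q - c) by rewrite mulrBr mulVf// mulrC.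
  by rewrite veroneseZ -scalemxAr vlineZ ?memv_line// mulf_neq0 ?conjC_eq0 ?invr_eq0.
have Z0 : Z 0 = 0 by apply/eqP; rewrite Zf_eq0.
apply: line_proj.
  apply/eqP => E; have : veronese s (- c) = 0.
    by rewrite -[LHS]mul1mx -(mulmx1C (unitarymxP Uu)) -mulmxA E mulmx0.
  by case/veronese_eq0 => /eqP; rewrite (negbTE s0).
have := G0; rewrite EG mulmxBl mul1mx Z0 sub0r => /eqP.
by rewrite subr_eq0 => /eqP <-.
Qed.

Lemma unchart_chart n (L : CP R n) k : generator L k 0 != 0 -> unchart k (chart k L) = L.
Proof.
move=> g0; apply: val_inj; rewrite -[RHS]/(line L) line_generator /=.
by rewrite -/(point k (chart k L)) point_chart// vlineZ// invr_eq0.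
Qed.

Definition veronese2 (w : 'cV[C]_2) : 'cV[C]_3 := veronese (w 0 0) (w 1 0).

Lemma veronese2Z l w : veronese2 (l *: w) = (l * l^*) *: veronese2 w.
Proof. by rewrite /veronese2 -veroneseZ; congr (veronese _ _); rewrite mxE. Qed.

Lemma global_form : exists (U : 'M[C]_3) (H : 'M[C]_2), [/\ U \is unitarymx, H \in unitmx &
  forall (L : S2 R) v, v != 0 -> v \in line L ->
    line (f L) = <[U *m veronese2 (H *m v)]>%VS].
Proof.
have [U [s [c [Uu s0 h]]]] := explicit_form hf.
have h1 := at_infinity Uu s0 h.
pose H : 'M[C]_2 := \matrix_(i, j) (if i == 0 then if j == 0 then 0 else s else
  if j == 0 then 1 else - c).
have EH (v : 'cV[C]_2) : veronese2 (H *m v) = veronese (s * v 1 0) (v 0 0 - c * v 1 0).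
  rewrite /veronese2 !mxE !big_ord_recl !big_ord0 !mxE /= mul0r add0r mul1r !addr0 mulNr.
  by congr (veronese (_ * v _ 0) (v _ 0 - _ * v _ 0)); exact: val_inj.
exists U, H; split=> //.
  rewrite unitmxE unitfE (expand_det_row _ 0) big_ord_recl big_ord1 /cofactor !mxE /=.
  by rewrite mul0r add0r det_mx11 !mxE /= mulf_neq0// mulf_neq0 ?expf_neq0 ?oppr_eq0 ?oner_eq0.
(* Rescaling [v] rescales [veronese2 (H *m v)] by a nonzero factor, so one generator of each line is
   enough. *)
suff key (L : S2 R) : exists2 v : 'cV[C]_2, line L = <[v]>%VS &
    line (f L) = <[U *m veronese2 (H *m v)]>%VS.
  move=> L v v0 vL; have [w Lw ->] := key L.
  move: vL; rewrite Lw => /vlineP[k E].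
  have k0 : k != 0 by apply: contraNneq v0 => k0; rewrite E k0 scale0r.
  by rewrite E -scalemxAr veronese2Z -scalemxAr vlineZ// mulf_neq0 ?conjC_eq0.
have [g0|g0] := eqVneq (generator L 0 0) 0; last first.
  rewrite -(unchart_chart g0); set p := chart 0 L.
  exists (point 0 p); first by [].
  by rewrite h EH [point 0 p 0 0]insert_k [point 0 p 1 0]insert01 of_real_Zf.
have g1 : generator L 1 0 != 0.
  have [i gi] := vec_neq0 (generator_neq0 L).
  by case: (ord2P i) gi => ->; rewrite ?g0 ?eqxx.
have p0 : chart 1 L = 0.
  apply/eqP; rewrite -Zf_eq0 -of_real_Zf -(insert10 1) -/(point 1 _) point_chart// mxE g0.
  by rewrite mulr0.
rewrite -(unchart_chart g1) p0; exists (point 1 0); first by [].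
rewrite h1 EH [point 1 0 1 0]insert_k [point 1 0 0 0]insert10 of_real_Zf.
by rewrite (_ : Z 0 = 0) ?sub0r ?mulr1//; apply/eqP; rewrite Zf_eq0.
Qed.

End Global.

(** * Projective transformations *)

Lemma open_csmooth_neq0 (R : realType) (V : normedModType R) (g : V -> R[i]) :
  csmooth setT g -> open [set x | g x != 0].
Proof.
move=> [sR sI].
rewrite (_ : [set x | _] = (fun x => complex.Re (g x)) @^-1` [set y : R | y != 0] `|`
  (fun x => complex.Im (g x)) @^-1` [set y : R | y != 0]); last first.
  apply/seteqP; split => x /=; rewrite eq_complex negb_and /=; first by move/orP.
  by move=> h; apply/orP.
by apply: openU; apply: open_comp; rewrite ?open_neq// => x _;
  [exact: (smooth_on_cont sR I)|exact: (smooth_on_cont sI I)].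
Qed.

Lemma smooth_on_point (R : realType) (V : normedModType R) n (k : 'I_n.+1) (U : set V)
    (W : V -> 'cV[R]_(n + n)) :
  open U -> msmooth U (fun x => point k (W x)) -> smooth_on U W.
Proof.
move=> oU sW; apply/(smooth_on_mx _ oU) => i j; rewrite (ord1 j).
have [a ->|a ->] := split_ordP i; have [sR sI] := sW (lift k a) 0.
  by apply: (smooth_on_eq oU _ sR) => x _; rewrite insert_lift of_realE.
by apply: (smooth_on_eq oU _ sI) => x _; rewrite insert_lift of_realE.
Qed.

(** Scaling the base vector and adding multiples of it to the tangent vectors are the changes of
    representative on projective space; by this invariance the metric can be computed from any
    lift. *)
Lemma fs_herm_scale (R : realType) n (v a b : 'cV[R[i]]_n) (c x y : R[i]) : v != 0 -> c != 0 ->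
  fs_herm (c *: v) (x *: v + c *: a) (y *: v + c *: b) = fs_herm v a b.
Proof.
rewrite -hdot_eq0 => v0 c0; have cJ0 : c^* != 0 by rewrite conjC_eq0.
rewrite /fs_herm !(hdotDl, hdotDr, hdotZl, hdotZr).
move: (hdot v v) (hdot a b) (hdot a v) (hdot v b) v0 (c^*) cJ0 (x^*) (y^*)
  => s t u w s0 c' c'0 x' y'.
by field; rewrite ?s0 ?c0 ?c'0.
Qed.

Lemma tvec_inj (R : realType) n (k : 'I_n.+1) : injective (@tvec R n k).
Proof.
move=> a b E; apply/eqP; rewrite -subr_eq0; apply/eqP/(@tvec_eq0 _ _ k).
by rewrite -[- b]scaleN1r tvecD tvecZ E rmorphN1 scaleN1r subrr.
Qed.

Section ProjectiveMap.
Variables (R : realType) (n : nat) (A : 'M[R[i]]_n.+1).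
Local Notation C := R[i].
Hypothesis Au : A \in unitmx.

Lemma mul_unit_neq0 (v : 'cV[C]_n.+1) : v != 0 -> A *m v != 0.
Proof.
by apply: contra_neq => h; rewrite -[v]mul1mx -(mulVmx Au) -mulmxA h mulmx0.
Qed.

Lemma limg_mulmx (L : CP R n) v : line L = <[v]>%VS ->
  (linfun (mulmx A) @: line L)%VS = <[A *m v]>%VS.
Proof. by move=> ->; rewrite limg_line lfunE. Qed.

Lemma dim_cpmap (L : CP R n) : \dim (linfun (mulmx A) @: line L)%VS == 1%N.
Proof.
rewrite (limg_mulmx (line_generator L)) dim_vline mul_unit_neq0//; exact: generator_neq0.
Qed.

Definition cpmap (L : CP R n) : CP R n :=
  exist (fun L' : {vspace 'cV[C]_n.+1} => \dim L' == 1%N) _ (dim_cpmap L).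

Lemma line_cpmap L v : line L = <[v]>%VS -> line (cpmap L) = <[A *m v]>%VS.
Proof. exact: limg_mulmx. Qed.

Lemma generator_scale (L : CP R n) v : line L = <[v]>%VS ->
  exists2 c, c != 0 & generator L = c *: v.
Proof.
move=> E; have : generator L \in <[v]>%VS by rewrite -E line_generator memv_line.
move=> /vlineP[c h]; exists c => //; apply: contraNneq (generator_neq0 L) => c0.
by rewrite h c0 scale0r.
Qed.

Lemma chart_domE (L : CP R n) v k : line L = <[v]>%VS -> chart_dom k L <-> v k 0 != 0.
Proof.
by move=> /generator_scale[c c0 h]; rewrite /chart_dom /= h mxE mulf_eq0 (negbTE c0).
Qed.

Lemma point_chartE (L : CP R n) v k : line L = <[v]>%VS -> v k 0 != 0 ->
  point k (chart k L) = (v k 0)^-1 *: v.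
Proof.
move=> E vk; have h : chart_dom k L by apply/(chart_domE k E).
rewrite (point_chart h); have [c c0 ->] := generator_scale E.
by rewrite mxE scalerA invfM mulrAC mulVf// mul1r.
Qed.

Variables (j k : 'I_n.+1).
Local Notation w := (local_rep cpmap j k).
Local Notation V := ('cV[R]_(n + n)).

Definition num (x : V) : 'cV[C]_n.+1 := A *m point j x.

Lemma num_neq0 x : num x != 0.
Proof. by rewrite mul_unit_neq0// point_neq0. Qed.

Lemma line_num x : line (cpmap (unchart j x)) = <[num x]>%VS.
Proof. exact: line_cpmap. Qed.

Lemma local_dom_cpmap : local_dom cpmap j k = [set x | num x k 0 != 0].
Proof. by apply/seteqP; split => x /(chart_domE k (line_num x)). Qed.

Lemma msmooth_num : msmooth setT num.
Proof. apply: msmoothM; [exact: openT|exact: msmooth_cst|exact: msmooth_point]. Qed.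

Lemma mcD_num v x : mcD v num x = A *m tvec j v.
Proof.
by rewrite (mcDM openT v (msmooth_cst _ A) (@msmooth_point R n j) I) mcD_cst mul0mx add0r mcD_point.
Qed.

Local Notation U := [set x | num x k 0 != 0].

Lemma open_cpmap_dom : open U.
Proof. apply: open_csmooth_neq0; exact: msmooth_num. Qed.

Let sN : msmooth U num.
Proof. by move=> i l; apply: csmoothS (subsetT _) (msmooth_num i l). Qed.

Lemma csmooth_inv_num : csmooth U (fun x => (num x k 0)^-1).
Proof. by apply: csmoothV; [exact: open_cpmap_dom| |exact: sN]. Qed.

Lemma point_local x : U x -> point k (w x) = (num x k 0)^-1 *: num x.
Proof. by move=> h; rewrite /local_rep (point_chartE (line_num x) h). Qed.

Lemma smooth_local : smooth_on U w.
Proof.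
apply: (smooth_on_point (k := k) open_cpmap_dom) => i l.
apply: (csmooth_eq open_cpmap_dom _ (msmoothZ open_cpmap_dom csmooth_inv_num sN i l)) => x Ux.
by rewrite point_local.
Qed.

Lemma tvec_local v x : U x -> tvec k ('D_v w x) =
  (- (A *m tvec j v) k 0 / num x k 0 ^+ 2) *: num x + (num x k 0)^-1 *: (A *m tvec j v).
Proof.
move=> Ux; rewrite -(mcD_insert k open_cpmap_dom smooth_local 1 v Ux).
rewrite (mcD_eq open_cpmap_dom v Ux point_local).
rewrite (mcDZ open_cpmap_dom v csmooth_inv_num sN Ux) mcD_num.
have E : cD v (fun x => num x k 0) x = (A *m tvec j v) k 0 by rewrite -(mcD_num v x) [RHS]mxE.
by rewrite (cDV v open_cpmap_dom _ (sN k 0) Ux)// E.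
Qed.

(** The right-hand side of [tvec_local] is complex linear in [tvec j v]. *)
Lemma derive_cplxJ v x : U x -> 'D_(cplxJ v) w x = cplxJ ('D_v w x).
Proof.
move=> Ux; have E1 := tvec_local (cplxJ v) Ux; have E2 := tvec_local v Ux.
have E3 := tvecJ k ('D_v w x); apply: (@tvec_inj R n k).
refine (etrans E1 (esym (etrans E3 (etrans (congr1 (fun t => 'i *: t) E2) (esym _))))).
rewrite {E1 E2 E3} tvecJ -scalemxAr.
move: (A *m tvec j v) (num x) => a b.
rewrite [X in - X]mxE scalerDr !scalerA; congr (_ *: _ + _ *: _); last exact: mulrC.
by rewrite mulrA mulrN.
Qed.

Lemma isometry_local x u v : A \is unitarymx -> U x ->
  pullback (fubini_study k) w x u v = fubini_study j x u v.
Proof.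
move=> AU Ux; have H (du dv : V) :
    tvec k du = (- (A *m tvec j u) k 0 / num x k 0 ^+ 2) *: num x +
      (num x k 0)^-1 *: (A *m tvec j u) ->
    tvec k dv = (- (A *m tvec j v) k 0 / num x k 0 ^+ 2) *: num x +
      (num x k 0)^-1 *: (A *m tvec j v) ->
    fs_herm (point k (w x)) (tvec k du) (tvec k dv) = fs_herm (point j x) (tvec j u) (tvec j v).
  move=> Eu Ev; rewrite Eu Ev (point_local Ux) fs_herm_scale ?num_neq0 ?invr_eq0//.
  by rewrite /fs_herm !hdot_mul.
exact (congr1 (@complex.Re R) (H _ _ (tvec_local u Ux) (tvec_local v Ux))).
Qed.

End ProjectiveMap.

Section Automorphisms.
Variables (R : realType) (n : nat).
Local Notation C := R[i].

Lemma cpmapK (A B : 'M[C]_n.+1) (Au : A \in unitmx) (Bu : B \in unitmx) :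
  B *m A = 1%:M -> cancel (@cpmap R n A Au) (cpmap Bu).
Proof.
move=> BA L; apply: val_inj; rewrite -[LHS]/(line _) -[RHS]/(line L).
by rewrite (line_cpmap Bu (line_cpmap Au (line_generator L))) mulmxA BA mul1mx -line_generator.
Qed.

Lemma smooth_cpmap (A : 'M[C]_n.+1) (Au : A \in unitmx) : smooth (cpmap Au).
Proof.
by move=> j k; rewrite local_dom_cpmap; split; [exact: open_cpmap_dom|exact: smooth_local].
Qed.

Lemma isometry_cpmap (A : 'M[C]_n.+1) (Au : A \in unitmx) : A \is unitarymx ->
  fs_isometry (cpmap Au).
Proof.
move=> AU; split; first exact: smooth_cpmap.
  have Bu : invmx A \in unitmx by rewrite unitmx_inv.
  exists (cpmap Bu); split; [exact: cpmapK (mulVmx Au)|exact: cpmapK (mulmxV Au)|].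
  exact: smooth_cpmap.
by move=> j k x; rewrite local_dom_cpmap => Ux u v; exact: isometry_local.
Qed.

End Automorphisms.

Lemma biholomorphic_cpmap (R : realType) (A : 'M[R[i]]_2) (Au : A \in unitmx) :
  biholomorphic (cpmap Au).
Proof.
have hol (B : 'M[R[i]]_2) (Bu : B \in unitmx) : holomorphic (cpmap Bu).
  move=> j k; rewrite local_dom_cpmap; split; first exact: open_cpmap_dom.
  move=> x Ux; have d :=
    smooth_differentiable_cV (@open_cpmap_dom R 1 B j k) (@smooth_local R 1 B Bu j k) Ux.
  split=> // v; have E := deriveE (cplxJ v) d; have E' := deriveE v d.
  exact (etrans (esym E) (etrans (derive_cplxJ Bu v Ux) (congr1 (@cplxJ R 1) E'))).
have Bu : invmx A \in unitmx by rewrite unitmx_inv.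
by exists (cpmap Bu); split; [exact: cpmapK (mulVmx Au)|exact: cpmapK (mulmxV Au)|..].
Qed.

(** * Equivariance and reality *)

Definition mx3 (K : nzRingType) (s : seq (seq K)) : 'M[K]_3 := \matrix_(i, j) (nth [::] s i)`_j.

(** The three-dimensional irreducible representation, in the basis of [veronese], at the element of
    SU(2) with first column (x, y). The conjugates [x'], [y'] are independent variables and [r] is a
    square root of 2, so its properties are polynomial identities. *)
Definition su3 (K : nzRingType) (r x y x' y' : K) : 'M[K]_3 :=
  mx3 [:: [:: x ^+ 2; - (r * x * y'); - y' ^+ 2];
          [:: r * x * y; x * x' - y * y'; r * x' * y'];
          [:: - y ^+ 2; - (r * x' * y); x' ^+ 2]].

(** The device of [eq_mod_half] modulo [r * r - 2], with the quotient as witness [c]. *)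
Lemma eq_mod_sq (K : comNzRingType) (r a b c : K) : r * r = 2 -> a = b + (r * r - 2) * c -> a = b.
Proof. by move=> -> ->; rewrite subrr mul0r addr0. Qed.

Lemma su3_mul (K : comNzRingType) (r x y x' y' : K) : r * r = 2 -> x * x' + y * y' = 1 ->
  su3 r x y x' y' *m su3 r x' (- y) x (- y') = 1%:M.
Proof.
move=> r2 n1; apply/matrixP => i j; rewrite !mxE !big_ord_recl big_ord0 !mxE.
case: i => -[|[|[|//]]] hi; case: j => -[|[|[|//]]] hj; rewrite /= ?mulr1n ?mulr0n.
- transitivity ((x * x' + y * y') ^+ 2); last by rewrite n1 expr1n.
  by apply: (eq_mod_sq (c := x * x' * y * y') r2); ring.
- by ring.
- by apply: (eq_mod_sq (c := x ^+ 2 * y' ^+ 2) r2); ring.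
- by ring.
- transitivity ((x * x' + y * y') ^+ 2); last by rewrite n1 expr1n.
  by apply: (eq_mod_sq (c := 2 * x * x' * y * y') r2); ring.
- by ring.
- by apply: (eq_mod_sq (c := x' ^+ 2 * y ^+ 2) r2); ring.
- by ring.
- transitivity ((x * x' + y * y') ^+ 2); last by rewrite n1 expr1n.
  by apply: (eq_mod_sq (c := x * x' * y * y') r2); ring.
Qed.

Lemma su3_det (K : comNzRingType) (r x y x' y' : K) : r * r = 2 -> x * x' + y * y' = 1 ->
  \det (su3 r x y x' y') = 1.
Proof.
move=> r2 n1; rewrite (expand_det_row _ 0) !big_ord_recl big_ord0 /cofactor.
rewrite !(expand_det_row _ 0) !big_ord_recl !big_ord0 /cofactor !det_mx11 !mxE /=.
transitivity ((x * x' + y * y') ^+ 3); last by rewrite n1 expr1n.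
apply: (eq_mod_sq (c := 2 * x ^+ 2 * x' ^+ 2 * y * y' + 2 * x * x' * y ^+ 2 * y' ^+ 2) r2).
by rewrite /bump /=; ring.
Qed.

(* The first column of the element of SU(2) sending [(a, b) / n] to [(c, e) / m]; primes stand
   for conjugates. *)
Lemma su2_transitive_algebra (K : fieldType) (a a' b b' c c' e e' n m : K) :
  n != 0 -> m != 0 -> n * n = a * a' + b * b' -> m * m = c * c' + e * e' ->
  [/\ (c * a' + e' * b) / (m * n) * ((c' * a + e * b') / (m * n)) +
      (e * a' - c' * b) / (m * n) * ((e' * a - c * b') / (m * n)) = 1,
      (c * a' + e' * b) / (m * n) * a - (e' * a - c * b') / (m * n) * b = n / m * c &
      (e * a' - c' * b) / (m * n) * a + (c' * a + e * b') / (m * n) * b = n / m * e].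
Proof.
move=> n0 m0 nn mm; split.
- transitivity ((a * a' + b * b') * (c * c' + e * e') / (m * m * (n * n))).
    by field; rewrite ?m0 ?n0.
  by rewrite -nn -mm; field; rewrite ?m0 ?n0.
- transitivity (c * (a * a' + b * b') / (m * n)); first by field; rewrite ?m0 ?n0.
  by rewrite -nn; field; rewrite ?m0 ?n0.
- transitivity (e * (a * a' + b * b') / (m * n)); first by field; rewrite ?m0 ?n0.
  by rewrite -nn; field; rewrite ?m0 ?n0.
Qed.

Section Rotations.
Variable R : realType.
Local Notation C := R[i].

Definition su2 (x y : C) : 'M[C]_2 :=
  \matrix_(i, j) (if i == 0 then if j == 0 then x else - y^* else if j == 0 then y else x^*).

Lemma su2_mul x y (u : 'cV[C]_2) :
  su2 x y *m u = \col_i (if i == 0 then x * u 0 0 - y^* * u 1 0 else y * u 0 0 + x^* * u 1 0).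
Proof.
apply/matrixP => i j; rewrite (ord1 j) !mxE !big_ord_recl big_ord0 !mxE /= addr0.
rewrite (_ : lift ord0 ord0 = 1); last exact: val_inj.
by case: (ord2P i) => -> /=; rewrite ?mulNr.
Qed.

Definition rotation (x y : C) : 'M[C]_3 := su3 (rt2 R) x y x^* y^*.

Lemma veronese_su2 x y (u : 'cV[C]_2) :
  veronese2 (su2 x y *m u) = rotation x y *m veronese2 u.
Proof.
rewrite su2_mul /veronese2 !mxE /=; move: (u 0 0) (u 1 0) => a b.
apply/matrixP => i j; rewrite (ord1 j) /rotation /su3 !mxE !big_ord_recl big_ord0 !mxE.
have r2 := rt2_sq R.
case: i => -[|[|[|//]]] hi /=; rewrite !(rmorphD, rmorphN, rmorphM) /= !conjCK;
  move: (x^*) (y^*) (a^*) (b^*) r2; move: (rt2 R) => r x' y' a' b' r2.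
- by ring.
- by apply: (eq_mod_sq (c := - (x * y * a * b' + x' * y' * a' * b)) r2); ring.
- by ring.
Qed.

Lemma rotation_SU x y : x * x^* + y * y^* = 1 -> SU (rotation x y).
Proof.
move=> n1; split; last exact: su3_det (rt2_sq R) n1.
apply/unitarymxP; rewrite -(su3_mul (rt2_sq R) n1); congr (_ *m _).
apply/matrixP => i j; rewrite !mxE.
case: i => -[|[|[|//]]] hi; case: j => -[|[|[|//]]] hj /=;
  rewrite !(rmorphD, rmorphN, rmorphM, rmorphXn) /= ?conjCK ?rt2J; by ring.
Qed.

Lemma su2_transitive (u u' : 'cV[C]_2) : u != 0 -> u' != 0 -> exists x y l,
  [/\ x * x^* + y * y^* = 1, l != 0 & su2 x y *m u = l *: u'].
Proof.
have norm (v : 'cV[C]_2) : v != 0 ->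
    exists n : C, [/\ n != 0, n^* = n & n * n = v 0 0 * (v 0 0)^* + v 1 0 * (v 1 0)^*].
  move=> v0; exists (sqrtC (hdot v v)); have h0 := hdot_ge0 v.
  have E : hdot v v = v 0 0 * (v 0 0)^* + v 1 0 * (v 1 0)^*.
    rewrite /hdot big_ord_recl big_ord1; congr (_ + v _ 0 * (v _ 0)^*); exact: val_inj.
  by rewrite sqrtC_eq0 hdot_eq0 v0 conj_Creal ?ger0_real ?sqrtC_ge0// -E -expr2 sqrtCK.
move=> /norm[n [n0 nJ nn]] /norm[m [m0 mJ mm]].
have [nxy ea eb] := su2_transitive_algebra n0 m0 nn mm.
exists ((u' 0 0 * (u 0 0)^* + (u' 1 0)^* * u 1 0) / (m * n)),
  ((u' 1 0 * (u 0 0)^* - (u' 0 0)^* * u 1 0) / (m * n)), (n / m).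
have J1 : ((u' 0 0 * (u 0 0)^* + (u' 1 0)^* * u 1 0) / (m * n))^* =
    ((u' 0 0)^* * u 0 0 + u' 1 0 * (u 1 0)^*) / (m * n).
  by rewrite rmorphM fmorphV rmorphD !rmorphM /= !conjCK nJ mJ.
have J2 : ((u' 1 0 * (u 0 0)^* - (u' 0 0)^* * u 1 0) / (m * n))^* =
    ((u' 1 0)^* * u 0 0 - u' 0 0 * (u 1 0)^*) / (m * n).
  by rewrite rmorphM fmorphV rmorphB !rmorphM /= !conjCK nJ mJ.
split; [by rewrite J1 J2|by rewrite mulf_neq0 ?invr_eq0|].
rewrite su2_mul J1 J2; apply/matrixP => i j; rewrite (ord1 j) !mxE.
by case: (ord2P i) => ->.
Qed.

(** It turns [veronese a b] into the Hopf map: twice the real and the imaginary part of a times the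
    conjugate of b, then |b|^2 - |a|^2. *)
Definition reality : 'M[C]_3 :=
  let s := (rt2 R)^-1 in mx3 [:: [:: s; 0; s]; [:: - 'i * s; 0; 'i * s]; [:: 0; 1; 0]].

Lemma reality_unitary : reality \is unitarymx.
Proof.
have sJ : (rt2 R)^-1^* = (rt2 R)^-1 by rewrite fmorphV /= rt2J.
have s2 : (rt2 R)^-1 * (rt2 R)^-1 = 2^-1 by rewrite -invfM rt2_sq.
have h2 := half2C R; have ii : 'i * 'i = -1 :> C by rewrite -expr2 sqrCi.
apply/unitarymxP; apply/matrixP => i j; rewrite !mxE !big_ord_recl big_ord0 !mxE.
case: i => -[|[|[|//]]] hi; case: j => -[|[|[|//]]] hj; rewrite /= ?mulr1n ?mulr0n;
  rewrite ?(rmorphM, rmorphN, rmorph0, rmorph1) /= ?sJ ?conjCi;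
  move: (rt2 R)^-1 s2 => s s2; try by ring.
- by transitivity (s * s + s * s); [ring|rewrite s2].
- by transitivity (- ('i * 'i) * (s * s + s * s)); [ring|rewrite s2 ii h2 opprK mulr1].
Qed.

Lemma reality_veronese (u : 'cV[C]_2) i :
  (((reality *m veronese2 u) i 0)^* = (reality *m veronese2 u) i 0).
Proof.
have sJ : (rt2 R)^-1^* = (rt2 R)^-1 by rewrite fmorphV /= rt2J.
rewrite /reality /veronese2; move: (u 0 0) (u 1 0) => a b; rewrite !mxE !big_ord_recl big_ord0 !mxE.
case: i => -[|[|[|//]]] hi;
  rewrite /= !(rmorphD, rmorphM, rmorphN, rmorph0, rmorph1) /= ?sJ ?conjCi ?rt2J ?conjCK; by ring.
Qed.

Lemma su2_unit x y : x * x^* + y * y^* = 1 -> su2 x y \in unitmx.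
Proof.
move=> n1; rewrite unitmxE (expand_det_row _ 0) big_ord_recl big_ord1 /cofactor !det_mx11 !mxE /=.
by rewrite expr0 mul1r expr1 mulN1r mulrN mulNr opprK [y^* * _]mulrC n1 unitr1.
Qed.

End Rotations.

Lemma adj_unitary (R : realType) n (U : 'M[R[i]]_n) : U \is unitarymx -> U^t* \is unitarymx.
Proof. by move=> Uu; apply/unitarymxP; rewrite adjK; exact: mulmx1C (unitarymxP Uu). Qed.

Theorem theorem7p2 (R : realType) (f : S2 R -> CP R 2)
    (hf : minimal_lagrangian_immersion f) :
  homogeneous f /\
  exists phi : CP R 2 -> CP R 2,
    fs_isometry phi /\ forall z : S2 R, RP (phi (f z)).
Proof.
have [U [H [Uu Hu h]]] := global_form hf; split.
  (* SU(2) is transitive on lines; the element found moves the image of [L] under [H] to that of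
     [L'], and conjugating it by [H] gives the automorphism of the sphere. *)
  move=> L L'; have [x [y [l [n1 l0 E]]]] := su2_transitive (mul_unit_neq0 Hu (generator_neq0 L))
    (mul_unit_neq0 Hu (generator_neq0 L')).
  have Gu : invmx H *m su2 x y *m H \in unitmx.
    by rewrite !unitmx_mul unitmx_inv Hu su2_unit.
  exists (cpmap Gu); last first.
    apply: val_inj; rewrite -[LHS]/(line _) -[RHS]/(line L') (line_cpmap Gu (line_generator L)).
    rewrite -!mulmxA E -scalemxAr mulmxA mulVmx// mul1mx vlineZ//.
    by rewrite line_generator.
  split; first exact: biholomorphic_cpmap.
  have [rU rD] := rotation_SU n1.
  (* Conjugation by [U] makes the rotation act on the image of [f] and keeps its determinant equal
     to 1, whatever the determinant of [U]. *)
  exists (U *m rotation x y *m U^t*).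
    split; first exact (mul_unitarymx (mul_unitarymx Uu rU) (adj_unitary Uu)).
    rewrite !det_mulmx rD mulr1 mulrC -det_mulmx.
    by rewrite (mulmx1C (unitarymxP Uu)) det1.
  move=> z; have g0 := generator_neq0 z; have gz : generator z \in line z.
    by rewrite line_generator memv_line.
  have Ez := line_cpmap Gu (line_generator z).
  rewrite (limg_mulmx _ (h z _ g0 gz)) (h _ _ (mul_unit_neq0 Gu g0)); last first.
    by rewrite Ez memv_line.
  congr (<[ _ ]>)%VS; rewrite -!mulmxA (mulmxA (U^t*)) (mulmx1C (unitarymxP Uu)) mul1mx.
  rewrite (mulmxA H) mulmxV// mul1mx -veronese_su2 //.
(* The isometry undoes [U] and then passes to the basis in which the Veronese vectors are real. *)
have Ku := mul_unitarymx (reality_unitary R) (adj_unitary Uu).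
have Ku' := unitarymx_unit Ku.
exists (cpmap Ku'); split; first exact: isometry_cpmap.
move=> z; have g0 := generator_neq0 z; have gz : generator z \in line z.
  by rewrite line_generator memv_line.
have := line_cpmap Ku' (h z _ g0 gz).
rewrite -mulmxA (mulmxA (U^t*)) (mulmx1C (unitarymxP Uu)) mul1mx.
set X := reality R *m veronese2 _ => EX.
have XE : map_mx (real_complex R) (map_mx (@complex.Re R) X) = X.
  apply/matrixP => i j; rewrite (ord1 j) 2!mxE; apply: RRe_real; apply/CrealP.
  exact: reality_veronese.
exists (map_mx (@complex.Re R) X); last by rewrite XE.
(* If the real vector were 0, the Veronese vector would be 0, and then so would
   [H *m generator z]. *)
apply: contra_neq (mul_unit_neq0 Hu g0) => X0.
have V0 : veronese2 (H *m generator z) = 0.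
  apply/eqP/negPn/negP => /(mul_unit_neq0 (unitarymx_unit (reality_unitary R))).
  by rewrite -/X -XE X0 map_mx0 eqxx.
have [e0 e1] := veronese_eq0 V0; apply/matrixP => i j; rewrite (ord1 j) [RHS]mxE.
by case: (ord2P i) => ->.
Qed.
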